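(* Let $\mathcal{W},\mathcal{V}$ be closed subspaces of $L^2(\mathbb{R})$ with $L^2(\mathbb{R})=\mathcal{W}\oplus\mathcal{V}^{\perp}$. Let $\phi,\phi_1\in L^2(\mathbb{R})$ be such that $\{T_k\phi\}_{k\in\mathbb{Z}}$ and $\{T_k\phi_1\}_{k\in\mathbb{Z}}$ are frames for $\mathcal{W}$ and $\mathcal{V}$, respectively. Let $\widetilde{\phi}\in\mathcal{V}$ be such that $\widehat{\widetilde{\phi}}=\widetilde{H}\,\widehat{\phi_1}$, where $\widetilde{H}\in\mathcal{C}^{2}_{\mathrm{per}}$. Assume $0\le\epsilon<1$. If $$\big|\overline{\widetilde{H}}(\gamma)[\widehat{\phi},\widehat{\phi_1}](\gamma)-1\big|\le\frac{\epsilon}{\|\pi_{\mathcal{W}\mathcal{V}^{\perp}}\|}\quad\text{for a.e. }\gamma\in N(\Phi)^{c},$$ then $\{T_k\widetilde{\phi}\}_{k\in\mathbb{Z}}$ is a frame for $\mathcal{V}$ such that $\{T_k\phi\}_{k\in\mathbb{Z}}$ and $\{T_k\widetilde{\phi}\}_{k\in\mathbb{Z}}$ are $\epsilon$-approximate oblique dual frames.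
   Context: $T_kf(x)=f(x-k)$ for $k\in\mathbb{Z}$. The Fourier transform is $\widehat{f}(\gamma)=\int_{\mathbb{R}}f(x)e^{-2\pi i x\gamma}\,dx$, extended to a unitary operator of $L^2(\mathbb{R})$. $\mathcal{C}^{p}_{\mathrm{per}}$ is the class of 1-periodic functions on $\mathbb{R}$ whose restriction to $[0,1)$ belongs to $L^p(0,1)$. For $\phi,\psi\in L^2(\mathbb{R})$, the 1-periodic bracket is $[\widehat{\phi},\widehat{\psi}](\gamma)=\sum_{k\in\mathbb{Z}}\widehat{\phi}(\gamma+k)\overline{\widehat{\psi}(\gamma+k)}$ (a.e. defined, complex valued); $\Phi(\gamma)=\sum_{k\in\mathbb{Z}}|\widehat{\phi}(\gamma+k)|^2$, $N(\Phi)=\{\gamma:\Phi(\gamma)=0\}$; $A^c$ is the complement of $A$ in $\mathbb{R}$. The direct sum $\mathcal{H}=\mathcal{W}\oplus\mathcal{V}^{\perp}$ ($\mathcal{H}=L^2(\mathbb{R})$; equivalently $\mathcal{H}=\mathcal{V}\oplus\mathcal{W}^{\perp}$) is not assumed orthogonal; $\pi_{\mathcal{W}\mathcal{V}^{\perp}}$ is the oblique projection onto $\mathcal{W}$ along $\mathcal{V}^{\perp}$ and $\pi_{\mathcal{V}\mathcal{W}^{\perp}}$ that onto $\mathcal{V}$ along $\mathcal{W}^{\perp}$. A family $\{f_k\}\subset\mathcal{W}$ is a frame for $\mathcal{W}$ if there are $0<\alpha\le\beta<\infty$ with $\alpha\|f\|^2\le\sum_k|\langle f,f_k\rangle|^2\le\beta\|f\|^2$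 for all $f\in\mathcal{W}$. For such $\mathcal{F}=\{f_k\}$, $T_{\mathcal{F}}\{c_k\}=\sum_kc_kf_k$ (synthesis operator on $\ell^2$) and $T_{\mathcal{F}}^{*}f=\{\langle f,f_k\rangle\}_k$. Frames $\mathcal{F}$ for $\mathcal{W}$ and $\mathcal{G}$ for $\mathcal{V}$ are $\epsilon$-approximate oblique dual frames if $\|\pi_{\mathcal{W}\mathcal{V}^{\perp}}-T_{\mathcal{F}}T_{\mathcal{G}}^{*}\|\le\epsilon$ or, equivalently, $\|\pi_{\mathcal{V}\mathcal{W}^{\perp}}-T_{\mathcal{G}}T_{\mathcal{F}}^{*}\|\le\epsilon$. *)

(* Defs.v *)
From HB Require Import structures.
From mathcomp Require Import all_boot all_order all_algebra.
From mathcomp Require Import complex.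
From mathcomp Require Import all_classical all_reals all_analysis.

Set Implicit Arguments.
Unset Strict Implicit.
Unset Printing Implicit Defensive.
Import Order.TTheory GRing.Theory Num.Theory.
Import numFieldNormedType.Exports.

Local Open Scope classical_set_scope.
Local Open Scope complex_scope.
Local Open Scope ring_scope.

Section L2.
Context {R : realType}.
Local Notation mu := (@lebesgue_measure R).
Local Notation C := R[i].
Local Notation cfun := (R -> C).
Local Notation Re := (@complex.Re R).
Local Notation Im := (@complex.Im R).
Implicit Types (f g : cfun) (u : nat -> cfun) (A B V W : set cfun).

(* The modulus of [z], as an element of [R] rather than of [R[i]]. *)
Definition cabs (z : C) : R := Re `|z|.

(* Elements of [L^p(R)] are represented by (Borel measurable) functions; two
   functions represent the same element when they are equal a.e. *)
Definition Lp (p : \bar R) : set cfun :=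
  [set f : cfun | (Re \o f \in Lfun mu p) /\ (Im \o f \in Lfun mu p)].

Definition cintegral f : C :=
  Rintegral mu setT (Re \o f) +i* Rintegral mu setT (Im \o f).

Definition inner f g : C := cintegral (fun x => f x * (g x)^*).

Definition norm2 f : R := fine 'N[mu]_2[EFin \o (cabs \o f)]%E.

Definition cvg2 u f : Prop :=
  [/\ forall n, Lp 2%:E (u n), Lp 2%:E f
    & (fun n => norm2 (u n \- f)) @ \oo --> (0 : R)].

(* Closure under [cvg2] also makes [W] invariant under a.e. equality: take a
   constant sequence. *)
Definition closed_subspace W : Prop :=
  [/\ W `<=` Lp 2%:E,
      W (cst 0),
      forall (a : C) f g, W f -> W g -> W (fun x => a * f x + g x)
    & forall u f, (forall n, W (u n)) -> cvg2 u f -> W f].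

Definition orthocompl V : set cfun :=
  [set f : cfun | Lp 2%:E f /\ forall g, V g -> inner f g = 0].

(* [L^2(R)] is the (not necessarily orthogonal) direct sum of [A] and [B]. *)
Definition L2_direct_sum A B : Prop :=
  (forall f, Lp 2%:E f ->
     exists a b, [/\ A a, B b & ae_eq mu setT f (a \+ b)]) /\
  (forall f, A f -> B f -> ae_eq mu setT f (cst 0)).

(* The projection onto [A] along [B]; the choice of the value among a.e. equal
   functions is immaterial. *)
Definition oblique_proj A B f : cfun := xget (cst 0) [set a : cfun | A a /\ B (f \- a)].

Definition opnorm (T : cfun -> cfun) : \bar R :=
  ereal_sup [set (norm2 (T f))%:E | f in [set f : cfun | Lp 2%:E f /\ norm2 f <= 1]].

Definition translate (k : int) f : cfun := fun x => f (x - k%:~R).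

(* [exp(i t)] *)
Definition cis (t : R) : C := cos t +i* sin t.

Definition fourierL1 f : cfun :=
  fun gamma => cintegral (fun x => f x * cis (- (2 * pi * x * gamma))).

(* The extension of [fourierL1] from [L^1 `&` L^2] to [L^2] by density and
   continuity. *)
Definition fourier f : cfun :=
  xget (cst 0) [set g : cfun | exists u, [/\ forall n, Lp 1 (u n), cvg2 u f
    & cvg2 (fun n => fourierL1 (u n)) g]].

(* The partial sum of [a] over the integers from [-n] to [n]. *)
Definition psumZ (a : int -> C) (n : nat) : C :=
  \sum_(i < n.*2.+1) a (i%:Z - n%:Z).

(* For an absolutely summable family, such as the one defining [bracket] at
   almost every point, this is the unordered sum. *)
Definition csumZ (a : int -> C) : C :=
  limn (Re \o psumZ a) +i* limn (Im \o psumZ a).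

Definition bracket f g : cfun :=
  fun gamma => csumZ (fun k => f (gamma + k%:~R) * (g (gamma + k%:~R))^*).

Definition periodization2 f (gamma : R) : \bar R :=
  (\esum_(k in [set: int]) ((cabs (f (gamma + k%:~R))) ^+ 2)%:E)%E.

Definition zero_set (Phi : R -> \bar R) : set R := [set gamma : R | Phi gamma = 0%E].

Definition Cper (p : \bar R) : set cfun :=
  [set H : cfun | (forall x, H (x + 1) = H x) /\ Lp p (patch (cst 0) `[0, 1[ H)].

Definition is_frame W (F : int -> cfun) : Prop :=
  (forall k, W (F k)) /\
  exists alpha beta : R, [/\ 0 < alpha, alpha <= beta
    & forall f, W f ->
        ((alpha * norm2 f ^+ 2)%:E
           <= \esum_(k in [set: int]) ((cabs (inner f (F k))) ^+ 2)%:E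
           <= (beta * norm2 f ^+ 2)%:E)%E].

(* The series is the limit in [L^2(R)] of its symmetric partial sums. It
   converges unconditionally for a frame [F] and square-summable [c]. *)
Definition synthesis (F : int -> cfun) (c : int -> C) : cfun :=
  xget (cst 0)
    [set g : cfun | cvg2 (fun n x => psumZ (fun k => c k * F k x) n) g].

Definition analysis (F : int -> cfun) f : int -> C := fun k => inner f (F k).

Definition approx_oblique_dual (eps : R) W V (F G : int -> cfun) : Prop :=
  [/\ is_frame W F, is_frame V G
    & (opnorm (fun f => (oblique_proj W (orthocompl V) f
                         \- synthesis F (analysis G f))%R) <= eps%:E)%E].

End L2.

(* Main.v *)
Require Import Defs.
From HB Require Import structures.
From mathcomp Require Import all_boot all_order all_algebra.
From mathcomp Require Import complex.
From mathcomp Require Import all_classical all_reals all_analysis.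
From mathcomp Require Import measurable_realfun.
From mathcomp Require Import zify ring lra.
Set Implicit Arguments.
Unset Strict Implicit.
Unset Printing Implicit Defensive.
Import Order.TTheory GRing.Theory Num.Theory.
Import numFieldNormedType.Exports.
Local Open Scope classical_set_scope.
Local Open Scope complex_scope.
Local Open Scope ring_scope.

(** Write [m p] for the Fourier transform of [w = sum_k c_k T_k phi], where [p]
    is the transform of [phi] and [m] the trigonometric polynomial with
    coefficients [c_k].  The analysis coefficients of [w] against
    [{T_k phit}] are the Fourier coefficients of [m conj(Ht) [p, p1]] on
    [[0, 1)], so that [w - sum_k <w, T_k phit> T_k phi] has transform
    [m (1 - conj(Ht) [p, p1]) p], and its norm is at most [eps / |pi| * |w|].
    By density this holds on [W]; since [<f, T_k phit> = <pi f, T_k phit>], it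
    bounds [pi f - T_F T_G^* f] by [eps |f|].

    Finite combinations with coefficients controlled by their norm are dense
    in [W] (frame algorithm), which makes [T_G^*] bounded on [W]; through
    [pi] it is pointwise bounded on [L^2], hence bounded by the uniform
    boundedness principle.  For the lower frame bound,
    [|v|^2 = <pi v, v> <= eps |v|^2 + <T_F T_G^* v, v>] for [v] in [V].

    The transform is only ever used through pairs [(f, g)] of limits of
    [(u_n, fourierL1 u_n)].  Plancherel's identity comes from Parseval's for
    Fourier series: for [u] of compact support, [k |-> fourierL1 u (t + k)]
    lists the Fourier coefficients of the [1]-periodization of
    [x |-> u x * cis (- 2 pi x t)]; integrate its square norm over [t]. *)

(** * Complex numbers *)

(** A priori [P = conj(Ht) [p, p1]] is only integrable on [0, 1), since [Ht] is merely
    square-integrable there. The assumed inequality makes it bounded: off [N(Phi)] it gives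
    [|P| <= 1 + eta] with [eta = eps / |pi|], and on [N(Phi)] all the values [p (t + k)] vanish,
    hence so do [P] and the residual. So [m P] is square-integrable over a period, and the
    coefficients of [w] against [{T_k phit}] are square-summable. This Bessel bound is in terms of
    the [c_k], which [w] need not determine; hence the control of coefficients in the density
    argument.

    The identity [<f, T_k phit> = <pi f, T_k phit>] requires [T_k phit] in [V]: as the closed span
    of the translates of [phi1], [V] is shift-invariant.

    Parseval's identity rests on the completeness of the characters. A function on [0, 1) orthogonal
    to all of them is orthogonal to bounded limits of trigonometric polynomials, among which are the
    indicators of intervals; its primitive is then zero and Lebesgue differentiation concludes. *)

Section Complex.
Variable R : realType.
Implicit Types z w : R[i].
Local Notation Re := (@complex.Re R).
Local Notation Im := (@complex.Im R).

Lemma complexP z w : Re z = Re w -> Im z = Im w -> z = w.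
Proof. by case: z w => [a b] [c d] /= -> ->. Qed.

Lemma cReD z w : Re (z + w) = Re z + Re w. Proof. by case: z; case: w. Qed.
Lemma cImD z w : Im (z + w) = Im z + Im w. Proof. by case: z; case: w. Qed.
Lemma cReN z : Re (- z) = - Re z. Proof. by case: z. Qed.
Lemma cImN z : Im (- z) = - Im z. Proof. by case: z. Qed.
Lemma cReJ z : Re z^* = Re z. Proof. by case: z. Qed.
Lemma cImJ z : Im z^* = - Im z. Proof. by case: z. Qed.
Lemma cReM z w : Re (z * w) = Re z * Re w - Im z * Im w.
Proof. by case: z; case: w. Qed.
Lemma cImM z w : Im (z * w) = Re z * Im w + Im z * Re w.
Proof. by case: z => a b; case: w => c d /=. Qed.
Lemma cRe0 : Re 0 = 0. Proof. by []. Qed.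
Lemma cIm0 : Im 0 = 0. Proof. by []. Qed.
Definition reim := (cReD, cImD, cReN, cImN, cReJ, cImJ, cReM, cImM).

Lemma Re_sum I (s : seq I) (P : pred I) (F : I -> R[i]) :
  Re (\sum_(i <- s | P i) F i) = \sum_(i <- s | P i) Re (F i).
Proof. exact: (big_morph Re cReD cRe0). Qed.

Lemma Im_sum I (s : seq I) (P : pred I) (F : I -> R[i]) :
  Im (\sum_(i <- s | P i) F i) = \sum_(i <- s | P i) Im (F i).
Proof. exact: (big_morph Im cImD cIm0). Qed.

Lemma cabsE z : cabs z = Num.sqrt (Re z ^+ 2 + Im z ^+ 2).
Proof. by rewrite /cabs normc_def. Qed.

Lemma cabs_ge0 z : 0 <= cabs z. Proof. by rewrite cabsE sqrtr_ge0. Qed.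

Lemma sqr_cabs z : cabs z ^+ 2 = Re z ^+ 2 + Im z ^+ 2.
Proof. by rewrite cabsE sqr_sqrtr// addr_ge0 ?sqr_ge0. Qed.

Lemma normcE z : `|z| = (cabs z)%:C. Proof. by rewrite /cabs normc_def. Qed.

Lemma cabsM z w : cabs (z * w) = cabs z * cabs w.
Proof. by apply: (@complexI R); rewrite rmorphM /= -!normcE normrM. Qed.

Lemma cabsD z w : cabs (z + w) <= cabs z + cabs w.
Proof. by rewrite -lecR rmorphD /= -!normcE ler_normD. Qed.

Lemma cabsN z : cabs (- z) = cabs z.
Proof. by apply: (@complexI R); rewrite -!normcE normrN. Qed.

Lemma cabsB z w : cabs (z - w) <= cabs z + cabs w.
Proof. by rewrite -(cabsN w) cabsD. Qed.

Lemma cabsBC z w : cabs (z - w) = cabs (w - z).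
Proof. by rewrite -cabsN opprB. Qed.

Lemma cabsJ z : cabs z^* = cabs z.
Proof. by rewrite !cabsE reim cImJ sqrrN. Qed.

Lemma cabs0 : cabs (0 : R[i]) = 0.
Proof. by rewrite cabsE /= expr0n /= addr0 sqrtr0. Qed.

Lemma cabs1 : cabs (1 : R[i]) = 1.
Proof. by rewrite cabsE /= expr1n expr0n /= addr0 sqrtr1. Qed.

Lemma cabs_real (x : R) : cabs x%:C = `|x|.
Proof. by rewrite cabsE /= expr0n /= addr0 sqrtr_sqr. Qed.

Lemma cabs_eq0 z : (cabs z == 0) = (z == 0).
Proof. by rewrite -(inj_eq (@complexI R)) -normcE normr_eq0. Qed.

Lemma normRe_le z : `|Re z| <= cabs z.
Proof.
by rewrite cabsE -sqrtr_sqr ler_wsqrtr// lerDl sqr_ge0.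
Qed.

Lemma normIm_le z : `|Im z| <= cabs z.
Proof.
by rewrite cabsE -sqrtr_sqr ler_wsqrtr// lerDr sqr_ge0.
Qed.

Lemma cabs_le z : cabs z <= `|Re z| + `|Im z|.
Proof.
rewrite cabsE -[leRHS]ger0_norm ?addr_ge0// -sqrtr_sqr ler_wsqrtr//.
rewrite sqrrD !real_normK ?num_real// lerD2r lerDl mulrn_wge0// mulr_ge0//.
Qed.

Lemma mulJ z : z * z^* = (cabs z ^+ 2)%:C.
Proof. by apply: complexP; rewrite !reim /= ?sqr_cabs; ring. Qed.

Lemma cisD (s t : R) : cis (s + t) = cis s * cis t.
Proof. by apply: complexP; rewrite !reim /= ?cosD ?sinD; ring. Qed.

Lemma cis0 : cis (0 : R) = 1. Proof. by rewrite /cis cos0 sin0. Qed.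

Lemma cisN (t : R) : cis (- t) = (cis t)^*.
Proof. by rewrite /cis cosN sinN. Qed.

Lemma cabs_cis (t : R) : cabs (cis t) = 1.
Proof. by rewrite cabsE /= cos2Dsin2 sqrtr1. Qed.

Lemma cis_2piz (k : int) : cis (2 * pi * k%:~R : R) = 1.
Proof.
have H (n : nat) : cis (2 * pi * n%:R : R) = 1.
  elim: n => [|n IH]; first by rewrite mulr0 cis0.
  rewrite -(addn1 n) natrD mulrDr cisD IH mul1r mulr1 /cis.
  by rewrite mulrC mulr_natr cos2pi sin2pi.
case: k => n; first exact: H.
by rewrite NegzE mulrNz mulrN cisN H rmorph1.
Qed.

End Complex.

(** * Integration of complex functions *)

Section Integral.
Variable R : realType.
Local Notation mu := (@lebesgue_measure R).
Local Notation cfun := (R -> R[i]).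
Local Notation Re := (@complex.Re R).
Local Notation Im := (@complex.Im R).
Implicit Types (f g h : cfun).

Definition ae (P : R -> Prop) : Prop :=
  \forall x \ae (@lebesgue_measure R : {measure set (measurableTypeR R) -> \bar R}), P x.
Let ae_filter : Filter (almost_everywhere (@lebesgue_measure R : {measure set (measurableTypeR R) -> \bar R})) := ae_filter_ringOfSetsType _.

Lemma aeS (P Q : R -> Prop) : (forall x, P x -> Q x) -> ae P -> ae Q.
Proof. by move=> PQ; exact: (@filterS _ _ ae_filter). Qed.

Lemma aeS2 (P Q S : R -> Prop) : (forall x, P x -> Q x -> S x) -> ae P -> ae Q -> ae S.
Proof. move=> PQ. exact: (@filterS2 _ _ ae_filter). Qed.

Lemma aeW (P : R -> Prop) : (forall x, P x) -> ae P.
Proof. by move=> PQ; exact: (@nearW _ _ _ ae_filter). Qed.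

Lemma ae_eqP (f g : R -> R[i]) : ae_eq lebesgue_measure setT f g <-> ae (fun x => f x = g x).
Proof. by split; apply: aeS => x; [move=> /(_ I)|move=> ? _]. Qed.

Lemma ae_eqPe (f g : R -> \bar R) : ae_eq lebesgue_measure setT f g <-> ae (fun x => f x = g x).
Proof. by split; apply: aeS => x; [move=> /(_ I)|move=> ? _]. Qed.

Lemma ae_forall (P : nat -> R -> Prop) : (forall n, ae (P n)) -> ae (fun x => forall n, P n x).
Proof. move=> H; exact/(@ae_foralln _ _ _ (@lebesgue_measure R)). Qed.

(** The pairs [n], [- n] with [n] natural exhaust the integers, which reduces the claim to a
    sequence of null sets. *)
Lemma ae_int (P : int -> R -> Prop) : (forall n, ae (P n)) -> ae (fun x => forall n, P n x).
Proof.
move=> H; have := @ae_forall (fun n x => P n x /\ P (- n%:Z) x).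
move=> h; apply: aeS (h _) => [x H' [] n|n].
- exact: (H' n).1.
- by rewrite NegzE; exact: (H' n.+1).2.
- by apply: aeS2 (H n) (H (- n%:Z)).
Qed.

Definition cmeasurable f : Prop :=
  measurable_fun setT (Re \o f) /\ measurable_fun setT (Im \o f).

Definition scalef (a : R[i]) f : cfun := fun x => a * f x.

Lemma cmeasurableD f g : cmeasurable f -> cmeasurable g -> cmeasurable (f + g).
Proof.
move=> [f1 f2] [g1 g2]; split.
  rewrite (_ : _ \o _ = (Re \o f) \+ (Re \o g)); first exact: measurable_funD.
  by apply/funext => x /=; rewrite reim.
rewrite (_ : _ \o _ = (Im \o f) \+ (Im \o g)); first exact: measurable_funD.
by apply/funext => x /=; rewrite reim.
Qed.

Lemma cmeasurableN f : cmeasurable f -> cmeasurable (- f).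
Proof.
move=> [f1 f2]; split.
  rewrite (_ : _ \o _ = (fun x => - (Re \o f) x)); first exact: measurableT_comp.
  by apply/funext => x /=; rewrite reim.
rewrite (_ : _ \o _ = (fun x => - (Im \o f) x)); first exact: measurableT_comp.
by apply/funext => x /=; rewrite reim.
Qed.

Lemma cmeasurableB f g : cmeasurable f -> cmeasurable g -> cmeasurable (f - g).
Proof. by move=> ? ?; apply: cmeasurableD => //; exact: cmeasurableN. Qed.

Lemma cmeasurableM f g : cmeasurable f -> cmeasurable g -> cmeasurable (fun x => f x * g x).
Proof.
move=> [f1 f2] [g1 g2]; split.
  rewrite (_ : _ \o _ = (fun x => (Re \o f) x * (Re \o g) x - (Im \o f) x * (Im \o g) x)).
    by apply: measurable_funB; exact: measurable_funM.
  by apply/funext => x /=; rewrite reim.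
rewrite (_ : _ \o _ = (fun x => (Re \o f) x * (Im \o g) x + (Im \o f) x * (Re \o g) x)).
  by apply: measurable_funD; exact: measurable_funM.
by apply/funext => x /=; rewrite reim.
Qed.

Lemma cmeasurableJ f : cmeasurable f -> cmeasurable (fun x => (f x)^*).
Proof.
move=> [f1 f2]; split.
  rewrite (_ : _ \o _ = (Re \o f))//.
  by apply/funext => x /=; rewrite reim.
rewrite (_ : _ \o _ = (fun x => - (Im \o f) x)); first exact: measurableT_comp.
by apply/funext => x /=; rewrite reim.
Qed.

Lemma cmeasurable_cst a : cmeasurable (cst a).
Proof. by split; exact: measurable_cst. Qed.

Lemma cmeasurableZ a f : cmeasurable f -> cmeasurable (scalef a f).
Proof. by move=> mf; apply: cmeasurableM => //; exact: cmeasurable_cst. Qed.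

Lemma cmeasurable_sum I (s : seq I) (F : I -> cfun) :
  (forall i, cmeasurable (F i)) -> cmeasurable (\sum_(i <- s) F i).
Proof.
move=> mF; elim: s => [|i s IH]; first by rewrite big_nil; exact: cmeasurable_cst.
by rewrite big_cons; exact: cmeasurableD.
Qed.

Lemma cmeasurable_comp (u : R -> R) f : measurable_fun setT u -> cmeasurable f -> cmeasurable (f \o u).
Proof. by move=> mu_ [f1 f2]; split; rewrite compA; exact: measurableT_comp. Qed.

Lemma measurable_cabs f : cmeasurable f -> measurable_fun setT (cabs \o f).
Proof.
move=> [f1 f2].
rewrite (_ : _ \o _ = (fun x => ((Re \o f) x ^+ 2 + (Im \o f) x ^+ 2) `^ 2^-1)).
  apply: (@measurableT_comp _ _ _ _ _ _ (fun x : R => x `^ 2^-1)); first exact: measurable_powR.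
  by apply: measurable_funD; exact: measurable_funX.
by apply/funext => x /=; rewrite powR12_sqrt ?addr_ge0 ?sqr_ge0// -cabsE.
Qed.

Lemma measurable_sqcabs f : cmeasurable f -> measurable_fun setT (fun x => (cabs (f x) ^+ 2)%:E).
Proof.
move=> mf; apply/measurable_EFinP.
by apply: measurable_funX; exact: measurable_cabs.
Qed.

Definition cintegrable f : Prop :=
  mu.-integrable setT (EFin \o (Re \o f)) /\ mu.-integrable setT (EFin \o (Im \o f)).

Lemma Lp1P f : Lp 1 f <-> cintegrable f.
Proof.
by split => -[f1 f2]; split; apply/Lfun1_integrable.
Qed.

Lemma cintegrable_cmeasurable f : cintegrable f -> cmeasurable f.
Proof.
move=> [f1 f2]; split; apply/measurable_EFinP; exact: (measurable_int mu).
Qed.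

Lemma le_cintegrable f (g : R -> R) : cmeasurable f -> mu.-integrable setT (EFin \o g) ->
  (forall x, cabs (f x) <= g x) -> cintegrable f.
Proof.
move=> [f1 f2] ig fg; split; apply: (le_integrable measurableT _ _ ig).
- exact/measurable_EFinP.
- move=> x _ /=; rewrite lee_fin (le_trans (normRe_le _))// (le_trans (fg x))//.
  exact: ler_norm.
- exact/measurable_EFinP.
- move=> x _ /=; rewrite lee_fin (le_trans (normIm_le _))// (le_trans (fg x))//.
  exact: ler_norm.
Qed.

Lemma cintegrable_cabs f : cintegrable f -> mu.-integrable setT (EFin \o (cabs \o f)).
Proof.
move=> fi; have [f1 f2] := fi.
have : mu.-integrable setT (EFin \o (fun x => `|Re (f x)| + `|Im (f x)|)).
  rewrite (_ : EFin \o _ = (abse \o (EFin \o (Re \o f))) \+ (abse \o (EFin \o (Im \o f)))).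
    by apply: integrableD => //; exact: integrable_abse.
  by apply/funext => x /=.
apply: le_integrable => //.
  by apply/measurable_EFinP; exact: measurable_cabs (cintegrable_cmeasurable fi).
move=> x _ /=; rewrite lee_fin ger0_norm ?cabs_ge0// ger0_norm ?addr_ge0//.
exact: cabs_le.
Qed.

Lemma le_cintegrable_cabs f g : cmeasurable f -> cintegrable g ->
  (forall x, cabs (f x) <= cabs (g x)) -> cintegrable f.
Proof. by move=> mf /cintegrable_cabs ig fg; exact: (le_cintegrable mf ig). Qed.

Lemma cintegrableD f g : cintegrable f -> cintegrable g -> cintegrable (f + g).
Proof.
move=> [f1 f2] [g1 g2]; split.
  rewrite (_ : _ \o _ = (EFin \o (Re \o f)) \+ (EFin \o (Re \o g)))%E.
    exact: integrableD.
  by apply/funext => x /=; rewrite reim EFinD.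
rewrite (_ : _ \o _ = (EFin \o (Im \o f)) \+ (EFin \o (Im \o g)))%E.
  exact: integrableD.
by apply/funext => x /=; rewrite reim EFinD.
Qed.

Lemma cintegrableZ a f : cintegrable f -> cintegrable (scalef a f).
Proof.
move=> fi; apply: (@le_cintegrable _ (fun x => cabs a * cabs (f x))).
- exact/cmeasurableZ/cintegrable_cmeasurable.
- rewrite (_ : _ \o _ = (fun x => (cabs a)%:E * (EFin \o (cabs \o f)) x)%E)//.
  by apply: integrableZl => //; exact: cintegrable_cabs.
- by move=> x; rewrite cabsM.
Qed.

Lemma cintegrableN f : cintegrable f -> cintegrable (- f).
Proof.
move=> fi; apply: (le_cintegrable_cabs _ fi); first exact/cmeasurableN/cintegrable_cmeasurable.
by move=> x; rewrite cabsN.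
Qed.

Lemma integ0 : cintegrable 0.
Proof. by split; exact: integrable0. Qed.

Lemma cintegrable_sum I (s : seq I) (F : I -> cfun) :
  (forall i, cintegrable (F i)) -> cintegrable (\sum_(i <- s) F i).
Proof.
move=> mF; elim: s => [|i s IH]; first by rewrite big_nil; exact: integ0.
by rewrite big_cons; exact: cintegrableD.
Qed.

Lemma cintegralD f g : cintegrable f -> cintegrable g ->
  cintegral (f + g) = cintegral f + cintegral g.
Proof.
move=> [f1 f2] [g1 g2]; apply: complexP; rewrite !reim /=.
  by rewrite -RintegralD//; apply: eq_Rintegral => x _ /=; rewrite reim.
by rewrite -RintegralD//; apply: eq_Rintegral => x _ /=; rewrite reim.
Qed.

Lemma integrableZr_Re (r : R) (u : R -> R) : mu.-integrable setT (EFin \o u) ->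
  mu.-integrable setT (EFin \o (fun x => r * u x)).
Proof.
move=> iu; rewrite (_ : _ \o _ = (fun x => r%:E * (EFin \o u) x)%E)//.
exact: integrableZl.
Qed.

Lemma cintegralZ a f : cintegrable f -> cintegral (scalef a f) = a * cintegral f.
Proof.
move=> [f1 f2]; apply: complexP; rewrite !reim /=.
  rewrite -!RintegralZl// -RintegralB//; try exact: integrableZr_Re.
  by apply: eq_Rintegral => x _ /=; rewrite reim.
rewrite -!RintegralZl// -RintegralD//; try exact: integrableZr_Re.
by apply: eq_Rintegral => x _ /=; rewrite reim.
Qed.

Lemma cintegralN f : cintegrable f -> cintegral (- f) = - cintegral f.
Proof.
move=> fi; rewrite -[RHS]mulN1r -cintegralZ//; congr cintegral.
by apply/funext => x; rewrite /scalef mulN1r.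
Qed.

Lemma cintegral0 : cintegral (0 : cfun) = 0.
Proof.
apply: complexP => /=; rewrite /Rintegral integral0_eq//.
Qed.

Lemma cintegral_sum I (s : seq I) (F : I -> cfun) :
  (forall i, cintegrable (F i)) ->
  cintegral (\sum_(i <- s) F i) = \sum_(i <- s) cintegral (F i).
Proof.
move=> mF; elim: s => [|i s IH]; first by rewrite !big_nil cintegral0.
by rewrite !big_cons cintegralD ?IH//; exact: cintegrable_sum.
Qed.

Lemma cintegralJ f : cintegrable f -> cintegral (fun x => (f x)^*) = (cintegral f)^*.
Proof.
move=> [f1 f2]; apply: complexP; rewrite !reim /=.
  by apply: eq_Rintegral => x _ /=; rewrite reim.
rewrite -mulN1r -RintegralZl//.
by apply: eq_Rintegral => x _ /=; rewrite reim mulN1r.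
Qed.

Lemma ae_eq_cintegral f g : cmeasurable f -> cmeasurable g -> ae_eq mu setT f g ->
  cintegral f = cintegral g.
Proof.
move=> [f1 f2] [g1 g2] fg; apply: complexP => /=; rewrite /Rintegral; congr fine;
  apply: ae_eq_integral => //; try exact/measurable_EFinP;
  by apply: filterS fg => x /(_ I) /= ->.
Qed.

End Integral.

(** * The inner product of L2 *)

Section L2.
Variable R : realType.
Local Notation mu := (@lebesgue_measure R).
Local Notation cfun := (R -> R[i]).
Local Notation Re := (@complex.Re R).
Local Notation Im := (@complex.Im R).
Local Notation L2 := (@Lp R 2%:E).
Implicit Types (f g h : cfun).

(** Extended-valued, unlike [norm2], so that monotonicity and Fatou's lemma apply before membership
    in L2 is known. *)
Definition sqnorm2 f : \bar R := (\int[mu]_x ((cabs (f x)) ^+ 2)%:E)%E.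

Lemma sqnorm2_ge0 f : (0 <= sqnorm2 f)%E.
Proof. by apply: integral_ge0 => x _; rewrite lee_fin sqr_ge0. Qed.

Lemma sqnorm2E f : cmeasurable f ->
  sqnorm2 f = (\int[mu]_x ((Re (f x)) ^+ 2)%:E + \int[mu]_x ((Im (f x)) ^+ 2)%:E)%E.
Proof.
move=> [f1 f2]; rewrite -ge0_integralD//=.
- by apply: eq_integral => x _; rewrite sqr_cabs EFinD.
- by move=> x _; rewrite lee_fin sqr_ge0.
- by apply/measurable_EFinP; exact: measurable_funX.
- by move=> x _; rewrite lee_fin sqr_ge0.
- by apply/measurable_EFinP; exact: measurable_funX.
Qed.

Lemma Lfun2P (u : R -> R) : u \in Lfun mu 2%:E <->
  measurable_fun setT u /\ (\int[mu]_x ((u x) ^+ 2)%:E < +oo)%E.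
Proof.
split=> [uL|[um ui]].
  split; first by move: uL; rewrite inE => /andP[]; rewrite inE.
  have /integrableP[_] := Lfun2_integrable_sqr uL.
  by under eq_integral do rewrite /= ger0_norm ?sqr_ge0//.
rewrite inE; apply/andP; split; rewrite inE//= /finite_norm unlock /Lnorm.
apply: poweR_lty; move: ui; congr (_ < _)%E; apply: eq_integral => x _ /=.
by rewrite powR_mulrn// real_normK ?num_real.
Qed.

Lemma L2P f : L2 f <-> cmeasurable f /\ (sqnorm2 f < +oo)%E.
Proof.
split=> [[/Lfun2P[m1 i1] /Lfun2P[m2 i2]]|[[m1 m2]]].
  by rewrite sqnorm2E//; split => //; exact: lte_add_pinfty.
rewrite sqnorm2E// => i; split; apply/Lfun2P; split => //; apply: le_lt_trans i.
  by apply: leeDl; apply: integral_ge0 => x _; rewrite lee_fin sqr_ge0.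
by apply: leeDr; apply: integral_ge0 => x _; rewrite lee_fin sqr_ge0.
Qed.

Lemma L2_cmeasurable f : L2 f -> cmeasurable f. Proof. by case/L2P. Qed.

Lemma L2_fin f : L2 f -> sqnorm2 f \is a fin_num.
Proof. by move=> /L2P[_ ?]; rewrite ge0_fin_numE// sqnorm2_ge0. Qed.

Lemma norm2E f : norm2 f = Num.sqrt (fine (sqnorm2 f)).
Proof.
rewrite /norm2 unlock /Lnorm fine_poweR powR12_sqrt ?fine_ge0//; last first.
  by apply: integral_ge0 => x _; exact: poweR_ge0.
congr (Num.sqrt (fine _)); apply: eq_integral => x _ /=.
by rewrite powR_mulrn// real_normK ?num_real.
Qed.

Lemma norm2_ge0 f : 0 <= norm2 f. Proof. by rewrite norm2E sqrtr_ge0. Qed.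

Lemma sqr_norm2 f : norm2 f ^+ 2 = fine (sqnorm2 f).
Proof. by rewrite norm2E sqr_sqrtr// fine_ge0// sqnorm2_ge0. Qed.

Lemma sqnorm2K f : L2 f -> sqnorm2 f = (norm2 f ^+ 2)%:E.
Proof. by move=> fL; rewrite sqr_norm2 fineK// L2_fin. Qed.

Lemma le_sqnorm2 f g : cmeasurable f -> cmeasurable g -> (forall x, cabs (f x) <= cabs (g x)) ->
  (sqnorm2 f <= sqnorm2 g)%E.
Proof.
move=> mf mg fg; apply: ge0_le_integral => //.
- by move=> x _; rewrite lee_fin sqr_ge0.
- exact: measurable_sqcabs.
- exact: measurable_sqcabs.
- by move=> x _; rewrite lee_fin lerXn2r ?nnegrE ?cabs_ge0.
Qed.

Lemma L2_le f g : cmeasurable f -> L2 g -> (forall x, cabs (f x) <= cabs (g x)) -> L2 f.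
Proof.
move=> mf /L2P[mg ig] fg; apply/L2P; split => //.
by apply: le_lt_trans ig; exact: le_sqnorm2.
Qed.

Lemma sqnorm2Z a f : cmeasurable f -> sqnorm2 (scalef a f) = ((cabs a ^+ 2)%:E * sqnorm2 f)%E.
Proof.
move=> mf; rewrite /sqnorm2 -ge0_integralZl//.
- by apply: eq_integral => x _; rewrite cabsM exprMn EFinM.
- exact: measurable_sqcabs.
- by move=> x _; rewrite lee_fin sqr_ge0.
- by rewrite lee_fin sqr_ge0.
Qed.

Lemma L2Z a f : L2 f -> L2 (scalef a f).
Proof.
move=> /L2P[mf fi]; apply/L2P; split; first exact: cmeasurableZ.
by rewrite sqnorm2Z// lte_mul_pinfty// lee_fin sqr_ge0.
Qed.

Lemma L2M_bounded (K : R) f (m : cfun) : cmeasurable m -> (forall x, cabs (m x) <= K) ->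
  L2 f -> L2 (fun x => m x * f x).
Proof.
move=> mm mK fL; have K0 : 0 <= K by rewrite (le_trans (cabs_ge0 _) (mK 0)).
apply: (@L2_le _ (scalef K%:C f)); [|exact: L2Z|].
  exact/cmeasurableM/L2_cmeasurable.
by move=> x; rewrite !cabsM cabs_real ger0_norm// ler_wpM2r ?cabs_ge0.
Qed.

Lemma L2D f g : L2 f -> L2 g -> L2 (f + g).
Proof.
move=> /L2P[mf fi] /L2P[mg gi]; apply/L2P; split; first exact: cmeasurableD.
apply: (@le_lt_trans _ _ (2%:E * (sqnorm2 f + sqnorm2 g))%E).
  rewrite /sqnorm2 -ge0_integralD//=; try exact: measurable_sqcabs; try by move=> x _; rewrite lee_fin sqr_ge0.
  rewrite -ge0_integralZl//=.
  - apply: ge0_le_integral => //.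
    + by move=> x _; rewrite lee_fin sqr_ge0.
    + by apply: measurable_sqcabs; exact: cmeasurableD.
    + apply: measurable_funeM; apply: emeasurable_funD; exact: measurable_sqcabs.
    + move=> x _; rewrite -EFinD -EFinM lee_fin /=.
      have := cabsD (f x) (g x).
      have := cabs_ge0 (f x + g x); have := cabs_ge0 (f x); have := cabs_ge0 (g x).
      set a := cabs _; set b := cabs _; set c := cabs _ => a0 b0 c0 h.
      have : c ^+ 2 <= (b + a) ^+ 2 by rewrite lerXn2r ?nnegrE// addr_ge0.
      have := sqr_ge0 (b - a); nra.
  - by apply: emeasurable_funD; exact: measurable_sqcabs.
  - by move=> x _; rewrite -EFinD lee_fin addr_ge0 ?sqr_ge0.
by rewrite lte_mul_pinfty// lte_add_pinfty.
Qed.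

Lemma L2N f : L2 f -> L2 (- f).
Proof.
move=> fL; apply: (L2_le _ fL); first exact/cmeasurableN/L2_cmeasurable.
by move=> x; rewrite cabsN.
Qed.

Lemma L2B f g : L2 f -> L2 g -> L2 (f - g).
Proof. by move=> ? ?; apply: L2D => //; exact: L2N. Qed.

Lemma L20 : L2 0.
Proof.
apply/L2P; split; first exact: cmeasurable_cst.
by rewrite /sqnorm2 integral0_eq// => x _; rewrite cabs0 expr0n.
Qed.

Lemma L2_sum I (s : seq I) (F : I -> cfun) :
  (forall i, L2 (F i)) -> L2 (\sum_(i <- s) F i).
Proof.
move=> mF; elim: s => [|i s IH]; first by rewrite big_nil; exact: L20.
by rewrite big_cons; exact: L2D.
Qed.

Lemma cintegrable_sqcabs f : L2 f -> mu.-integrable setT (EFin \o (fun x => cabs (f x) ^+ 2)).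
Proof.
move=> fL; apply/integrableP; split; first exact: measurable_sqcabs (L2_cmeasurable fL).
have /L2P[_] := fL; congr (_ < _)%E; apply: eq_integral => x _ /=.
by rewrite ger0_norm ?sqr_ge0.
Qed.

Lemma cintegrable_mul f g : L2 f -> L2 g -> cintegrable (fun x => f x * g x).
Proof.
move=> fL gL; apply: (@le_cintegrable _ _ (fun x => cabs (f x) ^+ 2 + cabs (g x) ^+ 2)).
- by apply: cmeasurableM; exact: L2_cmeasurable.
- rewrite (_ : _ \o _ = ((EFin \o (fun x => cabs (f x) ^+ 2)%R) \+ (EFin \o (fun x => cabs (g x) ^+ 2)%R))%E)//.
  by apply: integrableD => //; exact: cintegrable_sqcabs.
- move=> x; rewrite cabsM; have := cabs_ge0 (f x); have := cabs_ge0 (g x).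
  by have := sqr_ge0 (cabs (f x) - cabs (g x)); nra.
Qed.

Lemma L2J f : L2 f -> L2 (fun x => (f x)^*).
Proof.
move=> fL; apply: (L2_le _ fL); first exact/cmeasurableJ/L2_cmeasurable.
by move=> x; rewrite cabsJ.
Qed.

Lemma cintegrable_inner f g : L2 f -> L2 g -> cintegrable (fun x => f x * (g x)^*).
Proof. by move=> fL gL; apply: cintegrable_mul => //; exact: L2J. Qed.

Lemma innerDl f g h : L2 f -> L2 g -> L2 h ->
  inner (f + g) h = inner f h + inner g h.
Proof.
move=> fL gL hL; rewrite -cintegralD; try exact: cintegrable_inner.
by congr cintegral; apply/funext => x /=; rewrite mulrDl.
Qed.

Lemma innerZl a f h : L2 f -> L2 h -> inner (scalef a f) h = a * inner f h.
Proof.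
move=> fL hL; rewrite -cintegralZ; last exact: cintegrable_inner.
by congr cintegral; apply/funext => x /=; rewrite /scalef mulrA.
Qed.

Lemma innerC f g : L2 f -> L2 g -> inner g f = (inner f g)^*.
Proof.
move=> fL gL; rewrite -cintegralJ; last exact: cintegrable_inner.
by congr cintegral; apply/funext => x; rewrite rmorphM/= conjCK mulrC.
Qed.

Lemma innerff f : L2 f -> inner f f = (norm2 f ^+ 2)%:C.
Proof.
move=> fL; rewrite sqr_norm2 /inner.
rewrite (_ : (fun x => _) = (fun x => (cabs (f x) ^+ 2)%:C)); last first.
  by apply/funext => x; rewrite mulJ.
by apply: complexP => //=; rewrite /Rintegral integral0_eq.
Qed.

Lemma innerDr f g h : L2 f -> L2 g -> L2 h ->
  inner h (f + g) = inner h f + inner h g.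
Proof.
move=> fL gL hL; rewrite innerC ?innerDl//; last exact: L2D.
by rewrite rmorphD /= -!innerC.
Qed.

Lemma innerZr a f h : L2 f -> L2 h -> inner h (scalef a f) = a^* * inner h f.
Proof.
move=> fL hL; rewrite innerC ?innerZl//; last exact: L2Z.
by rewrite rmorphM /= -!innerC.
Qed.

Lemma scalefN1 f : - f = scalef (-1) f.
Proof. by apply/funext => x; rewrite /scalef mulN1r. Qed.

Lemma innerNl f h : L2 f -> L2 h -> inner (- f) h = - inner f h.
Proof. by move=> fL hL; rewrite scalefN1 innerZl// mulN1r. Qed.

Lemma innerNr f h : L2 f -> L2 h -> inner h (- f) = - inner h f.
Proof. by move=> fL hL; rewrite scalefN1 innerZr// rmorphN1 mulN1r. Qed.

Lemma innerBl f g h : L2 f -> L2 g -> L2 h ->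
  inner (f - g) h = inner f h - inner g h.
Proof. by move=> fL gL hL; rewrite innerDl ?innerNl//; exact: L2N. Qed.

Lemma inner0l h : inner 0 h = 0.
Proof.
rewrite -[RHS](@cintegral0 R); congr cintegral; apply/funext => x.
by rewrite mul0r.
Qed.

Lemma inner_suml I (s : seq I) (F : I -> cfun) h :
  (forall i, L2 (F i)) -> L2 h ->
  inner (\sum_(i <- s) F i) h = \sum_(i <- s) inner (F i) h.
Proof.
move=> FL hL; elim: s => [|i s IH]; first by rewrite !big_nil inner0l.
by rewrite !big_cons innerDl ?IH//; exact: L2_sum.
Qed.

Lemma inner_sumr I (s : seq I) (F : I -> cfun) h :
  (forall i, L2 (F i)) -> L2 h ->
  inner h (\sum_(i <- s) F i) = \sum_(i <- s) inner h (F i).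
Proof.
move=> FL hL; rewrite innerC//; last exact: L2_sum.
by rewrite inner_suml// rmorph_sum /=; apply: eq_bigr => i _; rewrite -innerC.
Qed.

Lemma norm2_0 : norm2 (0 : cfun) = 0.
Proof.
by apply/eqP; rewrite -sqrf_eq0 -(inj_eq (@complexI R)) -innerff ?inner0l//; exact: L20.
Qed.

Lemma norm2Z a f : L2 f -> norm2 (scalef a f) = cabs a * norm2 f.
Proof.
move=> fL; apply/eqP; rewrite -(@eqrXn2 _ 2)// ?norm2_ge0 ?mulr_ge0 ?norm2_ge0 ?cabs_ge0//.
rewrite -(inj_eq (@complexI R)) -innerff; last exact: L2Z.
rewrite innerZl ?innerZr ?innerff//; last exact: L2Z.
by rewrite mulrA mulJ -rmorphM/= exprMn.
Qed.

Lemma norm2N f : L2 f -> norm2 (- f) = norm2 f.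
Proof. by move=> fL; rewrite scalefN1 norm2Z// cabsN cabs1 mul1r. Qed.

Lemma norm2BC f g : L2 f -> L2 g -> norm2 (f - g) = norm2 (g - f).
Proof. by move=> fL gL; rewrite -opprB norm2N//; exact: L2B. Qed.

Lemma sqr_norm2D f g : L2 f -> L2 g ->
  norm2 (f + g) ^+ 2 = norm2 f ^+ 2 + 2 * Re (inner f g) + norm2 g ^+ 2.
Proof.
move=> fL gL; apply: (@complexI R); rewrite -innerff; last exact: L2D.
rewrite innerDl ?innerDr//; try exact: L2D.
rewrite !innerff// [in X in _ + (X + _)]innerC//.
by apply: complexP; rewrite !reim /=; ring.
Qed.

Lemma sqr_norm2B f g : L2 f -> L2 g ->
  norm2 (f - g) ^+ 2 = norm2 f ^+ 2 - 2 * Re (inner f g) + norm2 g ^+ 2.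
Proof.
move=> fL gL; rewrite sqr_norm2D ?norm2N//; last exact: L2N.
by rewrite innerNr// reim; ring.
Qed.

(** With [norm2 f = 0] the square norm of [t f + g] is affine in [t] and never negative, so its
    slope [2 Re <f, g>] is zero; otherwise the value of [t] chosen in the proof would make it
    [- norm2 g ^+ 2 - 2]. *)
Lemma norm2_eq0_inner f g : L2 f -> L2 g -> norm2 f = 0 -> Re (inner f g) = 0.
Proof.
move=> fL gL f0.
have H (t : R) : 0 <= 2 * (t * Re (inner f g)) + norm2 g ^+ 2.
  have := sqr_ge0 (norm2 (scalef t%:C f + g)).
  rewrite sqr_norm2D ?norm2Z ?innerZl//; last exact: L2Z.
  by rewrite f0 mulr0 expr0n add0r cReM/= mul0r subr0.
set r := Re _ in H *; apply: contrapT => /eqP r0.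
have := H (- (norm2 g ^+ 2 + 1) / r).
by rewrite divfK//; have := sqr_ge0 (norm2 g); nra.
Qed.

(** Expand [|b f - a g|^2 >= 0] with [a = norm2 f] and [b = norm2 g], then divide by [2 a b]; the
    cases [a = 0] and [b = 0] come from [norm2_eq0_inner]. *)
Lemma Re_inner_le f g : L2 f -> L2 g -> Re (inner f g) <= norm2 f * norm2 g.
Proof.
move=> fL gL.
have [f0|fN0] := eqVneq (norm2 f) 0; first by rewrite norm2_eq0_inner// f0 mul0r.
have [g0|gN0] := eqVneq (norm2 g) 0.
  by rewrite innerC// cReJ norm2_eq0_inner// g0 mulr0.
have := sqr_ge0 (norm2 (scalef (norm2 g)%:C f - scalef (norm2 f)%:C g)).
rewrite sqr_norm2B; try exact: L2Z.
rewrite !norm2Z// innerZl ?innerZr//; last exact: L2Z.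
rewrite !cabs_real !ger0_norm ?norm2_ge0//.
rewrite (_ : Re _ = norm2 g * norm2 f * Re (inner f g)); last by rewrite !cReM cImM /=; ring.
have a0 := norm2_ge0 f; have b0 := norm2_ge0 g.
have ab : 0 < norm2 g * norm2 f by rewrite mulr_gt0// lt0r ?gN0 ?fN0.
move=> h; rewrite -(ler_pM2l ab).
by move: h; set a := norm2 f; set b := norm2 g; set r := Re _ => h; nra.
Qed.

(** Multiplying [f] by the conjugate of [<f, g>] makes the inner product real, equal to
    [|<f, g>|^2], and [Re_inner_le] applies. *)
Lemma inner_le f g : L2 f -> L2 g -> cabs (inner f g) <= norm2 f * norm2 g.
Proof.
move=> fL gL; set z := inner f g.
have [z0|zN0] := eqVneq (cabs z) 0; first by rewrite z0 mulr_ge0 ?norm2_ge0.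
have zp : 0 < cabs z by rewrite lt0r zN0 cabs_ge0.
have := Re_inner_le (L2Z z^* fL) gL.
rewrite innerZl// norm2Z// cabsJ mulrC -/z.
by rewrite mulJ /= expr2 -mulrA ler_pM2l.
Qed.

Lemma norm2D f g : L2 f -> L2 g -> norm2 (f + g) <= norm2 f + norm2 g.
Proof.
move=> fL gL; rewrite -(@ler_pXn2r _ 2)// ?nnegrE ?addr_ge0 ?norm2_ge0//.
rewrite sqr_norm2D//; have := Re_inner_le fL gL.
by set a := norm2 f; set b := norm2 g; set r := Re _; nra.
Qed.

Lemma norm2_dist f g : L2 f -> L2 g -> `|norm2 f - norm2 g| <= norm2 (f - g).
Proof.
move=> fL gL; rewrite ler_norml; apply/andP; split.
  rewrite lerNl opprB lerBlDr (norm2BC fL gL).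
  by rewrite -[X in norm2 X <= _](subrK f g) norm2D//; exact: L2B.
by rewrite lerBlDr -[X in norm2 X <= _](subrK g f) norm2D//; exact: L2B.
Qed.

Lemma ae_eq_sqnorm2 f g : cmeasurable f -> cmeasurable g -> ae_eq mu setT f g -> sqnorm2 f = sqnorm2 g.
Proof.
move=> mf mg fg; apply: ae_eq_integral => //; try exact: measurable_sqcabs.
by apply: filterS fg => x /(_ I) /= ->.
Qed.

Lemma ae_eq_norm2 f g : cmeasurable f -> cmeasurable g -> ae_eq mu setT f g -> norm2 f = norm2 g.
Proof. by move=> mf mg fg; rewrite !norm2E (ae_eq_sqnorm2 mf mg fg). Qed.

Lemma ae_eq_L2 f g : L2 f -> cmeasurable g -> ae_eq mu setT f g -> L2 g.
Proof.
by move=> /L2P[mf fi] mg fg; apply/L2P; rewrite -(ae_eq_sqnorm2 mf mg fg).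
Qed.

Lemma ae_eq_inner f g f' g' : cmeasurable f -> cmeasurable g -> cmeasurable f' -> cmeasurable g' ->
  ae_eq mu setT f f' -> ae_eq mu setT g g' -> inner f g = inner f' g'.
Proof.
move=> mf mg mf' mg' ff' gg'; apply: ae_eq_cintegral; try by apply: cmeasurableM => //; exact: cmeasurableJ.
by apply: filterS2 ff' gg' => x /(_ I) -> /(_ I) ->.
Qed.

End L2.

(** * Convergence in L2 *)

Section Convergence.
Variable R : realType.
Local Notation mu := (@lebesgue_measure R).
Local Notation cfun := (R -> R[i]).
Local Notation Re := (@complex.Re R).
Local Notation Im := (@complex.Im R).
Local Notation L2 := (@Lp R 2%:E).
Implicit Types (f g h : cfun) (u v : nat -> cfun).

Lemma cvg0P (a : nat -> R) : (a @ \oo --> (0 : R)) <->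
  forall e, 0 < e -> exists N, forall n, (N <= n)%N -> `|a n| <= e.
Proof.
split => [/cvgrPdist_le H e e0|H].
  have [N _ HN] := H e e0; exists N => n Nn.
  by have := HN n Nn; rewrite sub0r normrN.
apply/cvgrPdist_le => e e0; have [N HN] := H e e0.
by exists N => // n /= Nn; rewrite sub0r normrN; exact: HN.
Qed.

Lemma real_cvg_le (a : nat -> R) (l M : R) : a @ \oo --> l ->
  (forall n, a n <= M) -> l <= M.
Proof.
move=> al aM; rewrite -(cvg_lim (@Rhausdorff R) al).
by apply: limr_le; [exact: cvgP al|exact: nearW].
Qed.

Lemma le_cvg0 (a b : nat -> R) : (forall n, `|a n| <= b n) ->
  b @ \oo --> (0 : R) -> a @ \oo --> (0 : R).
Proof.
move=> ab /cvg0P b0; apply/cvg0P => e /b0[N HN]; exists N => n /HN.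
by apply: le_trans; apply: (le_trans (ab n)); exact: ler_norm.
Qed.

(** Stated with the real modulus [cabs], so that every limit in the development is a limit of real
    sequences. *)
Definition ccvg (a : nat -> R[i]) (l : R[i]) : Prop :=
  (fun n => cabs (a n - l)) @ \oo --> (0 : R).

Lemma ccvgP a l : ccvg a l <->
  (Re \o a) @ \oo --> Re l /\ (Im \o a) @ \oo --> Im l.
Proof.
split=> [al|[al1 al2]].
  split; apply/subr_cvg0.
    apply: le_cvg0 al => n.
    by have := normRe_le (a n - l); rewrite cReD cReN.
  apply: le_cvg0 al => n.
  by have := normIm_le (a n - l); rewrite cImD cImN.
apply: (@le_cvg0 _ (fun n => `|Re (a n) - Re l| + `|Im (a n) - Im l|)).
  by move=> n; rewrite ger0_norm ?cabs_ge0// (le_trans (cabs_le _))// !reim.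
rewrite -[0](addr0 0); apply: cvgD.
  by rewrite -(normr0 R); apply: cvg_norm; exact/subr_cvg0.
by rewrite -(normr0 R); apply: cvg_norm; exact/subr_cvg0.
Qed.

Lemma ccvg_uniq a l l' : ccvg a l -> ccvg a l' -> l = l'.
Proof.
move=> /ccvgP[r i] /ccvgP[r' i']; apply: complexP.
  exact: (cvg_unique (@Rhausdorff R) r r').
exact: (cvg_unique (@Rhausdorff R) i i').
Qed.

Lemma eq_ccvg a b l : a =1 b -> ccvg a l -> ccvg b l.
Proof. by move=> /funext ->. Qed.

Lemma ccvg_cst l : ccvg (cst l) l.
Proof. by rewrite /ccvg; under eq_fun do rewrite subrr cabs0; exact: cvg_cst. Qed.

Lemma ccvgZ c a l : ccvg a l -> ccvg (fun n => c * a n) (c * l).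
Proof.
rewrite /ccvg => al; under eq_fun do rewrite -mulrBr cabsM.
by rewrite -[0](mulr0 (cabs c)); apply: cvgM => //; exact: cvg_cst.
Qed.

Lemma ccvgD a b l l' : ccvg a l -> ccvg b l' -> ccvg (fun n => a n + b n) (l + l').
Proof.
move=> al bl; apply: (@le_cvg0 _ (fun n => cabs (a n - l) + cabs (b n - l'))).
  by move=> n; rewrite ger0_norm ?cabs_ge0// opprD addrACA cabsD.
by rewrite -[0](addr0 0); exact: cvgD.
Qed.

Lemma ccvgB a b l l' : ccvg a l -> ccvg b l' -> ccvg (fun n => a n - b n) (l - l').
Proof.
move=> al /(ccvgZ (-1)) bl; rewrite -[- l']mulN1r.
by apply: (eq_ccvg _ (ccvgD al bl)) => n; rewrite mulN1r.
Qed.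

Lemma ccvg_sub (s : nat -> nat) a l : (forall n, (n <= s n)%N) ->
  ccvg a l -> ccvg (a \o s) l.
Proof.
move=> sn /cvg0P al; apply/cvg0P => e /al[N HN]; exists N => n Nn.
by apply: HN; exact: leq_trans (sn n).
Qed.

Lemma ccvg_cabs a l : ccvg a l -> (fun n => cabs (a n)) @ \oo --> cabs l.
Proof.
move=> al; apply/subr_cvg0; apply: le_cvg0 al => n.
rewrite ler_norml; apply/andP; split.
  rewrite lerNl opprB lerBlDr cabsBC -[X in cabs X <= _](subrK (a n) l).
  exact: cabsD.
by rewrite lerBlDr -[X in cabs X <= _](subrK l (a n)); exact: cabsD.
Qed.

(** Measurable wherever the sequence is, and equal to the limit wherever the
    sequence converges. *)
Definition aelim u : cfun := fun x =>
  fine (limn_esup (fun n => (Re (u n x))%:E)) +i* fine (limn_esup (fun n => (Im (u n x))%:E)).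

Lemma cmeasurable_aelim u : (forall n, cmeasurable (u n)) -> cmeasurable (aelim u).
Proof.
move=> mu_; split.
  rewrite (_ : _ \o _ = fine \o (fun x => limn_esup (fun n => (Re (u n x))%:E)))//.
  apply: measurableT_comp => //; apply: measurable_fun_limn_esup => n.
  by apply/measurable_EFinP; case: (mu_ n).
rewrite (_ : _ \o _ = fine \o (fun x => limn_esup (fun n => (Im (u n x))%:E)))//.
apply: measurableT_comp => //; apply: measurable_fun_limn_esup => n.
by apply/measurable_EFinP; case: (mu_ n).
Qed.

Lemma aelimE u x l : ccvg (u^~ x) l -> aelim u x = l.
Proof.
move=> /ccvgP[r i]; apply: complexP => /=.
  have H : (fun n => (Re (u n x))%:E) @ \oo --> (Re l)%:E.
    by apply: cvg_EFin => //; exact: nearW.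
  by rewrite (cvg_limn_einf_sup H).2.
have H : (fun n => (Im (u n x))%:E) @ \oo --> (Im l)%:E.
  by apply: cvg_EFin => //; exact: nearW.
by rewrite (cvg_limn_einf_sup H).2.
Qed.

Lemma fatou_sqnorm2 u f (M : \bar R) : (forall n, cmeasurable (u n)) -> cmeasurable f ->
  ae (fun x => ccvg (u^~ x) (f x)) -> (forall n, sqnorm2 (u n) <= M)%E ->
  (sqnorm2 f <= M)%E.
Proof.
move=> mu_ mf uf uM.
have H0 n x : [set: R] x -> (0 <= (cabs (u n x) ^+ 2)%:E)%E by rewrite lee_fin sqr_ge0.
have Hm n : measurable_fun [set: R] (fun x => (cabs (u n x) ^+ 2)%:E).
  exact: measurable_sqcabs.
have -> : sqnorm2 f = (\int[mu]_x limn_einf (fun n => (cabs (u n x) ^+ 2)%:E))%E.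
  apply: ae_eq_integral => //.
  - exact: measurable_sqcabs.
  - rewrite (_ : (fun x => _) =
      (fun x => - limn_esup ((-%E) \o (fun n => (cabs (u n x) ^+ 2)%:E)))%E); last first.
      by apply/funext => x; rewrite limn_esupN oppeK.
    apply: measurableT_comp => //; apply: measurable_fun_limn_esup => n.
    apply: (measurableT_comp (f := (fun y : \bar R => - y)%E)).
      exact: oppe_measurable.
    exact: Hm.
  - apply/ae_eqPe; apply: aeS uf => x ux.
    have H : (fun n => (cabs (u n x) ^+ 2)%:E) @ \oo --> (cabs (f x) ^+ 2)%:E.
      apply: cvg_EFin; first exact: nearW.
      rewrite expr2; under eq_fun do rewrite /= expr2.
      by apply: cvgM; exact: ccvg_cabs.
    by rewrite (cvg_limn_einf_sup H).1.
apply: (le_trans (fatou lebesgue_measure measurableT Hm H0)).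
rewrite limn_einf_lim; apply: lime_le; first exact: is_cvg_einfs.
apply: nearW => n; apply: le_trans (uM n).
by apply: ereal_inf_lbound; exists n => //=.
Qed.

Lemma fatou_norm2 u f (M : R) : (forall n, L2 (u n)) -> cmeasurable f ->
  ae (fun x => ccvg (u^~ x) (f x)) -> (forall n, norm2 (u n) <= M) ->
  L2 f /\ norm2 f <= M.
Proof.
move=> uL mf uf uM.
have M0 : 0 <= M by rewrite (le_trans (norm2_ge0 (u 0))).
have H : (sqnorm2 f <= (M ^+ 2)%:E)%E.
  apply: (fatou_sqnorm2 _ mf uf) => n; first exact: L2_cmeasurable.
  by rewrite sqnorm2K// lee_fin lerXn2r ?nnegrE ?norm2_ge0.
have fL : L2 f by apply/L2P; split => //; apply: le_lt_trans H _; rewrite ltey.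
split => //; rewrite -(@ler_pXn2r _ 2)// ?nnegrE ?norm2_ge0//.
by rewrite -lee_fin -sqnorm2K.
Qed.

Definition l2cauchy u := forall e, 0 < e ->
  exists N, forall n m, (N <= n)%N -> (N <= m)%N -> norm2 (u n - u m) <= e.

Lemma cvg2P u f : cvg2 u f <-> [/\ forall n, L2 (u n), L2 f &
  forall e, 0 < e -> exists N, forall n, (N <= n)%N -> norm2 (u n - f) <= e].
Proof.
split=> [[uL fL /cvg0P H]|[uL fL H]]; split=> //.
  move=> e /H[N HN]; exists N => n /HN.
  by rewrite ger0_norm// norm2_ge0.
apply/cvg0P => e /H[N HN]; exists N => n /HN.
by rewrite ger0_norm// norm2_ge0.
Qed.

Lemma norm2_tri f g h : L2 f -> L2 g -> L2 h ->
  norm2 (f - h) <= norm2 (f - g) + norm2 (g - h).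
Proof.
move=> fL gL hL; rewrite (_ : f - h = (f - g) + (g - h)).
  by apply: norm2D; exact: L2B.
by rewrite addrA subrK.
Qed.

Lemma cvg2_cauchy u f : cvg2 u f -> l2cauchy u.
Proof.
move=> /cvg2P[uL fL uf] e e0; have [N HN] := uf (e / 2) (divr_gt0 e0 (ltr0n _ 2)).
exists N => n m Nn Nm; rewrite (le_trans (norm2_tri (uL n) fL (uL m)))//.
rewrite (norm2BC fL (uL m)) [leRHS](splitr e).
by apply: lerD; exact: HN.
Qed.

(** For fixed [n], Fatou's lemma applied to [u n - u (s (N + j))] as [j] grows bounds
    [norm2 (u n - f)] by the Cauchy modulus. This is the recurrent way of identifying an L2 limit:
    exhibit it pointwise along a subsequence. *)
Lemma cauchy_cvg2 u f (s : nat -> nat) : (forall n, L2 (u n)) -> cmeasurable f ->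
  (forall n, (n <= s n)%N) ->
  ae (fun x => ccvg (fun n => u (s n) x) (f x)) -> l2cauchy u -> cvg2 u f.
Proof.
move=> uL mf sn uf uc.
have H e n N : (forall n m, (N <= n)%N -> (N <= m)%N -> norm2 (u n - u m) <= e) ->
    (N <= n)%N -> L2 (u n - f) /\ norm2 (u n - f) <= e.
  move=> HN Nn; apply: (@fatou_norm2 (fun j => u n - u (s (N + j)%N))).
  - by move=> j; exact: L2B.
  - by apply: cmeasurableB => //; exact: L2_cmeasurable.
  - apply: aeS uf => x ux; apply: (@ccvgB (cst (u n x)) (fun j => u (s (N + j)%N) x)).
      exact: ccvg_cst.
    apply: (@ccvg_sub (fun j => (N + j)%N) (fun j => u (s j) x)) => // j.
    exact: leq_addl.
  - move=> j; apply: HN => //; exact: leq_trans (leq_addr _ _) (sn _).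
have fL : L2 f.
  have [N HN] := uc 1 ltr01; have [dL _] := H _ _ _ HN (leqnn N).
  by rewrite -[f](subKr (u N)); exact: L2B.
apply/cvg2P; split=> // e /uc[N HN]; exists N => n Nn.
by have [] := H _ _ _ HN Nn.
Qed.

(** The integral of [sum_n 4 ^ n |v n|^2] is at most [sum_n 4 ^ - n], so this sum [S] is finite
    almost everywhere; each term is below [S], whence [K = sqrt S]. *)
Lemma ae_summable v : (forall n, L2 (v n)) -> (forall n, norm2 (v n) <= 4 ^- n) ->
  ae (fun x => exists K, 0 <= K /\ forall n, cabs (v n x) <= K * 2 ^- n).
Proof.
move=> vL v4.
pose a n x : \bar R := (4 ^+ n * cabs (v n x) ^+ 2)%:E.
have a0 n x : (0 <= a n x)%E by rewrite lee_fin mulr_ge0 ?sqr_ge0// exprn_ge0.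
have ma n : measurable_fun [set: R] (a n).
  apply/measurable_EFinP; apply: measurable_funM; first exact: measurable_cst.
  by apply: measurable_funX; apply: measurable_cabs; exact: L2_cmeasurable.
have ia : mu.-integrable setT (fun x => \big[+%E/0%E]_(0 <= n <oo) a n x)%E.
  apply/integrableP; split.
    by have := @ge0_emeasurable_sum _ _ R setT a xpredT; apply => //.
  rewrite (_ : (\int[_]_(x in _) _)%E = (\int[mu]_x \big[+%E/0%E]_(0 <= n <oo) a n x)%E); last first.
    by apply: eq_integral => x _; rewrite gee0_abs//; exact: nneseries_ge0.
  rewrite integral_nneseries//.
  (* The majorant [2 ^ - n] is written as [2 / 2 ^ (n + 1)] to match the geometric series of
     [epsilon_trick0], whose sum is bounded by 2. *)
  apply: (@le_lt_trans _ _ (\big[+%E/0%E]_(0 <= n <oo) (2 / (2 ^ n.+1)%:R)%:E)%E).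
    apply: lee_nneseries => [n _ _|n _]; first exact: integral_ge0.
    have -> : (\int[mu]_x a n x)%E = ((4 ^+ n)%:E * sqnorm2 (v n))%E.
      rewrite /sqnorm2 -ge0_integralZl//=.
      - exact: measurable_sqcabs (L2_cmeasurable (vL n)).
      - by move=> x _; rewrite lee_fin sqr_ge0.
    rewrite sqnorm2K// -!EFinM lee_fin.
    have -> : 2 / (2 ^ n.+1)%:R = 2 ^- n :> R.
      by rewrite natrX exprS; field; rewrite expf_neq0.
    rewrite (@le_trans _ _ (4 ^+ n * (4 ^- n) ^+ 2))//.
      by rewrite ler_wpM2l ?exprn_ge0// lerXn2r ?nnegrE ?norm2_ge0// invr_ge0 exprn_ge0.
    rewrite expr2 mulrA divff ?mul1r ?expf_neq0// lef_pV2 ?posrE ?exprn_gt0//.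
    by rewrite lerXn2r ?nnegrE// ler_nat.
  apply: (@le_lt_trans _ _ 2%:E); last exact: ltey.
  exact: (epsilon_trick0 xpredT).
have iae : ae (fun x => [set: R] x -> (\big[+%E/0%E]_(0 <= n <oo) a n x)%E \is a fin_num).
  exact: (integrable_ae measurableT ia).
apply: (aeS _ iae) => x /(_ I); set S := (\big[_/_]_(0 <= _ <oo) _)%E => fx.
have S0 : 0 <= fine S by rewrite fine_ge0// nneseries_ge0.
exists (Num.sqrt (fine S)); split; first exact: sqrtr_ge0.
move=> n; have : (a n x <= S)%E.
  apply: le_trans (nneseries_lim_ge (m := 0) n.+1 _) => //.
  rewrite big_nat_recr //= -[leLHS]add0e leeD2r//.
  by apply: sume_ge0 => i _.
rewrite -(fineK fx) lee_fin => h.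
rewrite -(@ler_pXn2r _ 2)// ?nnegrE ?cabs_ge0 ?mulr_ge0 ?sqrtr_ge0 ?invr_ge0 ?exprn_ge0//.
rewrite exprMn sqr_sqrtr// exprVn -exprM mulnC exprM -natrX.
by rewrite ler_pdivlMr ?exprn_gt0// mulrC.
Qed.

(** With the geometric tail [t n = 2 K / 2 ^ n], the sequence [a - t] increases and [a + t]
    decreases: the intervals between them are nested and shrink to a point. *)
Lemma cvg_geom_bound (a : nat -> R) (K : R) : 0 <= K ->
  (forall n, `|a n.+1 - a n| <= K * 2 ^- n) -> cvgn a.
Proof.
move=> K0 aK.
pose t n : R := 2 * K * 2 ^- n.
have tS n : t n - t n.+1 = K * 2 ^- n.
  by rewrite /t exprS invfM; field; rewrite expf_neq0.
have t0 n : 0 <= t n by rewrite !mulr_ge0 ?invr_ge0 ?exprn_ge0.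
have ct : t @ \oo --> (0 : R).
  rewrite -[0](mulr0 (2 * K)); apply: cvgM; first exact: cvg_cst.
  rewrite (_ : (fun n => 2 ^- n) = (fun n => (2^-1) ^+ n)).
    by apply: cvg_expr; rewrite ger0_norm ?invr_ge0// invf_lt1// ltr1n.
  by apply/funext => n; rewrite exprVn.
have up : {homo (fun n => a n - t n) : n m / (n <= m)%N >-> n <= m}.
  apply/nondecreasing_seqP => n; have := aK n; rewrite -tS ler_norml => /andP[+ _].
  by rewrite -subr_ge0 => h; lra.
have dn n : a n + t n <= a 0%N + t 0%N.
  elim: n => // n; apply: le_trans.
  by have := aK n; rewrite -tS ler_norml => /andP[_ h]; lra.
have cb : cvgn (fun n => a n - t n).
  apply: (nondecreasing_is_cvgn up); exists (a 0%N + t 0%N) => _ [n _ <-].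
  by have := dn n; have := t0 n; lra.
rewrite (_ : a = (fun n => (a n - t n) + t n)); last by apply/funext => n; rewrite subrK.
by apply: is_cvgD => //; apply/cvg_ex; exists 0.
Qed.

Lemma l2_complete u : (forall n, L2 (u n)) -> l2cauchy u -> exists f, cvg2 u f.
Proof.
move=> uL uc.
have /choice[N HN] : forall k, exists N, forall n m, (N <= n)%N -> (N <= m)%N ->
    norm2 (u n - u m) <= 4 ^- k.
  by move=> k; apply: uc; rewrite invr_gt0 exprn_gt0.
(* Adding [k] and all the thresholds up to [N k] makes [s] nondecreasing, with [s k >= k] and
   [s k >= N k]. *)
pose s k := (k + \sum_(i < k.+1) N i)%N.
have sS k : (s k <= s k.+1)%N by rewrite /s [in leqRHS]big_ord_recr /=; lia.
have sN k : (N k <= s k)%N by rewrite /s big_ord_recr /=; lia.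
have vL n : L2 (u (s n.+1) - u (s n)) by exact: L2B.
have v4 n : norm2 (u (s n.+1) - u (s n)) <= 4 ^- n.
  by apply: HN => //; exact: leq_trans (sS n).
exists (aelim (fun n => u (s n))).
apply: (@cauchy_cvg2 _ _ s) => //.
- by apply: cmeasurable_aelim => n; exact: L2_cmeasurable.
- by move=> n; rewrite /s leq_addr.
apply: aeS (ae_summable vL v4) => x [K [K0 xK]].
have cRe : cvgn (fun n => Re (u (s n) x)).
  apply: (cvg_geom_bound K0) => n; apply: le_trans (xK n).
  by have := normRe_le (u (s n.+1) x - u (s n) x); rewrite cReD cReN.
have cIm : cvgn (fun n => Im (u (s n) x)).
  apply: (cvg_geom_bound K0) => n; apply: le_trans (xK n).
  by have := normIm_le (u (s n.+1) x - u (s n) x); rewrite cImD cImN.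
have H : ccvg (fun n => u (s n) x)
    (limn (fun n => Re (u (s n) x)) +i* limn (fun n => Im (u (s n) x))).
  by apply/ccvgP; split.
by rewrite (aelimE H).
Qed.

Lemma cvg2_ae u f : cvg2 u f -> exists s : nat -> nat, (forall n, (n <= s n)%N) /\
  ae (fun x => ccvg (fun n => u (s n) x) (f x)).
Proof.
move=> /cvg2P[uL fL uf].
have /choice[N HN] : forall k, exists N, forall n, (N <= n)%N -> norm2 (u n - f) <= 4 ^- k.
  by move=> k; apply: uf; rewrite invr_gt0 exprn_gt0.
exists (fun k => k + N k)%N; split; first by move=> n; exact: leq_addr.
have vL n : L2 (u (n + N n)%N - f) by exact: L2B.
have v4 n : norm2 (u (n + N n)%N - f) <= 4 ^- n by apply: HN; exact: leq_addl.
apply: aeS (ae_summable vL v4) => x [K [K0 xK]].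
apply: (@le_cvg0 _ (fun n => K * (2^-1) ^+ n)).
  by move=> n; rewrite ger0_norm ?cabs_ge0// exprVn; exact: xK.
rewrite -[0](mulr0 K); apply: cvgM; first exact: cvg_cst.
by apply: cvg_expr; rewrite ger0_norm ?invr_ge0// invf_lt1// ltr1n.
Qed.

Lemma cvg2_cst f : L2 f -> cvg2 (fun=> f) f.
Proof.
move=> fL; apply/cvg2P; split => // e e0; exists 0%N => n _.
by rewrite subrr norm2_0 ltW.
Qed.

Lemma cvg2D u v f g : cvg2 u f -> cvg2 v g -> cvg2 (fun n => u n + v n) (f + g).
Proof.
move=> /cvg2P[uL fL uf] /cvg2P[vL gL vg]; apply/cvg2P; split.
- by move=> n; exact: L2D.
- exact: L2D.
move=> e e0; have e2 : 0 < e / 2 by rewrite divr_gt0.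
have [N HN] := uf _ e2; have [M HM] := vg _ e2; exists (N + M)%N => n NMn.
rewrite opprD addrACA (le_trans (norm2D _ _))//; try exact: L2B.
rewrite [leRHS](splitr e) lerD// ?HN ?HM//.
  exact: leq_trans (leq_addr _ _) NMn.
exact: leq_trans (leq_addl _ _) NMn.
Qed.

Lemma scalefB a f g : scalef a f - scalef a g = scalef a (f - g).
Proof. by apply/funext => x; rewrite /scalef /= mulrBr. Qed.

Lemma cvg2Z a u f : cvg2 u f -> cvg2 (fun n => scalef a (u n)) (scalef a f).
Proof.
move=> /cvg2P[uL fL uf]; apply/cvg2P; split.
- by move=> n; exact: L2Z.
- exact: L2Z.
move=> e e0; have c0 : 0 < cabs a + 1 by rewrite ltr_wpDl ?cabs_ge0.
have [N HN] := uf _ (divr_gt0 e0 c0); exists N => n /HN h.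
rewrite scalefB norm2Z; last exact: L2B.
rewrite (@le_trans _ _ ((cabs a + 1) * norm2 (u n - f)))//.
  by rewrite ler_wpM2r ?norm2_ge0// lerDl.
by rewrite mulrC -ler_pdivlMr.
Qed.

Lemma cvg2B u v f g : cvg2 u f -> cvg2 v g -> cvg2 (fun n => u n - v n) (f - g).
Proof.
move=> uf /(cvg2Z (-1)) vg; rewrite scalefN1.
by under eq_fun do rewrite scalefN1; exact: cvg2D.
Qed.

Lemma cvg2_norm u f : cvg2 u f -> (norm2 \o u) @ \oo --> norm2 f.
Proof.
move=> uf; have [uL fL H] := uf; apply/subr_cvg0; apply: le_cvg0 H => n.
exact: norm2_dist.
Qed.

Lemma cvg2_inner u f g : cvg2 u f -> L2 g -> ccvg (fun n => inner (u n) g) (inner f g).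
Proof.
move=> uf gL; have [uL fL H] := uf.
apply: (@le_cvg0 _ (fun n => norm2 (u n - f) * norm2 g)).
  move=> n; rewrite ger0_norm ?cabs_ge0// -innerBl//; apply: inner_le => //.
  exact: L2B.
by rewrite -[0](mul0r (norm2 g)); apply: cvgM => //; exact: cvg_cst.
Qed.

Lemma ae_eq_cvg2 u f g : cvg2 u f -> cmeasurable g -> ae_eq mu setT f g -> cvg2 u g.
Proof.
move=> /cvg2P[uL fL uf] mg fg; have gL := ae_eq_L2 fL mg fg.
apply/cvg2P; split => // e /uf[N HN]; exists N => n /HN; congr (_ <= _).
apply: ae_eq_norm2; try by apply: cmeasurableB; exact: L2_cmeasurable.
by apply: filterS fg => x /(_ I) h _; congr (u n x - _).
Qed.

End Convergence.

(** * Translations and dominated convergence *)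

Section Translation.
Variable R : realType.
Local Notation mu := (@lebesgue_measure R).
Local Notation cfun := (R -> R[i]).
Local Notation Re := (@complex.Re R).
Local Notation Im := (@complex.Im R).
Local Notation L2 := (@Lp R 2%:E).
Implicit Types (f g h : cfun) (a : R).

Lemma measurable_shift a : measurable_fun setT (fun x : R => x + a).
Proof. by apply: measurable_funD => //; exact: measurable_cst. Qed.

Lemma shift_itv a (p q : R) (b c : bool) :
  (fun x : R => x + a) @^-1` [set` Interval (BSide b p) (BSide c q)] =
  [set` Interval (BSide b (p - a)) (BSide c (q - a))].
Proof.
by apply/seteqP; split => x /=; rewrite !in_itv /=;
  case: b; case: c; rewrite /= ?lerBlDr ?lerBrDr ?ltrBlDr ?ltrBrDr.
Qed.

Lemma lebesgue_measure_shift a (A : set R) : measurable A ->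
  pushforward mu (fun x : R => x + a : measurableTypeR R) A = mu A.
Proof.
move=> mA; apply/esym/lebesgue_measure_unique => //=; first exact: measurable_shift.
move=> _ _ [[b c]] _ <-.
rewrite /pushforward shift_itv// !lebesgue_measure_itv/=.
by rewrite !lte_fin ltrD2r -!EFinB; case: ifP => // _; congr EFin; ring.
Qed.

Lemma ge0_integral_shift a (f : R -> \bar R) : measurable_fun setT f ->
  (forall x, 0 <= f x)%E -> (\int[mu]_x f (x + a)%R = \int[mu]_x f x)%E.
Proof.
move=> mf f0.
have ms := @measurable_shift a.
pose sh : R -> measurableTypeR R := fun x => x + a.
transitivity (\int[pushforward mu sh]_y f y)%E.
  rewrite ge0_integral_pushforward//.
apply: eq_measure_integral => A mA _; exact: lebesgue_measure_shift.
Qed.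

Lemma integral_shift a (f : R -> \bar R) : measurable_fun setT f ->
  (\int[mu]_x f (x + a)%R = \int[mu]_x f x)%E.
Proof.
move=> mf; rewrite integralE [RHS]integralE; congr (_ - _)%E.
  transitivity (\int[mu]_x f^\+ (x + a)%R)%E.
    by apply: eq_integral => x _; rewrite !funeposE.
  by rewrite ge0_integral_shift//; exact: measurable_funepos.
transitivity (\int[mu]_x f^\- (x + a)%R)%E.
  by apply: eq_integral => x _; rewrite !funenegE.
by rewrite ge0_integral_shift//; exact: measurable_funeneg.
Qed.

Definition shiftf a f : cfun := fun x => f (x + a).

Lemma cmeasurable_shiftf a f : cmeasurable f -> cmeasurable (shiftf a f).
Proof. by apply: cmeasurable_comp; exact: measurable_shift. Qed.

Lemma sqnorm2_shiftf a f : cmeasurable f -> sqnorm2 (shiftf a f) = sqnorm2 f.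
Proof.
move=> mf; rewrite /sqnorm2 -[RHS](integral_shift a)//; exact: measurable_sqcabs.
Qed.

Lemma L2_shiftf a f : L2 f -> L2 (shiftf a f).
Proof. by move=> /L2P[mf fi]; apply/L2P; rewrite sqnorm2_shiftf//; split => //; exact: cmeasurable_shiftf. Qed.

Lemma norm2_shiftf a f : L2 f -> norm2 (shiftf a f) = norm2 f.
Proof. by move=> /L2_cmeasurable mf; rewrite !norm2E sqnorm2_shiftf. Qed.

Lemma cintegral_shiftf a f : cmeasurable f -> cintegral (shiftf a f) = cintegral f.
Proof.
move=> [f1 f2]; apply: complexP => /=; rewrite /Rintegral; congr fine.
  by rewrite -[RHS](integral_shift a)//; exact/measurable_EFinP.
by rewrite -[RHS](integral_shift a)//; exact/measurable_EFinP.
Qed.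

Lemma cintegrable_shiftf a f : cintegrable f -> cintegrable (shiftf a f).
Proof.
move=> fi; have /integrableP[_ fi1] := cintegrable_cabs fi.
have ms := cmeasurable_shiftf a (cintegrable_cmeasurable fi).
have ic : mu.-integrable setT (EFin \o (cabs \o shiftf a f)).
  apply/integrableP; split.
    by apply/measurable_EFinP; exact: measurable_cabs.
  move: fi1; rewrite -(@integral_shift a (fun x => `|(EFin \o (cabs \o f)) x|)%E)//.
  apply: measurableT_comp => //; apply/measurable_EFinP.
  exact: measurable_cabs (cintegrable_cmeasurable fi).
exact: (le_cintegrable ms ic).
Qed.

Lemma ae_shift a (P : R -> Prop) : ae P -> ae (fun x => P (x + a)).
Proof.
move=> [N [mN N0 NP]]; exists ((fun x : R => x + a) @^-1` N); split.
- by rewrite -[X in measurable X]setTI; exact: measurable_shift.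
- by rewrite -[RHS]N0; exact: lebesgue_measure_shift.
- by move=> x /= Px; exact: NP.
Qed.

Lemma ae_shifts (P : R -> Prop) : ae P -> ae (fun x => forall k : int, P (x + k%:~R)).
Proof. by move=> aP; apply: ae_int => k; exact: ae_shift. Qed.

End Translation.

Section Dominated.
Variable R : realType.
Local Notation mu := (@lebesgue_measure R).
Local Notation cfun := (R -> R[i]).
Local Notation Re := (@complex.Re R).
Local Notation Im := (@complex.Im R).
Local Notation L2 := (@Lp R 2%:E).
Implicit Types (f g h : cfun) (u : nat -> cfun).

Lemma cdominated u f (G : R -> R) : (forall n, cmeasurable (u n)) -> cmeasurable f ->
  ae (fun x => ccvg (u^~ x) (f x)) -> mu.-integrable setT (EFin \o G) ->
  ae (fun x => forall n, cabs (u n x) <= G x) ->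
  cintegrable f /\ ccvg (fun n => cintegral (u n)) (cintegral f).
Proof.
move=> mu_ [mf1 mf2] uf iG uG.
have [i1 _ c1] : [/\ mu.-integrable setT (EFin \o (Re \o f)), True &
    (fun n => \int[mu]_x (EFin \o (Re \o u n)) x)%E @ \oo --> (\int[mu]_x (EFin \o (Re \o f)) x)%E].
  have [| | | |? _ ?] := @dominated_convergence _ _ R mu setT measurableT
      (fun n => EFin \o (Re \o u n)) (EFin \o (Re \o f)) (EFin \o G) _ _ _ iG; last by split.
  - by move=> n; apply/measurable_EFinP; case: (mu_ n).
  - exact/measurable_EFinP.
  - by apply: aeS uf => x /ccvgP[+ _] _; apply: cvg_EFin; exact: nearW.
  - apply: aeS uG => x + n _ => /(_ n) h /=; rewrite lee_fin; apply: le_trans h.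
    exact: normRe_le.
have [i2 _ c2] : [/\ mu.-integrable setT (EFin \o (Im \o f)), True &
    (fun n => \int[mu]_x (EFin \o (Im \o u n)) x)%E @ \oo --> (\int[mu]_x (EFin \o (Im \o f)) x)%E].
  have [| | | |? _ ?] := @dominated_convergence _ _ R mu setT measurableT
      (fun n => EFin \o (Im \o u n)) (EFin \o (Im \o f)) (EFin \o G) _ _ _ iG; last by split.
  - by move=> n; apply/measurable_EFinP; case: (mu_ n).
  - exact/measurable_EFinP.
  - by apply: aeS uf => x /ccvgP[_ +] _; apply: cvg_EFin; exact: nearW.
  - apply: aeS uG => x + n _ => /(_ n) h /=; rewrite lee_fin; apply: le_trans h.
    exact: normIm_le.
split; first by split.
apply/ccvgP; split => /=.
  by apply: fine_cvg; rewrite fineK//; exact: integrable_fin_num.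
by apply: fine_cvg; rewrite fineK//; exact: integrable_fin_num.
Qed.

Lemma cvg2_dominated u f g : (forall n, cmeasurable (u n)) -> cmeasurable f ->
  ae (fun x => ccvg (u^~ x) (f x)) -> L2 g ->
  ae (fun x => forall n, cabs (u n x) <= cabs (g x)) -> cvg2 u f.
Proof.
move=> mu_ mf uf gL ug.
have uL n : L2 (u n).
  apply/L2P; split => //; have /L2P[_] := gL; apply: le_lt_trans.
  apply: ae_ge0_le_integral => //.
  - by move=> x _; rewrite lee_fin sqr_ge0.
  - exact: measurable_sqcabs.
  - by move=> x _; rewrite lee_fin sqr_ge0.
  - exact: measurable_sqcabs (L2_cmeasurable gL).
  - by apply: aeS ug => x ux _; rewrite lee_fin lerXn2r ?nnegrE ?cabs_ge0.
have fg : ae (fun x => cabs (f x) <= cabs (g x)).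
  apply: (aeS2 _ uf ug) => x /ccvg_cabs ux hx.
  exact: (real_cvg_le ux).
have fL : L2 f.
  apply/L2P; split => //; have /L2P[_] := gL; apply: le_lt_trans.
  apply: ae_ge0_le_integral => //.
  - by move=> x _; rewrite lee_fin sqr_ge0.
  - exact: measurable_sqcabs.
  - by move=> x _; rewrite lee_fin sqr_ge0.
  - exact: measurable_sqcabs (L2_cmeasurable gL).
  - by apply: aeS fg => x ux _; rewrite lee_fin lerXn2r ?nnegrE ?cabs_ge0.
have dL n : L2 (u n - f) by exact: L2B.
split => //.
have [_ H] : cintegrable (0 : cfun) /\ ccvg (fun n => inner (u n - f) (u n - f)) (cintegral (0 : cfun)).
  apply: (@cdominated _ _ (fun x => 4 * cabs (g x) ^+ 2)).
  - by move=> n; apply: cintegrable_cmeasurable; exact: cintegrable_inner.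
  - exact: cmeasurable_cst.
  - apply: (aeS _ uf) => x ux.
    rewrite /ccvg; under eq_fun do rewrite subr0 mulJ cabs_real ger0_norm ?sqr_ge0// expr2.
    by rewrite -[0](mulr0 0); apply: cvgM.
  - exact: integrableZr_Re (cintegrable_sqcabs gL).
  - apply: (aeS2 _ ug fg) => x ux fx n; rewrite mulJ cabs_real ger0_norm ?sqr_ge0//.
    have := cabsB (u n x) (f x); have := ux n; have := cabs_ge0 ((u n - f) x).
    have := cabs_ge0 (u n x); have := cabs_ge0 (f x); move: fx.
    set a := cabs (f x); set b := cabs (g x); set c := cabs (u n x).
    rewrite -[cabs (u n x - f x)]/(cabs ((u n - f) x)).
    set d := cabs _ => *; have : d <= 2 * b by lra.
    move=> ?; have : d ^+ 2 <= (2 * b) ^+ 2 by rewrite lerXn2r ?nnegrE//; lra.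
    by rewrite exprMn -natrX.
apply/cvg0P => e e0; have [N HN] := (cvg0P _).1 H (e ^+ 2) (exprn_gt0 _ e0).
exists N => n /HN; rewrite cintegral0 subr0 innerff// cabs_real normr_id.
rewrite !ger0_norm ?sqr_ge0 ?norm2_ge0//.
by rewrite ler_pXn2r ?nnegrE ?norm2_ge0//; exact: ltW.
Qed.

End Dominated.

(** * Symmetric sums over the integers and unit tiles *)

Section Psum.
Variable V : nmodType.
Implicit Types a b : int -> V.

(** The sum [psumZ] with values in any additive monoid, so that it also serves for real sequences
    and for sequences of functions; on complex sequences the two are convertible. *)
Definition psum a (n : nat) : V := \sum_(i < n.*2.+1) a (i%:Z - n%:Z).

Lemma psum0 a : psum a 0 = a 0.
Proof. by rewrite /psum big_ord1 subr0. Qed.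

Lemma psumS a n : psum a n.+1 = a (- n.+1%:Z) + psum a n + a n.+1%:Z.
Proof.
rewrite /psum doubleS big_ord_recl /= add0r -addrA; congr (_ + _).
rewrite big_ord_recr /=; congr (_ + _).
  by apply: eq_bigr => i _; congr (a _); rewrite /bump /=; lia.
by congr (a _); rewrite /bump /=; lia.
Qed.

Lemma eq_psum a b n : a =1 b -> psum a n = psum b n.
Proof. by move=> ab; apply: eq_bigr => i _. Qed.

Lemma psumD a b n : psum (fun k => a k + b k) n = psum a n + psum b n.
Proof. exact: big_split. Qed.

Lemma psum_supp a n m : (forall k : int, (n < `|k|)%N -> a k = 0) -> (n <= m)%N ->
  psum a m = psum a n.
Proof.
move=> a0; elim: m => [|m IH]; first by rewrite leqn0 => /eqP ->.
rewrite leq_eqVlt => /predU1P[->//|]; rewrite ltnS => nm.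
by rewrite psumS IH// !a0 ?add0r ?addr0//; lia.
Qed.

Lemma psum_delta (j : int) (v : V) n :
  psum (fun k => if k == j then v else 0) n = if (`|j| <= n)%N then v else 0.
Proof.
elim: n => [|n IH].
  by rewrite psum0 leqn0 absz_eq0 eq_sym.
rewrite psumS IH.
by case: ifP => h1; case: ifP => h2; case: ifP => h3; case: ifP => h4;
  rewrite ?add0r ?addr0//; lia.
Qed.

End Psum.

Section PsumReal.
Variable R : realType.
Implicit Types (a b : int -> R).

Lemma le_psum a b n : (forall k, a k <= b k) -> psum a n <= psum b n.
Proof. by move=> ab; apply: ler_sum => i _. Qed.

Lemma psum_ge0 a n : (forall k, 0 <= a k) -> 0 <= psum a n.
Proof. by move=> a0; apply: sumr_ge0. Qed.

Lemma psum_homo a : (forall k, 0 <= a k) -> {homo psum a : n m / (n <= m)%N >-> n <= m}.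
Proof.
move=> a0; apply/nondecreasing_seqP => n; rewrite psumS.
by have := a0 n.+1%:Z; have := a0 (- n.+1%:Z); lra.
Qed.

Lemma psumZl (c : R) a n : psum (fun k => c * a k) n = c * psum a n.
Proof. by rewrite /psum mulr_sumr. Qed.

Lemma psumZc (c : R[i]) (a : int -> R[i]) n : psum (fun k => c * a k) n = c * psum a n.
Proof. by rewrite /psum mulr_sumr. Qed.

Lemma cabs_psum (a : int -> R[i]) n : cabs (psum a n) <= psum (cabs \o a) n.
Proof.
elim: n => [|n IH]; first by rewrite !psum0.
by rewrite !psumS (le_trans (cabsD _ _))// lerD// (le_trans (cabsD _ _))// lerD.
Qed.

Lemma psum_cvg a (K : R) : (forall k, 0 <= a k) -> (forall n, psum a n <= K) ->
  cvgn (psum a).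
Proof.
move=> a0 aK; apply: (nondecreasing_is_cvgn (psum_homo a0)).
by exists K => _ [n _ <-].
Qed.

(** [a] is the difference of the nonnegative families [a + |a|] and [|a|], whose symmetric sums are
    nondecreasing and bounded. *)
Lemma psum_abs_cvg a (K : R) : (forall n, psum (fun k => `|a k|) n <= K) -> cvgn (psum a).
Proof.
move=> aK.
have c1 : cvgn (psum (fun k => `|a k|)) by exact: psum_cvg aK.
have c2 : cvgn (psum (fun k => a k + `|a k|)).
  apply: (@psum_cvg _ (K + K)) => [k|n].
    by rewrite -lerBlDr sub0r lerNl ler_normr lexx orbT.
  rewrite psumD lerD// (le_trans _ (aK n))//; apply: le_psum => k; exact: ler_norm.
rewrite (_ : psum a = (fun n => psum (fun k => a k + `|a k|) n - psum (fun k => `|a k|) n)).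
  exact: is_cvgB.
by apply/funext => n; rewrite psumD addrK.
Qed.

Lemma psum_Re (a : int -> R[i]) n : complex.Re (psum a n) = psum (@complex.Re R \o a) n.
Proof. exact: Re_sum. Qed.

Lemma psum_Im (a : int -> R[i]) n : complex.Im (psum a n) = psum (@complex.Im R \o a) n.
Proof. exact: Im_sum. Qed.

Lemma psum_ccvg (a : int -> R[i]) (K : R) : (forall n, psum (cabs \o a) n <= K) ->
  exists l, ccvg (psum a) l.
Proof.
move=> aK.
have c1 : cvgn (@complex.Re R \o psum a).
  rewrite (_ : _ \o _ = psum (@complex.Re R \o a)); last first.
    by apply/funext => n; exact: psum_Re.
  apply: (@psum_abs_cvg _ K) => n; apply: le_trans (aK n).
  by apply: le_psum => k; exact: normRe_le.
have c2 : cvgn (@complex.Im R \o psum a).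
  rewrite (_ : _ \o _ = psum (@complex.Im R \o a)); last first.
    by apply/funext => n; exact: psum_Im.
  apply: (@psum_abs_cvg _ K) => n; apply: le_trans (aK n).
  by apply: le_psum => k; exact: normIm_le.
exists (limn (@complex.Re R \o psum a) +i* limn (@complex.Im R \o psum a)).
by apply/ccvgP; split.
Qed.

Lemma csumZE (a : int -> R[i]) l : ccvg (psum a) l -> csumZ a = l.
Proof.
move=> /ccvgP[r i]; apply: complexP => /=.
  exact: (cvg_lim (@Rhausdorff R) r).
exact: (cvg_lim (@Rhausdorff R) i).
Qed.

End PsumReal.

Section Tiles.
Variable R : realType.
Local Notation mu := (@lebesgue_measure R).
Local Notation cfun := (R -> R[i]).
Local Notation Re := (@complex.Re R).
Local Notation Im := (@complex.Im R).
Local Notation L2 := (@Lp R 2%:E).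
Implicit Types (f g h : cfun) (u : nat -> cfun).

Definition ind01 : cfun := fun x => ((0 <= x) && (x < 1))%:R.

Lemma ind01E x : ind01 x = (\1_(`[0, 1[%classic) x)%:C.
Proof.
rewrite indicE /ind01 mem_setE in_itv /=.
by case: (_ && _).
Qed.

Lemma cmeasurable_ind01 : cmeasurable ind01.
Proof.
split; last first.
  rewrite (_ : _ \o _ = cst 0) //.
  by apply/funext => x /=; rewrite ind01E.
rewrite (_ : _ \o _ = (\1_(`[0, 1[%classic) : R -> R)).
  exact: measurable_indic.
by apply/funext => x /=; rewrite ind01E.
Qed.

Lemma cabs_ind01 x : cabs (ind01 x) <= 1.
Proof. by rewrite /ind01; case: (_ && _); rewrite ?cabs0 ?cabs1. Qed.

Lemma ind01_idem x : ind01 x * ind01 x = ind01 x.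
Proof. by rewrite /ind01; case: (_ && _); rewrite ?mulr1 ?mulr0. Qed.

Lemma ind01J x : (ind01 x)^* = ind01 x.
Proof. by rewrite /ind01; case: (_ && _); rewrite ?rmorph1 ?rmorph0. Qed.

Lemma L2_ind01 : L2 ind01.
Proof.
apply/L2P; split; first exact: cmeasurable_ind01.
rewrite /sqnorm2 (_ : (\int[_]_(x in _) _)%E = (\int[mu]_x (\1_(`[0, 1[%classic) x)%:E)%E).
  rewrite integral_indic// setIT.
  apply: (@le_lt_trans _ _ (mu (`[0, 1[%classic : set R))); first exact: lexx.
  rewrite lebesgue_measure_itv /= lte_fin ltr01 oppr0 adde0.
  exact: ltey.
apply: eq_integral => x _; rewrite ind01E cabs_real indicE.
by case: (_ \in _); rewrite ?normr1 ?normr0 ?expr1n ?expr0n.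
Qed.

Definition restr01 f : cfun := fun x => ind01 x * f x.

Lemma L2_restr01 f : L2 f -> L2 (restr01 f).
Proof. by apply: L2M_bounded; [exact: cmeasurable_ind01|exact: cabs_ind01]. Qed.

(** The tiles [[k, k + 1[] with [|k| <= n] cover [[- n, n + 1[], which is not symmetric about 0.
    Writing this indicator as a sum of tiles is what lets an integral over the line be folded onto
    [[0, 1[]. *)
Definition box n : cfun := fun x => psum (fun k : int => ind01 (x - k%:~R)) n.

Lemma boxE n x : box n x = ((- n%:R <= x) && (x < n%:R + 1))%:R.
Proof.
rewrite /box; elim: n => [|n IH]; first by rewrite psum0 subr0 /ind01 oppr0 add0r.
rewrite psumS IH /ind01 !mulrNz opprK -!pmulrn -!natr1.
have n0 : 0 <= n%:R :> R by [].
have -> : (0 <= x + (n%:R + 1)) = (- (n%:R + 1) <= x) by rewrite -lerBlDr sub0r.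
have -> : (x + (n%:R + 1) < 1) = (x < - n%:R) by apply/idP/idP; lra.
have -> : (0 <= x - (n%:R + 1)) = (n%:R + 1 <= x) by rewrite subr_ge0.
have -> : (x - (n%:R + 1) < 1) = (x < n%:R + 1 + 1) by apply/idP/idP; lra.
case: (leP (- n%:R) x) => h1; case: (ltP x (n%:R + 1)) => h2;
case: (leP (- (n%:R + 1)) x) => h3; case: (ltP x (n%:R + 1 + 1)) => h4 /=;
rewrite ?add0r ?addr0//; exfalso; clear IH; lra.
Qed.

Lemma cmeasurable_box n : cmeasurable (box n).
Proof.
rewrite (_ : box n = \sum_(i < n.*2.+1) shiftf (- (i%:Z - n%:Z)%:~R) ind01).
  by apply: cmeasurable_sum => i; apply: cmeasurable_shiftf; exact: cmeasurable_ind01.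
by apply/funext => x; rewrite /box /psum fct_sumE.
Qed.

Lemma cabs_box n x : cabs (box n x) <= 1.
Proof. by rewrite boxE; case: (_ && _); rewrite ?cabs0 ?cabs1. Qed.

Lemma box_cvg x : exists N, forall n, (N <= n)%N -> box n x = 1.
Proof.
exists (Num.trunc `|x|).+1 => n Nn.
have : `|x| < n%:R.
  by apply: (lt_le_trans (truncnS_gt _)); rewrite ler_nat.
by rewrite ltr_norml boxE => /andP[h1 h2]; rewrite (ltW h1) (lt_trans h2)// ltrDl.
Qed.

Lemma ccvg_eventually (a : nat -> R[i]) l :
  (exists N, forall n, (N <= n)%N -> a n = l) -> ccvg a l.
Proof.
move=> [N HN]; apply/cvg0P => e e0; exists N => n /HN ->.
by rewrite subrr cabs0 normr0 ltW.
Qed.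

Lemma ccvg_box x (z : R[i]) : ccvg (fun n => box n x * z) z.
Proof.
apply: ccvg_eventually; have [N HN] := box_cvg x.
by exists N => n /HN ->; rewrite mul1r.
Qed.

Definition cut n f : cfun := fun x => box n x * f x.

Lemma cmeasurable_cut n f : cmeasurable f -> cmeasurable (cut n f).
Proof. by move=> mf; apply: cmeasurableM => //; exact: cmeasurable_box. Qed.

Lemma cabs_cut n f x : cabs (cut n f x) <= cabs (f x).
Proof. by rewrite cabsM ler_piMl ?cabs_ge0// cabs_box. Qed.

Lemma L2_cut n f : L2 f -> L2 (cut n f).
Proof.
move=> fL; apply: (L2_le _ fL); first exact/cmeasurable_cut/L2_cmeasurable.
exact: cabs_cut.
Qed.

Lemma cintegrable_cut n f : cintegrable f -> cintegrable (cut n f).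
Proof.
move=> fL; apply: (le_cintegrable_cabs _ fL); first exact/cmeasurable_cut/cintegrable_cmeasurable.
exact: cabs_cut.
Qed.

Lemma cvg2_cut f : L2 f -> cvg2 (fun n => cut n f) f.
Proof.
move=> fL; apply: (@cvg2_dominated _ _ _ f) => //.
- by move=> n; exact/cmeasurable_cut/L2_cmeasurable.
- exact: L2_cmeasurable.
- by apply: aeW => x; exact: ccvg_box.
- by apply: aeW => x n; exact: cabs_cut.
Qed.

Lemma ccvg_cintegral_cut f : cintegrable f -> ccvg (fun n => cintegral (cut n f)) (cintegral f).
Proof.
move=> fi.
apply: (proj2 (@cdominated _ (fun n => cut n f) f (cabs \o f) _ _ _ _ _)).
- by move=> n; exact/cmeasurable_cut/cintegrable_cmeasurable.
- exact: cintegrable_cmeasurable.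
- by apply: aeW => x; exact: ccvg_box.
- exact: cintegrable_cabs.
- by apply: aeW => x n; exact: cabs_cut.
Qed.

Lemma cintegral_cut f n : cintegrable f ->
  cintegral (cut n f) = psum (fun k : int => cintegral (restr01 (shiftf k%:~R f))) n.
Proof.
move=> fi.
rewrite (_ : cut n f = \sum_(i < n.*2.+1)
    (fun x => ind01 (x - (i%:Z - n%:Z)%:~R) * f x)); last first.
  by apply/funext => x; rewrite /cut /box /psum fct_sumE mulr_suml.
have H (a : R) : cmeasurable (fun x => ind01 (x - a) * f x).
  by apply: cmeasurableM; [apply: cmeasurable_shiftf; exact: cmeasurable_ind01|exact: cintegrable_cmeasurable].
rewrite cintegral_sum; last first.
  move=> i; apply: (le_cintegrable_cabs (H _) fi) => x.
  by rewrite cabsM ler_piMl ?cabs_ge0// cabs_ind01.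
apply: eq_bigr => i _; rewrite -(cintegral_shiftf (i%:Z - n%:Z)%:~R (H _)).
by congr cintegral; apply/funext => x; rewrite /shiftf /restr01 addrK.
Qed.

Lemma inner_cut f g n : L2 f -> L2 g ->
  inner (cut n f) g = psum (fun k : int => inner (restr01 (shiftf k%:~R f)) (shiftf k%:~R g)) n.
Proof.
move=> fL gL; rewrite /inner.
have -> : (fun x => cut n f x * (g x)^*) = cut n (fun x => f x * (g x)^*).
  by apply/funext => x; rewrite /cut mulrA.
rewrite cintegral_cut; last exact: cintegrable_inner.
by apply: eq_psum => k; congr cintegral; apply/funext => x; rewrite /restr01 /shiftf mulrA.
Qed.

End Tiles.

(** * Periodization *)

Section Periodize.
Variable R : realType.
Local Notation mu := (@lebesgue_measure R).
Local Notation cfun := (R -> R[i]).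
Local Notation Re := (@complex.Re R).
Local Notation Im := (@complex.Im R).
Local Notation L2 := (@Lp R 2%:E).
Implicit Types (f g h F P m : cfun) (u : nat -> cfun).

Definition shiftsum F n : cfun := fun x => psum (fun k : int => F (x + k%:~R)) n.

Lemma cintegrable_restr01 F : cintegrable F -> cintegrable (restr01 F).
Proof.
move=> Fi; apply: (le_cintegrable_cabs _ Fi).
  by apply: cmeasurableM; [exact: cmeasurable_ind01|exact: cintegrable_cmeasurable].
by move=> x; rewrite cabsM ler_piMl ?cabs_ge0// cabs_ind01.
Qed.

Lemma restr01_shiftsum F n : restr01 (shiftsum F n) =
  \sum_(i < n.*2.+1) restr01 (shiftf (i%:Z - n%:Z)%:~R F).
Proof. by apply/funext => x; rewrite fct_sumE /restr01 /shiftsum /psum mulr_sumr. Qed.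

Lemma cintegrable_restr01_shiftsum F n : cintegrable F -> cintegrable (restr01 (shiftsum F n)).
Proof.
move=> Fi; rewrite restr01_shiftsum; apply: cintegrable_sum => i.
by apply: cintegrable_restr01; exact: cintegrable_shiftf.
Qed.

Lemma cintegral_shiftsum F n : cintegrable F -> cintegral (restr01 (shiftsum F n)) = cintegral (cut n F).
Proof.
move=> Fi; rewrite cintegral_cut// restr01_shiftsum cintegral_sum// => i.
by apply: cintegrable_restr01; exact: cintegrable_shiftf.
Qed.

(** Monotone convergence for [|F|] folded onto [[0, 1[]: the partial integrals are those of [|F|]
    over growing boxes, so [sum_k |F (x + k)|] is integrable on [[0, 1[] and finite almost
    everywhere. That sum is the witness [G]; it is exported along with the periodization [P] to keep
    dominated convergence available. *)
Lemma periodize F : cintegrable F -> exists P (G : R -> R),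
  [/\ cmeasurable P, mu.-integrable setT (EFin \o G),
    ae (fun x => ccvg (fun n => restr01 (shiftsum F n) x) (P x)) &
    ae (fun x => forall n, cabs (restr01 (shiftsum F n) x) <= G x)].
Proof.
move=> Fi; pose Fc : cfun := fun x => (cabs (F x))%:C.
have Fci : cintegrable Fc.
  have H : cintegrable (fun x => F x) by [].
  apply: (@le_cintegrable _ _ (cabs \o F)); last first.
  - by move=> x; rewrite cabs_real ger0_norm// cabs_ge0.
  - exact: cintegrable_cabs.
  - split; first exact: measurable_cabs (cintegrable_cmeasurable Fi).
    by rewrite (_ : _ \o _ = cst 0).
pose A n x : R := Re (restr01 (shiftsum Fc n) x).
have AE n x : A n x = Re (ind01 x) * psum (fun k : int => cabs (F (x + k%:~R))) n.
  rewrite /A /restr01 cReM (_ : Im (ind01 x) = 0) ?mul0r ?subr0 ?psum_Re//.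
    by rewrite ind01E.
have I0 x : 0 <= Re (ind01 x) by rewrite ind01E /= indicE.
have A0 n x : 0 <= A n x.
  by rewrite AE mulr_ge0// psum_ge0// => k; exact: cabs_ge0.
have Ai n := cintegrable_restr01_shiftsum n Fci.
pose M := Re (cintegral Fc).
have mA n : measurable_fun [set: R] (fun x => (A n x)%:E).
  by apply/measurable_EFinP; case: (cintegrable_cmeasurable (Ai n)).
have AM n : (\int[mu]_x (A n x)%:E <= M%:E)%E.
  rewrite (_ : (\int[mu]_x (A n x)%:E)%E = (Re (cintegral (restr01 (shiftsum Fc n))))%:E); last first.
    by rewrite /= fineK//; apply: integrable_fin_num => //; case: (Ai n).
  rewrite lee_fin cintegral_shiftsum//; apply: le_Rintegral => //.
  - by case: (cintegrable_cut n Fci).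
  - by case: Fci.
  - move=> x _ /=; rewrite /cut boxE /Fc.
    by case: (_ && _); rewrite ?mul1r ?mul0r /= ?cabs_ge0.
pose L x : \bar R := limn (fun n => (A n x)%:E).
have Ahomo x : {homo (fun n => (A n x)%:E) : n m / (n <= m)%N >-> (n <= m)%E}.
  move=> n m nm; rewrite lee_fin !AE ler_wpM2l//; apply: psum_homo => // k.
  exact: cabs_ge0.
have Lc x : (fun n => (A n x)%:E) @ \oo --> L x.
  by apply: ereal_nondecreasing_is_cvgn.
have AL n x : ((A n x)%:E <= L x)%E.
  rewrite /L (cvg_lim _ (ereal_nondecreasing_cvgn (Ahomo x)))//.
  by apply: ereal_sup_ubound; exists n.
have mL : measurable_fun [set: R] L by exact: (@emeasurable_fun_cvg _ _ _ setT (fun n x => (A n x)%:E) L mA (fun x _ => Lc x)).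
have L0 x : (0 <= L x)%E by apply: le_trans (AL 0%N x); rewrite lee_fin.
have Li : mu.-integrable setT L.
  apply/integrableP; split => //.
  rewrite (_ : (\int[_]_(x in _) _)%E = (\int[mu]_x L x)%E); last first.
    by apply: eq_integral => x _; rewrite gee0_abs.
  apply: (@le_lt_trans _ _ M%:E); last exact: ltey.
  rewrite /L monotone_convergence//; last by move=> n x _; rewrite lee_fin.
  apply: lime_le; last by apply: nearW => n; exact: AM.
  apply: ereal_nondecreasing_is_cvgn => n m nm.
  apply: ge0_le_integral => //; first [exact: mA|by move=> x _; rewrite lee_fin|move=> x _; exact: Ahomo].
have Lfin : ae (fun x => [set: R] x -> L x \is a fin_num).
  exact: (integrable_ae measurableT Li).
have AG x : L x \is a fin_num -> forall n, psum (fun k : int => cabs (ind01 x * F (x + k%:~R))) n <= fine (L x).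
  move=> Lx n; rewrite -lee_fin fineK//; apply: le_trans (AL n x).
  rewrite lee_fin AE -psumZl; apply: le_psum => k.
  by rewrite cabsM ind01E cabs_real ger0_norm// indicE.
exists (aelim (fun n => restr01 (shiftsum F n))), (fine \o L); split.
- by apply: cmeasurable_aelim => n; exact/cintegrable_cmeasurable/cintegrable_restr01_shiftsum.
- apply: le_integrable Li => //.
    by apply/measurable_EFinP; exact: measurableT_comp.
  move=> x _ /=; rewrite ger0_norm ?fine_ge0// gee0_abs//.
  by case: (L x) (L0 x) => //= *; rewrite leey.
- apply: aeS Lfin => x /(_ I) /AG /psum_ccvg[l].
  rewrite (_ : psum _ = (fun n => restr01 (shiftsum F n) x)); last first.
    by apply/funext => n; rewrite psumZc.
  by move=> H; rewrite (aelimE H).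
- apply: aeS Lfin => x /(_ I) /AG h n; apply: le_trans (h n).
  by rewrite /restr01 /shiftsum -psumZc; exact: cabs_psum.
Qed.

(** A periodic factor [m] comes out of every [shiftsum], so folding [m F] onto [[0, 1[] amounts to
    folding [F] alone; [K G] dominates the partial sums. *)
Lemma cintegral_periodize F P (G : R -> R) m (K : R) : cintegrable F -> cmeasurable P ->
  mu.-integrable setT (EFin \o G) ->
  ae (fun x => ccvg (fun n => restr01 (shiftsum F n) x) (P x)) ->
  ae (fun x => forall n, cabs (restr01 (shiftsum F n) x) <= G x) ->
  cmeasurable m -> (forall x, cabs (m x) <= K) -> (forall x (k : int), m (x + k%:~R) = m x) ->
  cintegral (fun x => m x * F x) = cintegral (fun x => m x * P x).
Proof.
move=> Fi mP iG cP bG mm mK mper.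
have K0 : 0 <= K by apply: le_trans (mK 0); exact: cabs_ge0.
have mFi : cintegrable (fun x => m x * F x).
  apply: (@le_cintegrable _ _ (fun x => K * cabs (F x))).
  - by apply: cmeasurableM => //; exact: cintegrable_cmeasurable.
  - exact: integrableZr_Re (cintegrable_cabs Fi).
  - by move=> x; rewrite cabsM ler_wpM2r ?cabs_ge0.
have E n : restr01 (shiftsum (fun x => m x * F x) n) = (fun x => m x * restr01 (shiftsum F n) x).
  apply/funext => x; rewrite /restr01 /shiftsum [RHS]mulrCA; congr (_ * _); rewrite -psumZc.
  by apply: eq_psum => k; rewrite mper.
apply: (ccvg_uniq (ccvg_cintegral_cut mFi)).
apply: (@eq_ccvg _ (fun n => cintegral (fun x => m x * restr01 (shiftsum F n) x))).
  by move=> n; rewrite -E cintegral_shiftsum.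
apply: (proj2 (@cdominated _ (fun n x => m x * restr01 (shiftsum F n) x) _ (fun x => K * G x) _ _ _ _ _)).
- by move=> n; apply: cmeasurableM => //; exact/cintegrable_cmeasurable/cintegrable_restr01_shiftsum.
- exact: cmeasurableM.
- by apply: aeS cP => x; exact: ccvgZ.
- exact: integrableZr_Re.
- by apply: aeS bG => x h n; rewrite cabsM ler_pM ?cabs_ge0.
Qed.

End Periodize.

(** * Fourier series *)

Section Characters.
Variable R : realType.
Local Notation mu := (@lebesgue_measure R).
Local Notation cfun := (R -> R[i]).
Local Notation Re := (@complex.Re R).
Local Notation Im := (@complex.Im R).
Local Notation L2 := (@Lp R 2%:E).
Implicit Types (f g h F P m p : cfun) (u : nat -> cfun) (k j : int).

Definition echar k : cfun := fun x => cis (- (2 * pi * k%:~R * x)).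

Lemma chr0 x : echar 0 x = 1.
Proof. by rewrite /echar mulr0 mul0r oppr0 cis0. Qed.

Lemma echarD j k x : echar (j + k) x = echar j x * echar k x.
Proof. by rewrite /echar -cisD; congr cis; rewrite rmorphD /=; ring. Qed.

Lemma echarJ k x : (echar k x)^* = echar (- k) x.
Proof. by rewrite /echar -cisN; congr cis; rewrite rmorphN /=; ring. Qed.

Lemma echar_per k x j : echar k (x + j%:~R) = echar k x.
Proof.
rewrite /echar (_ : - _ = - (2 * pi * k%:~R * x) + 2 * pi * (- (k * j))%:~R).
  by rewrite cisD cis_2piz mulr1.
by rewrite rmorphN rmorphM /=; ring.
Qed.

Lemma echar_shift k x a : echar k (x + a) = echar k x * cis (- (2 * pi * k%:~R * a)).
Proof. by rewrite /echar -cisD; congr cis; ring. Qed.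

Lemma cabs_echar k x : cabs (echar k x) = 1. Proof. exact: cabs_cis. Qed.

Lemma cmeasurable_cis (a b : R) : cmeasurable (fun x => cis (a * x + b)).
Proof.
have H : measurable_fun setT (fun x : R => a * x + b).
  by apply: measurable_funD => //; exact: measurable_funM.
split; rewrite /comp /=.
  apply: (@measurableT_comp _ _ _ _ _ _ (@cos R)) H.
  by apply: continuous_measurable_fun; exact: continuous_cos.
apply: (@measurableT_comp _ _ _ _ _ _ (@sin R)) H.
by apply: continuous_measurable_fun; exact: continuous_sin.
Qed.

Lemma cmeasurable_echar k : cmeasurable (echar k).
Proof.
rewrite (_ : echar k = (fun x => cis (- (2 * pi * k%:~R) * x + 0))); first exact: cmeasurable_cis.
by apply/funext => x; rewrite addr0 mulNr.
Qed.

Lemma L2_echar k f : L2 f -> L2 (fun x => echar k x * f x).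
Proof.
by apply: (@L2M_bounded _ 1); [exact: cmeasurable_echar|move=> x; rewrite cabs_echar].
Qed.

Lemma psum_opp (V : nmodType) (a : int -> V) n : psum (fun k => a (- k)) n = psum a n.
Proof.
elim: n => [|n IH]; first by rewrite !psum0 oppr0.
by rewrite !psumS IH opprK [LHS]addrC (addrC (a n.+1%:Z)) addrA.
Qed.

Lemma cintegrable_ind01_bounded (K : R) m : cmeasurable m -> (forall x, cabs (m x) <= K) -> cintegrable (restr01 m).
Proof.
move=> mm mK; rewrite (_ : restr01 m = (fun x => m x * ind01 x * ind01 x)).
  apply: cintegrable_mul; last exact: L2_ind01.
  by apply: (L2M_bounded mm mK); exact: L2_ind01.
by apply/funext => x; rewrite -mulrA ind01_idem mulrC.
Qed.

(** The left side is the integral of [m] over [[a, a + 1[]. Folding that interval onto [[0, 1[]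
    meets every point exactly once, and [m] is blind to the integer shifts involved. *)
Lemma cintegral_period_shift (K a : R) m : cmeasurable m -> (forall x, cabs (m x) <= K) ->
  (forall x k, m (x + k%:~R) = m x) ->
  cintegral (restr01 (shiftf a m)) = cintegral (restr01 m).
Proof.
move=> mm mK mper.
pose F : cfun := fun x => ind01 (x - a) * m x.
have FE : restr01 (shiftf a m) = shiftf a F.
  by apply/funext => x; rewrite /F /shiftf /restr01 addrK.
have Fi : cintegrable F.
  rewrite (_ : F = shiftf (- a) (restr01 (shiftf a m))).
    apply: cintegrable_shiftf; apply: (@cintegrable_ind01_bounded K); first exact: cmeasurable_shiftf.
    by move=> x; exact: mK.
  by apply/funext => x; rewrite FE /shiftf subrK.
rewrite FE cintegral_shiftf; last exact: cintegrable_cmeasurable.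
apply: (ccvg_uniq (ccvg_cintegral_cut Fi)); apply: ccvg_eventually.
(* For [x] in [[0, 1[] the point [x - a] lies in the box of size [n] as soon as [n > |a| + 1]; the
   finite sum of tiles is then exactly 1. *)
exists (Num.trunc (`|a| + 1)).+1 => n Nn; rewrite -cintegral_shiftsum//.
congr cintegral; apply/funext => x; rewrite /restr01 /shiftsum.
have [x01|x01] := boolP ((0 <= x) && (x < 1)); last first.
  by rewrite /ind01 (negbTE x01) !mul0r.
congr (_ * _).
rewrite (@eq_psum _ _ (fun k : int => m x * ind01 (x - a + k%:~R))); last first.
  by move=> k; rewrite /F mper mulrC addrAC.
rewrite psumZc -psum_opp.
rewrite (@eq_psum _ _ (fun k : int => ind01 (x - a - k%:~R))); last first.
  by move=> k; rewrite rmorphN.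
rewrite -/(box n (x - a)) boxE (_ : (_ && _) = true) ?mulr1//.
have h : `|a| + 1 < n%:R by apply: (lt_le_trans (truncnS_gt _)); rewrite ler_nat.
have := ler_norm a; have := ler_norm (- a); rewrite normrN => h1 h2.
by move/andP: x01 => [x0 x1]; apply/andP; split; lra.
Qed.

(** A shift by half a period changes the sign of a nontrivial character. *)
Lemma cintegral_echar k : cintegral (restr01 (echar k)) = (k == 0)%:R.
Proof.
have [->|k0] := eqVneq k 0.
  rewrite (_ : restr01 _ = (fun x => ind01 x * (ind01 x)^*)); last first.
    by apply/funext => x; rewrite /restr01 chr0 mulr1 ind01J ind01_idem.
  rewrite -/(inner _ _) innerff; last exact: L2_ind01.
  rewrite sqr_norm2 /sqnorm2.
  rewrite (_ : (\int[_]_(x in _) _)%E = (\int[mu]_x (\1_(`[0, 1[%classic) x)%:E)%E).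
    rewrite integral_indic// setIT.
    by have /= -> := @lebesgue_measure_itv R `[0, 1[; rewrite lte_fin ltr01 oppr0 adde0.
  apply: eq_integral => x _; rewrite ind01E cabs_real indicE.
  by case: (_ \in _); rewrite ?normr1 ?normr0 ?expr1n ?expr0n.
have kR : (k%:~R : R) != 0 by rewrite intr_eq0.
pose a : R := (2 * k%:~R)^-1.
have E : cintegral (restr01 (shiftf a (echar k))) = - cintegral (restr01 (echar k)).
  have ci : cintegrable (restr01 (echar k)).
    by apply: (@cintegrable_ind01_bounded 1); [exact: cmeasurable_echar|move=> x; rewrite cabs_echar].
  rewrite -cintegralN//; congr cintegral; apply/funext => x.
  rewrite /restr01 /shiftf echar_shift (_ : 2 * pi * k%:~R * a = pi); last first.
    by rewrite /a; field; rewrite kR.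
  by rewrite cisN /cis cospi sinpi; rewrite (_ : _^* = -1) ?mulrN1 ?mulrN//; apply: complexP => /=; rewrite ?oppr0.
move: E; rewrite (@cintegral_period_shift 1); first last.
- by move=> x j; exact: echar_per.
- by move=> x; rewrite cabs_echar.
- exact: cmeasurable_echar.
move/eqP; rewrite -addr_eq0 -mulr2n mulrn_eq0 /= => /eqP ->//.
Qed.

Definition ebasis k : cfun := restr01 (echar k).

Lemma L2_ebasis k : L2 (ebasis k).
Proof.
rewrite (_ : ebasis k = (fun x => echar k x * ind01 x)).
  by apply: L2_echar; exact: L2_ind01.
by apply/funext => x; rewrite mulrC.
Qed.

Lemma inner_ebasis j k : inner (ebasis j) (ebasis k) = (j == k)%:R.
Proof.
rewrite -subr_eq0 -cintegral_echar; congr cintegral; apply/funext => x.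
by rewrite /ebasis /restr01 rmorphM /= ind01J echarJ echarD mulrACA ind01_idem.
Qed.

End Characters.

(** * Completeness of the characters over one period *)

Section Completeness.
Variable R : realType.
Local Notation mu := (@lebesgue_measure R).
Local Notation cfun := (R -> R[i]).
Local Notation Re := (@complex.Re R).
Local Notation Im := (@complex.Im R).
Local Notation L2 := (@Lp R 2%:E).
Implicit Types (f g h F P p : cfun) (u : nat -> cfun) (k j : int).

Lemma bernoulli_ge (t : R) m : 0 <= t <= 1 -> 1 - m%:R * t <= (1 - t) ^+ m.
Proof.
move=> /andP[t0 t1]; elim: m => [|m IH]; first by rewrite mul0r subr0 expr0.
rewrite exprS -natr1; apply: (@le_trans _ _ ((1 - t) * (1 - m%:R * t))).
  by have : 0 <= m%:R * t ^+ 2 by [rewrite mulr_ge0// sqr_ge0]; nra.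
by rewrite ler_wpM2l// subr_ge0.
Qed.

(** Bernoulli's inequality for [1 + t], multiplied by [(1 - t) ^+ m], leaves [(1 - t ^+ 2) ^+ m],
    which is at most 1. *)
Lemma bernoulli_le (t : R) m : 0 <= t <= 1 -> (1 - t) ^+ m * (1 + m%:R * t) <= 1.
Proof.
move=> /andP[t0 t1]; apply: (@le_trans _ _ ((1 - t) ^+ m * (1 + t) ^+ m)).
  rewrite ler_wpM2l ?exprn_ge0 ?subr_ge0//.
  elim: m => [|m IH]; first by rewrite mul0r addr0 expr0.
  rewrite exprS -natr1; apply: (@le_trans _ _ ((1 + t) * (1 + m%:R * t))).
    by have : 0 <= m%:R * t ^+ 2 by [rewrite mulr_ge0// sqr_ge0]; nra.
  by rewrite ler_wpM2l// addr_ge0.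
rewrite -exprMn -subr_sqr expr1n exprn_ile1// ?subr_ge0 ?gerBl ?sqr_ge0//.
by rewrite exprn_ile1.
Qed.

(** Converges to [1] for [0 <= s < 1 / 2] and to [0] for [1 / 2 < s <= 1]
    by Bernoulli's inequality, as in the Brosowski-Deutsch proof of the
    Stone-Weierstrass theorem. *)
Definition bernstep (s : R) (n : nat) : R := (1 - s ^+ n) ^+ (2 ^ n).

Lemma bernstep_itv s n : 0 <= s <= 1 -> 0 <= bernstep s n <= 1.
Proof.
move=> /andP[s0 s1]; rewrite /bernstep exprn_ge0 ?subr_ge0 ?exprn_ile1//=.
  by rewrite subr_ge0 exprn_ile1.
by rewrite gerBl exprn_ge0.
Qed.

(** With exponent [2 ^ n] and [t = s ^+ n], the product of exponent and [t] in Bernoulli's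
    inequality is [(2 s) ^+ n]: hence the threshold 1 / 2 and a geometric rate. *)
Lemma bernstep_cvg1 s : 0 <= s -> s < 1 / 2 -> bernstep s n @[n --> \oo] --> (1 : R).
Proof.
move=> s0 s1; have s2 : 0 <= s <= 1 by apply/andP; split => //; lra.
apply/subr_cvg0; apply: (@le_cvg0 _ _ (fun n => (2 * s) ^+ n)); last first.
  by apply: cvg_expr; rewrite ger0_norm; lra.
move=> n; have /andP[q0 q1] := bernstep_itv n s2.
rewrite ler_norml; apply/andP; split; last by rewrite (@le_trans _ _ 0)// ?exprn_ge0//; lra.
have sn : 0 <= s ^+ n <= 1 by rewrite exprn_ge0 ?exprn_ile1//; lra.
by have := bernoulli_ge (2 ^ n) sn; rewrite -/(bernstep s n) natrX -exprMn; lra.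
Qed.

Lemma bernstep_cvg0 s : 1 / 2 < s -> s <= 1 -> bernstep s n @[n --> \oo] --> (0 : R).
Proof.
move=> s0 s1; have s2 : 0 <= s <= 1 by apply/andP; split => //; lra.
apply: (@le_cvg0 _ _ (fun n => (2 * s)^-1 ^+ n)); last first.
  have h : 1 < 2 * s by lra.
  by apply: cvg_expr; rewrite ger0_norm ?invr_ge0 ?invf_lt1//; lra.
move=> n; have /andP[q0 q1] := bernstep_itv n s2.
rewrite ger0_norm//.
have sn : 0 <= s ^+ n <= 1 by rewrite exprn_ge0 ?exprn_ile1//; lra.
have p : 0 < (2 * s) ^+ n by rewrite exprn_gt0//; lra.
have := bernoulli_le (2 ^ n) sn; rewrite -/(bernstep s n) natrX -exprMn exprVn.
by rewrite -[_^-1]mul1r ler_pdivlMr//; nra.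
Qed.

Lemma ccvg_real (a : nat -> R) (l : R) : a @ \oo --> l -> ccvg (fun n => (a n)%:C) l%:C.
Proof. by move=> al; apply/ccvgP; split => /=; [exact: al|exact: cvg_cst]. Qed.

Lemma cintegrableM_bounded (K : R) h p : cintegrable h -> cmeasurable p -> (forall x, cabs (p x) <= K) ->
  cintegrable (fun x => h x * p x).
Proof.
move=> hi mp pK; apply: (@le_cintegrable _ _ (fun x => K * cabs (h x))).
- by apply: cmeasurableM => //; exact: cintegrable_cmeasurable.
- exact: integrableZr_Re (cintegrable_cabs hi).
- by move=> x; rewrite cabsM mulrC ler_wpM2r ?cabs_ge0.
Qed.

Section Annihilator.
Variable h : cfun.
Hypothesis hi : cintegrable h.

(** Asking for orthogonality to every [echar k * p], and not to [p] alone, makes the class stable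
    under multiplication by characters. Powers of trigonometric polynomials are then reached by
    closure, without expanding them. *)
Definition annih p : Prop := exists K : R, [/\ cmeasurable p, forall x, cabs (p x) <= K &
  forall k, cintegral (fun x => h x * (echar k x * p x)) = 0].

Lemma cintegrable_annih k p K : cmeasurable p -> (forall x, cabs (p x) <= K) ->
  cintegrable (fun x => h x * (echar k x * p x)).
Proof.
move=> mp pK; apply: (@cintegrableM_bounded K) => //; first by apply: cmeasurableM => //; exact: cmeasurable_echar.
by move=> x; rewrite cabsM cabs_echar mul1r.
Qed.

Lemma annihD p q : annih p -> annih q -> annih (fun x => p x + q x).
Proof.
move=> [K [mp pK p0]] [K' [mq qK q0]]; exists (K + K'); split.
- exact: cmeasurableD.
- by move=> x; rewrite (le_trans (cabsD _ _))// lerD.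
- move=> k; rewrite -[RHS](addr0 0) -[X in _ = X + _](p0 k) -[X in _ = _ + X](q0 k) -cintegralD.
  + by congr cintegral; apply/funext => x /=; rewrite !mulrDr.
  + exact: cintegrable_annih pK.
  + exact: cintegrable_annih qK.
Qed.

Lemma annihZ a p : annih p -> annih (fun x => a * p x).
Proof.
move=> [K [mp pK p0]]; exists (cabs a * K); split.
- exact: cmeasurableZ.
- by move=> x; rewrite cabsM ler_wpM2l ?cabs_ge0.
- move=> k; rewrite -[RHS](mulr0 a) -(p0 k) -cintegralZ; last exact: cintegrable_annih pK.
  by congr cintegral; apply/funext => x; rewrite /scalef; ring.
Qed.

Lemma annih_echar j p : annih p -> annih (fun x => echar j x * p x).
Proof.
move=> [K [mp pK p0]]; exists K; split.
- by apply: cmeasurableM => //; exact: cmeasurable_echar.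
- by move=> x; rewrite cabsM cabs_echar mul1r.
- move=> k; rewrite -[RHS](p0 (k + j)).
  by congr cintegral; apply/funext => x; rewrite echarD; ring.
Qed.

(** For [0 <= b < c <= 1] and [x] in [(0, 1)], it is less than [1 / 2] exactly
    when [b < x < c]. *)
Definition trig (b c x : R) : R := 1 / 2 - sin (pi * (x - b)) * sin (pi * (c - x)) / 2.

(** By the product-to-sum formula the two sines, each of half frequency, combine into a constant and
    [cos (2 pi x - pi (b + c))]: a trigonometric polynomial of degree 1 and period 1. *)
Lemma trigE b c x : (trig b c x)%:C = (1 / 2 + cos (pi * (c - b)) / 4)%:C +
  (- (8^-1)%:C * cis (- (pi * (b + c))) * echar (- 1) x +
   - (8^-1)%:C * cis (pi * (b + c)) * echar 1 x).
Proof.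
rewrite -mulrA -[in X in _ + (_ + X)]mulrA -mulrDr /echar -!cisD.
set w := pi * (b + c); set t := 2 * pi * x.
rewrite (_ : - w + _ = t - w); last by rewrite /t rmorphN rmorph1; ring.
rewrite (_ : w + _ = - (t - w)); last by rewrite /t rmorph1; ring.
rewrite cisN; apply: complexP; rewrite !reim /=; last by ring.
have -> : cos (t - w) = cos (pi * (x - b) - pi * (c - x)).
  by congr cos; rewrite /t /w; ring.
have -> : pi * (c - b) = pi * (x - b) + pi * (c - x) by ring.
by rewrite cosB cosD /trig; field.
Qed.

Lemma trig_itv b c x : 0 <= trig b c x <= 1.
Proof.
rewrite /trig; set u := sin _; set v := sin _.
have : `|u * v| <= 1 by rewrite normrM mulr_ile1// ?sin_max//; rewrite ler_norml sin_geN1 sin_le1.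
by rewrite ler_norml => /andP[? ?]; apply/andP; split; lra.
Qed.

Lemma annih_trig b c p : annih p -> annih (fun x => (trig b c x)%:C * p x).
Proof.
move=> ap; set A := (1 / 2 + cos (pi * (c - b)) / 4)%:C.
set B := - (8^-1)%:C * cis (- (pi * (b + c))); set D := - (8^-1)%:C * cis (pi * (b + c)).
have := annihD (annihZ A ap) (annihD (annihZ B (annih_echar (-1) ap)) (annihZ D (annih_echar 1 ap))).
by congr annih; apply/funext => x; rewrite trigE -/A -/B -/D; ring.
Qed.

Lemma annih_trigX b c n p : annih p -> annih (fun x => (trig b c x ^+ n)%:C * p x).
Proof.
move=> ap; elim: n => [|n]; first by under eq_fun do rewrite expr0 mul1r.
move/(annih_trig b c); congr annih; apply/funext => x.
by rewrite exprS rmorphM /= mulrA.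
Qed.

Lemma annih_1BX b c n m p : annih p -> annih (fun x => ((1 - trig b c x ^+ n) ^+ m)%:C * p x).
Proof.
move=> ap; elim: m => [|m ap']; first by under eq_fun do rewrite expr0 mul1r.
have := annihD ap' (annihZ (-1) (annih_trigX b c n ap')); congr annih; apply/funext => x.
by rewrite [in RHS]exprS !rmorphM rmorphB rmorph1; ring.
Qed.

Hypothesis h0 : forall k, cintegral (fun x => h x * echar k x) = 0.

Lemma annih_bernstep b c n : cintegral (fun x => h x * (bernstep (trig b c x) n)%:C) = 0.
Proof.
have a1 : annih (fun=> 1).
  exists 1; split; [exact: cmeasurable_cst|by move=> x; rewrite cabs1|move=> k].
  by under eq_fun do rewrite mulr1.
have [K [_ _ /(_ 0)]] := annih_1BX b c n (2 ^ n) a1.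
by under eq_fun do rewrite chr0 mul1r mulr1.
Qed.

Hypothesis h01 : restr01 h = h.

Lemma ae_neq (a : R) : ae (fun x => x != a).
Proof.
exists [set a]; split => //; first exact: lebesgue_measure_set1.
by move=> x /= /negP; rewrite negbK => /eqP.
Qed.

(** The trigonometric polynomials [bernstep (trig b c x) n] stay in [0, 1] and tend to the indicator
    of []b, c[] almost everywhere on [[0, 1[], which contains the support of [h]; dominated
    convergence carries orthogonality over to the limit. *)
Lemma cintegral_itv0 b c : 0 <= b -> b < c -> c <= 1 ->
  cintegral (fun x => h x * ((b < x) && (x < c))%:R) = 0.
Proof.
move=> b0 bc c1.
have mbump n : cmeasurable (fun x => (bernstep (trig b c x) n)%:C).
  have mt : measurable_fun setT (trig b c).
    rewrite (_ : trig b c = Re \o (fun x => (trig b c x)%:C)) //.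
    rewrite (_ : (fun x => _) = (fun x => (1 / 2 + cos (pi * (c - b)) / 4)%:C +
  (- (8^-1)%:C * cis (- (pi * (b + c))) * echar (- 1) x +
   - (8^-1)%:C * cis (pi * (b + c)) * echar 1 x))); last by apply/funext => x; exact: trigE.
    have [//] : cmeasurable (fun x => (1 / 2 + cos (pi * (c - b)) / 4)%:C +
  (- (8^-1)%:C * cis (- (pi * (b + c))) * echar (- 1) x +
   - (8^-1)%:C * cis (pi * (b + c)) * echar 1 x)).
    apply: cmeasurableD; first exact: cmeasurable_cst.
    by apply: cmeasurableD; apply: cmeasurableZ; exact: cmeasurable_echar.
  split; last by rewrite (_ : _ \o _ = cst 0).
  rewrite (_ : _ \o _ = (fun x => bernstep (trig b c x) n))//.
  apply: measurable_funX; apply: measurable_funB; first exact: measurable_cst.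
  exact: measurable_funX.
have bb n x : cabs (bernstep (trig b c x) n)%:C <= 1.
  by have /andP[? ?] := bernstep_itv n (trig_itv b c x); rewrite cabs_real ger0_norm.
have pp := @pi_gt0 R.
apply: (@ccvg_uniq _ (fun n => cintegral (fun x => h x * (bernstep (trig b c x) n)%:C))); last first.
  by apply: (eq_ccvg _ (ccvg_cst 0)) => n; rewrite annih_bernstep.
apply: (proj2 (@cdominated _ (fun n x => h x * (bernstep (trig b c x) n)%:C) _ (cabs \o h) _ _ _ _ _)).
- by move=> n; apply: cmeasurableM => //; exact: cintegrable_cmeasurable.
- apply: cmeasurableM; first exact: cintegrable_cmeasurable.
  rewrite (_ : (fun x => _) = (fun x => (\1_(`]b, c[%classic) x)%:C)); last first.
    by apply/funext => x; rewrite indicE mem_setE in_itv /=; case: (_ && _).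
  split; last by rewrite (_ : _ \o _ = cst 0).
  by rewrite (_ : _ \o _ = \1_(`]b, c[%classic))//; exact: measurable_indic.
(* At [b] and [c], and at 0 when [c = 1], [trig b c] equals 1 / 2, where [bernstep] tends to neither
   0 nor 1. *)
- apply: (aeS2 _ (ae_neq 0) (aeS2 (S := fun x => x != b /\ x != c) _ (ae_neq b) (ae_neq c))).
    2: by [].
  move=> x x0 [xb xc].
  have [x01|x01] := boolP ((0 <= x) && (x < 1)); last first.
    have -> : h x = 0 by rewrite -h01 /restr01 /ind01 (negbTE x01) mul0r.
    by apply: (eq_ccvg _ (ccvg_cst _)) => n; rewrite /= !mul0r.
  apply: ccvgZ; move: x01 => /andP[x0' x1].
  have {x0 x0'}x0 : 0 < x by rewrite lt0r x0.
  have sinp (y : R) : 0 < y < 1 -> 0 < sin (pi * y).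
    by move=> /andP[y0 y1]; apply: sin_gt0_pi; apply/andP; split; [exact: mulr_gt0|rewrite gtr_pMr].
  have /andP[t0 t1] := trig_itv b c x.
  case: (ltP b x) => bx /=; last first.
    have {xb}bx : x < b by rewrite lt_neqAle xb.
    have h1 : 0 < sin (pi * (b - x)) by apply: sinp; apply/andP; split; lra.
    have h2 : 0 < sin (pi * (c - x)) by apply: sinp; apply/andP; split; lra.
    apply: ccvg_real; apply: bernstep_cvg0 => //.
    rewrite /trig -(opprB b x) mulrN sinN mulNr mulNr opprK ltrDl divr_gt0//.
    exact: mulr_gt0.
  have h1 : 0 < sin (pi * (x - b)) by apply: sinp; apply/andP; split; lra.
  case: (ltP x c) => xc' /=.
    have h2 : 0 < sin (pi * (c - x)) by apply: sinp; apply/andP; split; lra.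
    apply: ccvg_real; apply: bernstep_cvg1 => //.
    by rewrite /trig ltrBlDr ltrDl divr_gt0// mulr_gt0.
  have {xc'}cx : c < x by rewrite lt_neqAle eq_sym xc.
  have h2 : 0 < sin (pi * (x - c)) by apply: sinp; apply/andP; split; lra.
  apply: ccvg_real; apply: bernstep_cvg0 => //.
  rewrite /trig -(opprB x c) mulrN sinN mulrN mulNr opprK ltrDl divr_gt0//.
  exact: mulr_gt0.
- exact: cintegrable_cabs.
- by apply: aeW => x n; rewrite cabsM ler_piMr ?cabs_ge0.
Qed.

(** Since [h] vanishes off [[0, 1[], the half-line up to [y] may be replaced, almost everywhere, by
    []0, min y 1[], which is empty when [y <= 0]. *)
Lemma cintegral_le0 (y : R) : cintegral (fun x => h x * (x <= y)%R%:R) = 0.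
Proof.
have mh := cintegrable_cmeasurable hi.
have mi : cmeasurable (fun x : R => (x <= y)%R%:R).
  rewrite (_ : (fun x => _) = (fun x => (\1_(`]-oo, y]%classic) x)%:C)); last first.
    by apply/funext => x; rewrite indicE mem_setE in_itv /=; case: (_ <= _).
  split; last by rewrite (_ : _ \o _ = cst 0).
  by rewrite (_ : _ \o _ = \1_(`]-oo, y]%classic))//; exact: measurable_indic.
have mhi : cmeasurable (fun x => h x * (x <= y)%R%:R) by exact: cmeasurableM.
have hx0 x : (0 <= x < 1) = false -> h x = 0.
  by move=> x01; rewrite -h01 /restr01 /ind01 x01 mul0r.
have [y0|y0] := leP y 0.
  rewrite -[RHS](@cintegral0 R); apply: ae_eq_cintegral => //; first exact: cmeasurable_cst.
  apply/ae_eqP; apply: (aeS _ (ae_neq 0)) => x xN0.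
  case: (leP x y) => xy; last by rewrite mulr0.
  rewrite hx0 ?mul0r//; apply/negbTE; rewrite negb_and -ltNge.
  by rewrite lt_neqAle xN0 (le_trans xy).
have mi2 (c : R) : cmeasurable (fun x : R => ((0 < x) && (x < c))%:R).
  rewrite (_ : (fun x => _) = (fun x => (\1_(`]0, c[%classic) x)%:C)); last first.
    by apply/funext => x; rewrite indicE mem_setE in_itv /=; case: (_ && _).
  split; last by rewrite (_ : _ \o _ = cst 0).
  by rewrite (_ : _ \o _ = \1_(`]0, c[%classic))//; exact: measurable_indic.
have c1 : Num.min y 1 <= 1 by rewrite ge_min lexx orbT.
have c0 : 0 < Num.min y 1 by rewrite lt_min y0 ltr01.
rewrite -[RHS](cintegral_itv0 (lexx 0) c0 c1); apply: ae_eq_cintegral => //.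
  exact: cmeasurableM.
apply/ae_eqP; apply: (aeS2 _ (ae_neq 0) (ae_neq y)) => x x0 xy.
have [x01|x01] := boolP (0 <= x < 1); last by rewrite hx0 ?mul0r//; exact: negbTE.
move: x01 => /andP[x0' x1]; congr (_ * _%:R).
by rewrite lt0r x0 x0' /= lt_min x1 andbT [in RHS]lt_neqAle xy.
Qed.

(** Lebesgue differentiation: almost everywhere [f] is the derivative of its primitive from minus
    infinity, and that primitive is zero by hypothesis. *)
Lemma ae_zero_of_cdf (f : R -> R) : mu.-integrable setT (EFin \o f) ->
  (forall y, \int[mu]_x (f x * (x <= y)%R%:R) = 0) -> ae (fun x => f x = 0).
Proof.
move=> fi f0.
have fL : locally_integrable setT f by apply: open_integrable_locally => //; exact: openT.
have fy y : mu.-integrable `]-oo, y] (EFin \o f) by exact: integrableS fi.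
pose D (y : R) : R := \int[mu]_(t in [set` `]-oo, y]]) f t.
have H : ae (fun x => derivable D x 1 /\ derive1 D x = f x) by exact: (FTC1Ny fy fL).
apply: aeS H => x [_ <-].
rewrite (_ : D = cst 0) ?derive1_cst//.
apply/funext => y; rewrite -[RHS](f0 y) /D Rintegral_mkcond.
apply: eq_Rintegral => t _; rewrite patchE mem_setE in_itv /=.
by case: (t <= y); rewrite ?mulr1 ?mulr0.
Qed.

Lemma annih_eq0 : ae (fun x => h x = 0).
Proof.
have [h1 h2] := hi.
have H := cintegral_le0.
have r0 : ae (fun x => Re (h x) = 0).
  apply: ae_zero_of_cdf => // y; have /(congr1 Re) /= := H y => <-.
  apply: eq_Rintegral => x _ /=.
  by case: (x <= y); rewrite ?mulr1 ?mulr0.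
have i0 : ae (fun x => Im (h x) = 0).
  apply: ae_zero_of_cdf => // y; have /(congr1 Im) /= := H y => <-.
  apply: eq_Rintegral => x _ /=.
  by case: (x <= y); rewrite ?mulr1 ?mulr0.
by apply: (aeS2 _ r0 i0) => x ? ?; exact: complexP.
Qed.

End Annihilator.
End Completeness.

(** * Finite combinations of a family and their convergence *)

Section Combinations.
Variable R : realType.
Local Notation mu := (@lebesgue_measure R).
Local Notation cfun := (R -> R[i]).
Local Notation Re := (@complex.Re R).
Local Notation Im := (@complex.Im R).
Local Notation L2 := (@Lp R 2%:E).
Implicit Types (f g h : cfun) (u : nat -> cfun) (k j : int) (c : int -> R[i]).

Definition lincomb (F : int -> cfun) c n : cfun := psum (fun k => scalef (c k) (F k)) n.

Definition sqsum c n : R := psum (fun k => cabs (c k) ^+ 2) n.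

Lemma sqsum_ge0 c n : 0 <= sqsum c n.
Proof. by apply: psum_ge0 => k; exact: sqr_ge0. Qed.

Lemma lincombE F c n x : lincomb F c n x = psumZ (fun k => c k * F k x) n.
Proof. by rewrite /lincomb /psum fct_sumE. Qed.

Lemma lincombD F c c' n : lincomb F (fun k => c k + c' k) n = lincomb F c n + lincomb F c' n.
Proof.
rewrite /lincomb -psumD; apply: eq_psum => k; apply/funext => x.
by rewrite /scalef /= mulrDl.
Qed.

Lemma lincombZ F a c n : lincomb F (fun k => a * c k) n = scalef a (lincomb F c n).
Proof.
apply/funext => x; rewrite /scalef !lincombE -psumZc.
by apply: eq_psum => k; rewrite mulrA.
Qed.

Lemma lincombB F c c' n : lincomb F (fun k => c k - c' k) n = lincomb F c n - lincomb F c' n.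
Proof.
rewrite scalefN1 -lincombZ -lincombD; congr lincomb; apply/funext => k.
by rewrite mulN1r.
Qed.

Lemma L2_lincomb F c n : (forall k, L2 (F k)) -> L2 (lincomb F c n).
Proof. by move=> FL; apply: L2_sum => i; exact: L2Z. Qed.

Lemma inner_lcl F c n g : (forall k, L2 (F k)) -> L2 g ->
  inner (lincomb F c n) g = psum (fun k => c k * inner (F k) g) n.
Proof.
move=> FL gL; rewrite inner_suml//; last by move=> i; exact: L2Z.
by apply: eq_bigr => i _; rewrite innerZl.
Qed.

Lemma inner_lcr F c n g : (forall k, L2 (F k)) -> L2 g ->
  inner g (lincomb F c n) = psum (fun k => (c k)^* * inner g (F k)) n.
Proof.
move=> FL gL; rewrite inner_sumr//; last by move=> i; exact: L2Z.
by apply: eq_bigr => i _; rewrite innerZr.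
Qed.

Definition supp c n := forall k, (n < `|k|)%N -> c k = 0.

Lemma supp_le c n m : (n <= m)%N -> supp c n -> supp c m.
Proof. by move=> nm cn k mk; apply: cn; exact: leq_ltn_trans mk. Qed.

Lemma lincomb_supp F c n m : supp c n -> (n <= m)%N -> lincomb F c m = lincomb F c n.
Proof.
move=> cn nm; apply: psum_supp => // k /cn ->.
by apply/funext => x; rewrite /scalef mul0r.
Qed.

Lemma sqsum_supp c n m : supp c n -> (n <= m)%N -> sqsum c m = sqsum c n.
Proof.
by move=> cn nm; apply: psum_supp => // k /cn ->; rewrite cabs0 expr0n.
Qed.

Definition trunc_seq n c : int -> R[i] := fun k => if (`|k| <= n)%N then c k else 0.

Lemma supp_trunc n c : supp (trunc_seq n c) n.
Proof. by move=> k nk; rewrite /trunc_seq leqNgt nk. Qed.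

Lemma eq_psum_in (V : nmodType) (a b : int -> V) n :
  (forall k, (`|k| <= n)%N -> a k = b k) -> psum a n = psum b n.
Proof.
move=> ab; apply: eq_bigr => i _; apply: ab.
by have := ltn_ord i; lia.
Qed.

Lemma lincomb_trunc F c n : lincomb F (trunc_seq n c) n = lincomb F c n.
Proof. by apply: eq_psum_in => k kn; rewrite /trunc_seq kn. Qed.

Lemma sqsum_trunc c n : sqsum (trunc_seq n c) n = sqsum c n.
Proof. by apply: eq_psum_in => k kn; rewrite /trunc_seq kn. Qed.

Definition tail n c : int -> R[i] := fun k => if (`|k| <= n)%N then 0 else c k.

Lemma tailE n c k : tail n c k = c k - trunc_seq n c k.
Proof. by rewrite /tail /trunc_seq; case: ifP; rewrite ?subrr ?subr0. Qed.

Lemma lincomb_tail F c n m : (n <= m)%N -> lincomb F (tail n c) m = lincomb F c m - lincomb F c n.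
Proof.
move=> nm; rewrite -(lincomb_trunc F c n) -(lincomb_supp F (@supp_trunc n c) nm) -lincombB.
by congr lincomb; apply/funext => k; exact: tailE.
Qed.

Lemma sqsum_tail c n m : (n <= m)%N -> sqsum (tail n c) m = sqsum c m - sqsum c n.
Proof.
move=> nm; rewrite -(sqsum_trunc c n) -(sqsum_supp (@supp_trunc n c) nm).
apply/eqP; rewrite eq_sym subr_eq -psumD; apply/eqP; apply: eq_psum => k.
by rewrite /tail /trunc_seq; case: ifP; rewrite cabs0 expr0n ?add0r ?addr0.
Qed.

Lemma sqsum_cvg c (K : R) : (forall n, sqsum c n <= K) -> cvgn (sqsum c).
Proof. by move=> cK; apply: psum_cvg cK => k; exact: sqr_ge0. Qed.

Lemma sqsum_homo c : {homo sqsum c : n m / (n <= m)%N >-> n <= m}.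
Proof. by apply: psum_homo => k; exact: sqr_ge0. Qed.

(** Applied to the tail of [c], the synthesis bound gives [B] times a difference of two partial sums
    of a convergent series. *)
Lemma lincomb_cauchy F c (B K : R) : 0 <= B -> (forall k, L2 (F k)) ->
  (forall c n, norm2 (lincomb F c n) ^+ 2 <= B * sqsum c n) ->
  (forall n, sqsum c n <= K) -> l2cauchy (lincomb F c).
Proof.
move=> B0 FL FB cK e e0.
(* Dividing by [B + 1] rather than by [B] covers the case [B = 0]. *)
have B1 : 0 < B + 1 by lra.
have e1 : 0 < e ^+ 2 / (B + 1) by rewrite divr_gt0// exprn_gt0.
have cc := sqsum_cvg cK.
have ub n : sqsum c n <= limn (sqsum c) by exact: nondecreasing_cvgn_le (@sqsum_homo c) cc n.
have /cvgrPdist_le /(_ _ e1) [N _ HN] : sqsum c @ \oo --> limn (sqsum c) by [].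
have H n m : (N <= n)%N -> (n <= m)%N -> norm2 (lincomb F c m - lincomb F c n) <= e.
  move=> Nn nm; rewrite -(@ler_pXn2r _ 2)// ?nnegrE ?norm2_ge0 ?(ltW e0)//.
  rewrite -lincomb_tail// (le_trans (FB _ _))// sqsum_tail//.
  have := HN n Nn; rewrite ger0_norm ?subr_ge0// ler_pdivlMr//.
  by have := ub m; have := @sqsum_homo c _ _ nm; nra.
exists N => n m Nn Nm; have [nm|/ltnW mn] := leqP n m; last exact: H.
by rewrite norm2BC ?H//; exact: L2_lincomb.
Qed.

End Combinations.

(** * Bessel's inequality and Parseval's identity *)

Section FourierSeries.
Variable R : realType.
Local Notation mu := (@lebesgue_measure R).
Local Notation cfun := (R -> R[i]).
Local Notation Re := (@complex.Re R).
Local Notation Im := (@complex.Im R).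
Local Notation L2 := (@Lp R 2%:E).
Implicit Types (f g h : cfun) (u : nat -> cfun) (k j : int) (c : int -> R[i]).

Notation ebasis := (@ebasis R).

Lemma inner_lincomb_ebasis c n j : inner (lincomb ebasis c n) (ebasis j) = if (`|j| <= n)%N then c j else 0.
Proof.
rewrite inner_lcl; [|exact: L2_ebasis|exact: L2_ebasis].
rewrite -(psum_delta j (c j) n); apply: eq_psum => k; rewrite inner_ebasis.
by case: eqP => [->|_]; rewrite ?mulr1 ?mulr0.
Qed.

Lemma psum_rc (a : int -> R) n : psum (fun k => (a k)%:C) n = (psum a n)%:C.
Proof. by rewrite /psum rmorph_sum. Qed.

Lemma norm2_lincomb_ebasis c n : norm2 (lincomb ebasis c n) ^+ 2 = sqsum c n.
Proof.
have bL : forall k, L2 (ebasis k) by exact: L2_ebasis.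
apply: (@complexI R); rewrite -innerff; last exact: L2_lincomb.
rewrite inner_lcr//; last exact: L2_lincomb.
rewrite /sqsum -psum_rc; apply: eq_psum_in => k kn.
by rewrite inner_lincomb_ebasis kn -mulJ mulrC.
Qed.

Lemma bessel h n : L2 h -> sqsum (fun k => inner h (ebasis k)) n <= norm2 h ^+ 2.
Proof.
move=> hL; have bL : forall k, L2 (ebasis k) by exact: L2_ebasis.
set c := fun k => _.
have := sqr_ge0 (norm2 (h - lincomb ebasis c n)).
rewrite sqr_norm2B//; last exact: L2_lincomb.
rewrite norm2_lincomb_ebasis inner_lcr//.
rewrite (@eq_psum _ _ (fun k => (cabs (c k) ^+ 2)%:C)).
  by rewrite psum_rc /= -/(sqsum c n); lra.
by move=> k; rewrite -/(c k) -mulJ mulrC.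
Qed.

Lemma restr01_idem f : restr01 (restr01 f) = restr01 f.
Proof. by apply/funext => x; rewrite /restr01 mulrA ind01_idem. Qed.

(** Bessel's inequality and the completeness of L2 provide a limit [s] of the series. Its difference
    with [h] has only zero Fourier coefficients, so it is zero almost everywhere by [annih_eq0]. *)
Lemma fourier_series h : L2 h -> restr01 h = h ->
  cvg2 (lincomb ebasis (fun k => inner h (ebasis k))) h.
Proof.
move=> hL h01; have bL : forall k, L2 (ebasis k) by exact: L2_ebasis.
set c := fun k => _.
have SL n : L2 (lincomb ebasis c n) by exact: L2_lincomb.
have [s Ss] : exists s, cvg2 (lincomb ebasis c) s.
  apply: l2_complete => //; apply: (@lincomb_cauchy _ _ _ 1 (norm2 h ^+ 2)) => //.
    by move=> c' n; rewrite mul1r norm2_lincomb_ebasis.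
  by move=> n; exact: bessel.
have [_ sL _] := Ss; have rsL := L2_restr01 sL.
have S01 n : restr01 (lincomb ebasis c n) = lincomb ebasis c n.
  apply/funext => x; rewrite /restr01 !lincombE -psumZc; apply: eq_psum => k.
  by rewrite /ebasis /restr01 mulrCA [ind01 x * (_ * _)]mulrA ind01_idem.
(* [s] is known only up to a null set, while [annih_eq0] asks for a function vanishing everywhere
   off [[0, 1[]. The partial sums live on [[0, 1[], so [restr01 s] is a limit as well. *)
have Sr : cvg2 (lincomb ebasis c) (restr01 s).
  move/cvg2P: (Ss) => [_ _ H]; apply/cvg2P; split => // e /H[N HN].
  exists N => n /HN; apply: le_trans.
  rewrite -{1}S01 (_ : _ - _ = restr01 (lincomb ebasis c n - s)); last first.
    by apply/funext => x; rewrite /restr01 /= mulrBr.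
  rewrite -(@ler_pXn2r _ 2)// ?nnegrE ?norm2_ge0// -lee_fin -!sqnorm2K; last 2 first.
  - exact: L2B.
  - by apply: L2_restr01; exact: L2B.
  have dL : L2 (lincomb ebasis c n - s) by exact: L2B.
  apply: le_sqnorm2; [exact/L2_cmeasurable/L2_restr01|exact: L2_cmeasurable|move=> x].
  by rewrite /restr01 cabsM ler_piMl ?cabs_ge0// cabs_ind01.
pose d := h - restr01 s; have dL : L2 d by exact: L2B.
have d01 : restr01 d = d.
  by rewrite /d -{2}h01 -(restr01_idem s); apply/funext => x; rewrite /restr01 /= mulrBr mulrA ind01_idem.
have di : cintegrable d.
  rewrite -d01 (_ : restr01 d = (fun x => d x * ind01 x)).
    by apply: cintegrable_mul => //; exact: L2_ind01.
  by apply/funext => x; rewrite /restr01 mulrC.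
have d0 k : inner d (ebasis k) = 0.
  rewrite innerBl//; apply/eqP; rewrite subr_eq0; apply/eqP.
  apply: (ccvg_uniq (a := fun n => inner (lincomb ebasis c n) (ebasis k))); last exact: cvg2_inner Sr _.
  apply: ccvg_eventually; exists `|k|%N => n kn.
  by rewrite inner_lincomb_ebasis kn.
have : ae (fun x => d x = 0).
  apply: annih_eq0 => // k; rewrite -[RHS](d0 (- k)) -[in LHS]d01.
  congr cintegral; apply/funext => x.
  by rewrite /ebasis /restr01 rmorphM /= ind01J echarJ opprK; ring.
move=> dae; apply: (ae_eq_cvg2 Sr); first exact: L2_cmeasurable.
apply/ae_eqP; apply: aeS dae => x /eqP; rewrite /d subr_eq0 => /eqP ->//.
Qed.

Lemma parseval h : L2 h -> restr01 h = h ->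
  sqsum (fun k => inner h (ebasis k)) @ \oo --> norm2 h ^+ 2.
Proof.
move=> hL h01; have := cvg2_norm (fourier_series hL h01) => H.
set c := fun k => inner h (ebasis k).
rewrite (_ : sqsum c = (fun n => norm2 (lincomb ebasis c n) * norm2 (lincomb ebasis c n))); last first.
  by apply/funext => n; rewrite -expr2 norm2_lincomb_ebasis.
by rewrite expr2; exact: cvgM.
Qed.

End FourierSeries.

(** * Plancherel's theorem *)

Section Plancherel.
Variable R : realType.
Local Notation mu := (@lebesgue_measure R).
Local Notation cfun := (R -> R[i]).
Local Notation Re := (@complex.Re R).
Local Notation Im := (@complex.Im R).
Local Notation L2 := (@Lp R 2%:E).
Local Notation ebasis := (@ebasis R).
Implicit Types (f g h u v : cfun) (k j : int).

Definition modul (t : R) u : cfun := fun x => u x * cis (- (2 * pi * x * t)).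

Lemma cmeasurable_modul t u : cmeasurable u -> cmeasurable (modul t u).
Proof.
move=> mu_; apply: cmeasurableM => //.
rewrite (_ : (fun x => _) = (fun x => cis (- (2 * pi * t) * x + 0))); first exact: cmeasurable_cis.
by apply/funext => x; congr cis; ring.
Qed.

Lemma cabs_modul t u x : cabs (modul t u x) = cabs (u x).
Proof. by rewrite /modul cabsM cabs_cis mulr1. Qed.

Lemma cintegrable_modul t u : cintegrable u -> cintegrable (modul t u).
Proof.
move=> ui; apply: (le_cintegrable_cabs _ ui); first exact/cmeasurable_modul/cintegrable_cmeasurable.
by move=> x; rewrite cabs_modul.
Qed.

Lemma L2_modul t u : L2 u -> L2 (modul t u).
Proof.
move=> ui; apply: (L2_le _ ui); first exact/cmeasurable_modul/L2_cmeasurable.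
by move=> x; rewrite cabs_modul.
Qed.

Lemma fourierL1D f g : cintegrable f -> cintegrable g ->
  fourierL1 (f + g) = fourierL1 f + fourierL1 g.
Proof.
move=> fi gi; apply/funext => t.
rewrite -[RHS](cintegralD (cintegrable_modul t fi) (cintegrable_modul t gi)).
by congr cintegral; apply/funext => x; rewrite /modul /= mulrDl.
Qed.

Lemma fourierL1Z a f : cintegrable f -> fourierL1 (scalef a f) = scalef a (fourierL1 f).
Proof.
move=> fi; apply/funext => t; rewrite /scalef -[RHS](cintegralZ a (cintegrable_modul t fi)).
by congr cintegral; apply/funext => x; rewrite /modul /scalef mulrA.
Qed.

Lemma fourierL1B f g : cintegrable f -> cintegrable g ->
  fourierL1 (f - g) = fourierL1 f - fourierL1 g.
Proof.
move=> fi gi; rewrite !scalefN1 fourierL1D ?fourierL1Z//.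
exact: cintegrableZ.
Qed.

Lemma fourierL1_translate k f : cintegrable f ->
  fourierL1 (translate k f) = (fun t => echar k t * fourierL1 f t).
Proof.
move=> fi; apply/funext => t.
rewrite -[X in _ * X]/(cintegral (modul t f)) -cintegralZ; last exact: cintegrable_modul.
rewrite -[RHS](@cintegral_shiftf _ (- k%:~R)); last exact/cmeasurableZ/cmeasurable_modul/cintegrable_cmeasurable.
congr cintegral; apply/funext => x; rewrite /shiftf /scalef /modul /translate /echar.
by rewrite mulrCA -cisD; congr (_ * cis _); ring.
Qed.

(** The factor 2 comes from bounding the real and imaginary parts separately; the estimate only
    serves to show that transforms are bounded. *)
Lemma cabs_cintegral_le f : cintegrable f ->
  cabs (cintegral f) <= 2 * \int[mu]_x (cabs (f x)).
Proof.
move=> fi; have [f1 f2] := fi; rewrite mulrDl !mul1r (le_trans (cabs_le _))//.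
have ic := cintegrable_cabs fi.
have H (p : R -> R) : mu.-integrable setT (EFin \o p) -> (forall x, `|p x| <= cabs (f x)) ->
    `|\int[mu]_x p x| <= \int[mu]_x (cabs (f x)).
  move=> ip pf; apply: (le_trans (le_normr_Rintegral _ ip)) => //.
  have ia : mu.-integrable setT (EFin \o (fun x => `|p x|)).
    rewrite (_ : EFin \o _ = abse \o (EFin \o p))//.
    exact: integrable_abse.
  exact: (le_Rintegral measurableT ia ic (fun x _ => pf x)).
by apply: lerD; apply: H => // x; [exact: normRe_le|exact: normIm_le].
Qed.

Lemma cabs_fourierL1_le f t : cintegrable f ->
  cabs (fourierL1 f t) <= 2 * \int[mu]_x (cabs (f x)).
Proof.
move=> fi; apply: (le_trans (cabs_cintegral_le (cintegrable_modul t fi))).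
by rewrite ler_wpM2l// le_eqVlt; apply/orP; left; apply/eqP; apply: eq_Rintegral => x _; exact: cabs_modul.
Qed.

Lemma cintegral_param_continuous (w : R -> cfun) (G : R -> R) :
  (forall t, cmeasurable (w t)) -> mu.-integrable setT (EFin \o G) ->
  (forall t x, cabs (w t x) <= G x) ->
  (forall x, continuous (fun t => Re (w t x)) /\ continuous (fun t => Im (w t x))) ->
  cmeasurable (fun t => cintegral (w t)).
Proof.
move=> mw iG wG wc.
have wi t : cintegrable (w t) by exact: (le_cintegrable (mw t) iG).
split; apply: continuous_measurable_fun => t.
  have := @continuity_under_integral R _ _ mu (fun t x => Re (w t x)) setT measurableT
    (t - 1) (t + 1) _ _ G iG _ t.
  apply => //.
  - by move=> s _; case: (wi s).
  - by apply: aeW => x _ s _; case: (wc x).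
  - by move=> s _; apply: aeW => x _; exact: le_trans (normRe_le _) (wG s x).
  - by rewrite inE /= in_itv /= ltrBlDr ltrDl ltr01.
have := @continuity_under_integral R _ _ mu (fun t x => Im (w t x)) setT measurableT
    (t - 1) (t + 1) _ _ G iG _ t.
apply => //.
- by move=> s _; case: (wi s).
- by apply: aeW => x _ s _; case: (wc x).
- by move=> s _; apply: aeW => x _; exact: le_trans (normIm_le _) (wG s x).
- by rewrite inE /= in_itv /= ltrBlDr ltrDl ltr01.
Qed.

Lemma continuous_reim_cis (z : R[i]) (a : R) :
  continuous (fun t => Re (z * cis (- (a * t)))) /\
  continuous (fun t => Im (z * cis (- (a * t)))).
Proof.
have cl t : (fun t => - (a * t)) s @[s --> t] --> - (a * t).
  by apply: cvgN; apply: cvgM; [exact: cvg_cst|exact: cvg_id].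
have cc t : cos (- (a * s)) @[s --> t] --> cos (- (a * t)).
  by apply: (cvg_comp (fun s => - (a * s)) cos (cl t)); exact: continuous_cos.
have cs t : sin (- (a * s)) @[s --> t] --> sin (- (a * t)).
  by apply: (cvg_comp (fun s => - (a * s)) sin (cl t)); exact: continuous_sin.
split=> t.
  rewrite (_ : (fun _ => _) = (fun s => Re z * cos (- (a * s)) - Im z * sin (- (a * s)))); last first.
    by apply/funext => s; rewrite cReM.
  by apply: cvgB; apply: cvgM; (exact: cvg_cst || exact: cc || exact: cs).
rewrite (_ : (fun _ => _) = (fun s => Re z * sin (- (a * s)) + Im z * cos (- (a * s)))); last first.
  by apply/funext => s; rewrite cImM.
by apply: cvgD; apply: cvgM; (exact: cvg_cst || exact: cc || exact: cs).
Qed.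

(** The transform is continuous, since the integrand is continuous in [t] and dominated by [|u|]. *)
Lemma cmeasurable_fourierL1 u : cintegrable u -> cmeasurable (fourierL1 u).
Proof.
move=> ui; apply: (@cintegral_param_continuous (fun t => modul t u) (cabs \o u)).
- by move=> t; exact/cmeasurable_modul/cintegrable_cmeasurable.
- exact: cintegrable_cabs.
- by move=> t x; rewrite cabs_modul.
- by move=> x; exact: continuous_reim_cis.
Qed.

Section CompactSupport.
Variables (u : cfun) (N : nat).
Hypothesis uL : L2 u.
Hypothesis uN : cut N u = u.

Lemma L2_box n : L2 (@box R n).
Proof.
rewrite (_ : box n = \sum_(i < n.*2.+1) shiftf (- (i%:Z - n%:Z)%:~R) (@ind01 R)).
  by apply: L2_sum => i; apply: L2_shiftf; exact: L2_ind01.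
by apply/funext => x; rewrite /box /psum fct_sumE.
Qed.

Lemma compact_cintegrable : cintegrable u.
Proof. by rewrite -uN; apply: cintegrable_mul => //; exact: L2_box. Qed.

Let ui := compact_cintegrable.
Let uh := fourierL1 u.
(** As [u] lives in the box of size [N], the shifts up to [N] already give the whole periodization
    of [modul t u]. *)
Let Z t := restr01 (shiftsum (modul t u) N).
Let B j k := inner (restr01 (shiftf j%:~R u)) (restr01 (shiftf k%:~R u)).

Let L2_piece t k : L2 (restr01 (shiftf k%:~R (modul t u))).
Proof. by apply: L2_restr01; apply: L2_shiftf; exact: L2_modul. Qed.

Let L2_Z t : L2 (Z t).
Proof. by rewrite /Z restr01_shiftsum; apply: L2_sum => i; exact: L2_piece. Qed.

(** The exponential of frequency [t + k] is that of frequency [t] times [echar k], and the latter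
    has period 1, so it comes out of the periodization. The sign in [- k] arises because [echar]
    carries the minus sign of the Fourier kernel and [inner] conjugates its second argument. *)
Let fourier_Z t k : uh (t + k%:~R) = inner (Z t) (ebasis (- k)).
Proof.
rewrite /uh /fourierL1 -/(modul (t + k%:~R) u).
have E : cut N (modul (t + k%:~R) u) = modul (t + k%:~R) u.
  by rewrite -[in RHS]uN; apply/funext => x; rewrite /cut /modul mulrA.
rewrite -E -cintegral_shiftsum; last exact: cintegrable_modul.
congr cintegral; apply/funext => x; rewrite /Z /ebasis /restr01 rmorphM /= ind01J echarJ opprK.
rewrite (_ : _ * _ * _ = ind01 x * (echar k x * shiftsum (modul t u) N x)); last first.
  by rewrite mulrACA ind01_idem [shiftsum _ _ _ * _]mulrC.
congr (_ * _); rewrite /shiftsum -psumZc; apply: eq_psum => j; rewrite /modul.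
rewrite mulrCA; congr (_ * _); rewrite -(echar_per k x j) /echar -cisD.
by congr cis; ring.
Qed.

Let Z01 t : restr01 (Z t) = Z t. Proof. exact: restr01_idem. Qed.

Let sqsum_fourier t n : sqsum (fun k => uh (t + k%:~R)) n = sqsum (fun k => inner (Z t) (ebasis k)) n.
Proof. by rewrite /sqsum -psum_opp; apply: eq_psum => k; rewrite fourier_Z opprK. Qed.

(** In the inner product of two modulated tiles the common factor [cis (- 2 pi x t)] cancels, and
    only the phase [echar (i - l) t] of their offset survives. So the square norm is a trigonometric
    polynomial in [t], whose coefficients are the inner products [B] of the tiles of [u]. *)
Let normZ t : (norm2 (Z t) ^+ 2)%:C =
  \sum_(i < N.*2.+1) \sum_(l < N.*2.+1)
    B (i%:Z - N%:Z) (l%:Z - N%:Z) * echar ((i%:Z - N%:Z) - (l%:Z - N%:Z)) t.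
Proof.
have pL (q : int) : L2 (restr01 (shiftf q%:~R u)) by apply: L2_restr01; exact: L2_shiftf.
have E (q : int) : restr01 (shiftf q%:~R (modul t u)) =
    scalef (echar q t) (modul t (restr01 (shiftf q%:~R u))).
  apply/funext => x; rewrite /scalef /restr01 /shiftf /modul /echar mulrA [RHS]mulrC -[RHS]mulrA.
  by rewrite -cisD; congr (_ * cis _); ring.
have SL := L2_Z t; rewrite -innerff//; rewrite /Z restr01_shiftsum in SL *.
rewrite inner_suml//; apply: eq_bigr => i _.
rewrite inner_sumr//; apply: eq_bigr => l _; rewrite !E.
rewrite innerZl ?innerZr; try exact: L2_modul; last by apply: L2Z; exact: L2_modul.
rewrite [in RHS]mulrC (echarD (i%:Z - N%:Z)) -echarJ mulrA; congr (_ * _).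
congr cintegral; apply/funext => x; rewrite /modul rmorphM /= mulrACA mulJ.
by rewrite cabs_cis expr1n mulr1.
Qed.

Let Nc : cfun := fun t => (norm2 (Z t) ^+ 2)%:C.

Let NcE : Nc = \sum_(i < N.*2.+1) \sum_(l < N.*2.+1)
    scalef (B (i%:Z - N%:Z) (l%:Z - N%:Z)) (echar ((i%:Z - N%:Z) - (l%:Z - N%:Z))).
Proof.
apply/funext => t; rewrite /Nc normZ fct_sumE; apply: eq_bigr => i _.
by rewrite fct_sumE.
Qed.

Let restr01_NcE : restr01 Nc = \sum_(i < N.*2.+1) \sum_(l < N.*2.+1)
    scalef (B (i%:Z - N%:Z) (l%:Z - N%:Z)) (ebasis ((i%:Z - N%:Z) - (l%:Z - N%:Z))).
Proof.
apply/funext => t; rewrite /restr01 NcE !fct_sumE mulr_sumr; apply: eq_bigr => i _.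
rewrite !fct_sumE mulr_sumr; apply: eq_bigr => l _.
by rewrite /scalef /ebasis /restr01 mulrCA.
Qed.

Let cintegrable_ebasis k : cintegrable (ebasis k).
Proof. by apply: (@cintegrable_ind01_bounded _ 1); [exact: cmeasurable_echar|move=> x; rewrite cabs_echar]. Qed.

Let cintegrable_Nc : cintegrable (restr01 Nc).
Proof.
rewrite restr01_NcE; apply: cintegrable_sum => i; apply: cintegrable_sum => l; exact: cintegrableZ.
Qed.

(** Integrating over a period in [t] kills the off-diagonal terms of [normZ]; the diagonal adds up
    the square norms of the tiles of [u]. *)
Let cintegral_Nc : cintegral (restr01 Nc) = (norm2 u ^+ 2)%:C.
Proof.
rewrite restr01_NcE cintegral_sum; last by move=> i; apply: cintegrable_sum => l; exact: cintegrableZ.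
rewrite -innerff// -{1}uN inner_cut//; apply: eq_bigr => i _.
rewrite cintegral_sum; last by move=> l; exact: cintegrableZ.
rewrite (bigD1 i) //= cintegralZ// cintegral_echar subrr eqxx mulr1 big1 ?addr0.
  rewrite /B; congr cintegral; apply/funext => x.
  by rewrite /restr01 rmorphM /= ind01J mulrACA ind01_idem mulrA.
move=> l li; rewrite cintegralZ// cintegral_echar (_ : (_ == _) = false) ?mulr0//.
by apply/negbTE; apply: contraNneq li => h; apply/eqP/val_inj => /=; lia.
Qed.

Let cmeasurable_uh : cmeasurable uh. Proof. exact: cmeasurable_fourierL1. Qed.

Let L2_cut_uh n : L2 (cut n uh).
Proof.
rewrite (_ : cut n uh = (fun x => uh x * box n x)).
  by apply: L2M_bounded (L2_box n) => // x; exact: cabs_fourierL1_le.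
by apply/funext => x; rewrite mulrC.
Qed.

Let sqc v : cfun := fun x => (cabs (v x) ^+ 2)%:C.

(** The integral over the box is folded onto [[0, 1[]: for [t] there and [|k| <= n] the point
    [t + k] lies in [[- n, n + 1[], so the cutoff is 1 in every term. *)
Let norm2_cut_uh n : (norm2 (cut n uh) ^+ 2)%:C =
  cintegral (fun t => ind01 t * (sqsum (fun k => uh (t + k%:~R)) n)%:C).
Proof.
have ci : cintegrable (sqc (cut n uh)).
  have := cintegrable_inner (L2_cut_uh n) (L2_cut_uh n); congr cintegrable; apply/funext => x.
  by rewrite mulJ.
have -> : (norm2 (cut n uh) ^+ 2)%:C = cintegral (cut n (sqc (cut n uh))).
  rewrite -innerff//; congr cintegral; apply/funext => x.
  rewrite mulJ /sqc /cut boxE.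
  by case: (_ && _); rewrite ?mul1r// !mul0r cabs0 expr0n.
rewrite -cintegral_shiftsum//; congr cintegral; apply/funext => t.
rewrite /restr01 /shiftsum /sqsum -psum_rc -!psumZc; apply: eq_psum_in => k kn.
have [t01|t01] := boolP ((0 <= t) && (t < 1)); last by rewrite /ind01 (negbTE t01) !mul0r.
congr (_ * _); rewrite /sqc /cut boxE (_ : (_ && _) = true) ?mul1r//.
have h1 : (- n%:R <= k%:~R :> R) by rewrite (_ : - n%:R = (- n%:Z)%:~R) ?ler_int ?mulrNz//; lia.
have h2 : (k%:~R <= n%:R :> R) by rewrite (_ : n%:R = n%:Z%:~R)// ler_int; lia.
by move/andP: t01 => [? ?]; apply/andP; split; lra.
Qed.

Let le_fourier_Z t n : sqsum (fun k => uh (t + k%:~R)) n <= norm2 (Z t) ^+ 2.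
Proof. by rewrite sqsum_fourier; exact: bessel. Qed.

Let cabs_tile n t :
  cabs (ind01 t * (sqsum (fun k => uh (t + k%:~R)) n)%:C) <= cabs (restr01 Nc t).
Proof.
rewrite /restr01 /Nc !cabsM ler_wpM2l ?cabs_ge0// !cabs_real.
by rewrite !ger0_norm ?sqsum_ge0 ?sqr_ge0.
Qed.

Let cmeasurable_tile n : cmeasurable (fun t => ind01 t * (sqsum (fun k => uh (t + k%:~R)) n)%:C).
Proof.
apply: cmeasurableM; first exact: cmeasurable_ind01.
rewrite (_ : (fun t => _) = \sum_(i < n.*2.+1) (shiftf (i%:Z - n%:Z)%:~R (sqc uh))).
  apply: cmeasurable_sum => i; apply: cmeasurable_shiftf; split; last by rewrite (_ : _ \o _ = cst 0).
  apply: (@measurable_funX _ _ _ _ (cabs \o uh) 2); exact: measurable_cabs.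
by apply/funext => t; rewrite fct_sumE /sqsum -psum_rc.
Qed.

(** Parseval's identity holds for [Z t] at each [t], and Bessel's inequality provides the dominating
    function [norm2 (Z t) ^+ 2]. *)
Let cvg_norm_cut : (fun n => norm2 (cut n uh) ^+ 2) @ \oo --> norm2 u ^+ 2.
Proof.
have H : ccvg (fun n => (norm2 (cut n uh) ^+ 2)%:C) (norm2 u ^+ 2)%:C.
  rewrite -cintegral_Nc.
  under eq_fun do rewrite norm2_cut_uh.
  apply: (proj2 (@cdominated _ _ _ (cabs \o restr01 Nc) _ _ _ _ _)).
  - exact: cmeasurable_tile.
  - exact: cintegrable_cmeasurable.
  - apply: aeW => t; rewrite /restr01; apply: ccvgZ; apply: ccvg_real.
    rewrite (_ : sqsum (fun k => uh (t + k%:~R)) = sqsum (fun k => inner (Z t) (ebasis k))).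
      exact: parseval.
    by apply/funext => n; exact: sqsum_fourier.
  - exact: cintegrable_cabs.
  - by apply: aeW => t n; exact: cabs_tile.
by have /ccvgP[/=] := H.
Qed.

(** Bessel's inequality and Fatou's lemma first put [uh] in L2; only then do its cutoffs converge to
    it in norm, so that [cvg_norm_cut] computes [norm2 uh]. *)
Lemma plancherel_compact : L2 uh /\ norm2 uh = norm2 u.
Proof.
have le n : norm2 (cut n uh) <= norm2 u.
  rewrite -(@ler_pXn2r _ 2)// ?nnegrE ?norm2_ge0//.
  have := congr1 Re (norm2_cut_uh n); have := congr1 Re cintegral_Nc.
  move=> /= <- ->; apply: le_Rintegral => //.
  - by case: (le_cintegrable_cabs (cmeasurable_tile n) cintegrable_Nc (cabs_tile n)).
  - by case: cintegrable_Nc.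
  - move=> t _ /=; rewrite /restr01 /Nc ind01E -!rmorphM /=.
    by rewrite ler_wpM2l// indicE.
have [uhL _] := fatou_norm2 L2_cut_uh cmeasurable_uh (aeW (fun x => ccvg_box x (uh x))) le.
split => //.
have H1 := cvg2_norm (cvg2_cut uhL).
have H2 : (fun n => norm2 (cut n uh) ^+ 2) @ \oo --> norm2 uh ^+ 2.
  by under eq_fun do rewrite expr2; rewrite expr2; exact: cvgM.
have E : norm2 uh ^+ 2 = norm2 u ^+ 2.
  exact: (cvg_unique (@Rhausdorff R) H2 cvg_norm_cut).
by apply/eqP; rewrite -(@eqrXn2 _ 2) ?norm2_ge0// E.
Qed.
End CompactSupport.
End Plancherel.

Section FourierTransform.
Variable R : realType.
Local Notation mu := (@lebesgue_measure R).
Local Notation cfun := (R -> R[i]).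
Local Notation Re := (@complex.Re R).
Local Notation Im := (@complex.Im R).
Local Notation L2 := (@Lp R 2%:E).
Implicit Types (f g h u v : cfun) (k j : int).

Lemma cut_cut n m u : (n <= m)%N -> cut m (cut n u) = cut n u.
Proof.
move=> nm; apply/funext => x; rewrite /cut !boxE.
have h : n%:R <= m%:R :> R by rewrite ler_nat.
case: (boolP (- n%:R <= x < n%:R + 1)) => [/andP[? ?]|_]; last by rewrite mul0r mulr0.
by rewrite (_ : (_ && _) = true) ?mul1r//; apply/andP; split; lra.
Qed.

Lemma cutB n u v : cut n (u - v) = cut n u - cut n v.
Proof. by apply/funext => x; rewrite /cut /= mulrBr. Qed.

(** The transforms of the cutoffs are Cauchy by the compactly supported case, and converge pointwise
    to [fourierL1 u] because [u] is integrable. *)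
Lemma plancherel u : cintegrable u -> L2 u -> L2 (fourierL1 u) /\ norm2 (fourierL1 u) = norm2 u.
Proof.
move=> ui uL; pose w n := cut n u.
have wL n : L2 (w n) by exact: L2_cut.
have wi n : cintegrable (w n) by exact: cintegrable_cut.
have wc : cvg2 w u by exact: cvg2_cut.
have HL n : L2 (fourierL1 (w n)) /\ norm2 (fourierL1 (w n)) = norm2 (w n).
  by apply: (@plancherel_compact _ _ n) => //; exact: cut_cut.
have Hc : cvg2 (fun n => fourierL1 (w n)) (fourierL1 u).
  apply: (@cauchy_cvg2 _ _ _ id) => //.
  - by move=> n; case: (HL n).
  - exact: cmeasurable_fourierL1.
  - apply: aeW => t; have := ccvg_cintegral_cut (cintegrable_modul t ui).
    apply: eq_ccvg => n; congr cintegral; apply/funext => x.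
    by rewrite /cut /modul /w /cut mulrA.
  - move=> e /(cvg2_cauchy wc)[N HN]; exists N => n m Nn Nm.
    rewrite -fourierL1B//.
    (* The difference of two cutoffs is supported in the larger box, so the compact case applies to
       it. *)
    have S : cut (maxn n m) (w n - w m) = w n - w m.
      by rewrite cutB /w !cut_cut// ?leq_maxl ?leq_maxr.
    by have [_ ->] := plancherel_compact (L2B (wL n) (wL m)) S; exact: HN.
split; first by case: Hc.
have H1 := cvg2_norm Hc.
have H2 := cvg2_norm wc.
have E : norm2 \o (fun n => fourierL1 (w n)) = norm2 \o w.
  by apply/funext => n /=; case: (HL n).
rewrite E in H1; exact: (cvg_unique (@Rhausdorff R) H1 H2).
Qed.

Definition is_fourier f g : Prop := exists u : nat -> cfun,
  [/\ forall n, Lp 1 (u n), cvg2 u f & cvg2 (fun n => fourierL1 (u n)) g].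

Lemma is_fourier_L2 f g : is_fourier f g -> L2 f /\ L2 g.
Proof. by move=> [u [_ [_ ? _] [_ ? _]]]. Qed.

Lemma is_fourier_norm f g : is_fourier f g -> norm2 g = norm2 f.
Proof.
move=> [u [/(_ _)/Lp1P ui uf ug]]; have [uL _ _] := uf.
have E : norm2 \o (fun n => fourierL1 (u n)) = norm2 \o u.
  by apply/funext => n /=; case: (plancherel (ui n) (uL n)).
have := cvg2_norm ug; rewrite E => H.
exact: (cvg_unique (@Rhausdorff R) H (cvg2_norm uf)).
Qed.

Lemma is_fourier_D f g f' g' : is_fourier f g -> is_fourier f' g' -> is_fourier (f + f') (g + g').
Proof.
move=> [u [ui uf ug]] [u' [ui' uf' ug']]; exists (fun n => u n + u' n); split.
- by move=> n; apply/Lp1P; apply: cintegrableD; exact/Lp1P.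
- exact: cvg2D.
- rewrite (_ : (fun n => _) = (fun n => fourierL1 (u n) + fourierL1 (u' n))).
    exact: cvg2D.
  by apply/funext => n; rewrite fourierL1D//; exact/Lp1P.
Qed.

Lemma is_fourier_Z a f g : is_fourier f g -> is_fourier (scalef a f) (scalef a g).
Proof.
move=> [u [ui uf ug]]; exists (fun n => scalef a (u n)); split.
- by move=> n; apply/Lp1P; apply: cintegrableZ; exact/Lp1P.
- exact: cvg2Z.
- rewrite (_ : (fun n => _) = (fun n => scalef a (fourierL1 (u n)))); first exact: cvg2Z.
  by apply/funext => n; rewrite fourierL1Z//; exact/Lp1P.
Qed.

Lemma is_fourier_0 : is_fourier 0 0.
Proof.
have E : fourierL1 (0 : cfun) = 0.
  apply/funext => t; rewrite -[RHS](@cintegral0 R); congr cintegral.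
  by apply/funext => x; rewrite mul0r.
exists (fun=> 0); split; first by move=> n; apply/Lp1P; exact: integ0.
  by apply: cvg2_cst; exact: L20.
by rewrite E; apply: cvg2_cst; exact: L20.
Qed.

Lemma is_fourier_sum I (s : seq I) (F G : I -> cfun) : (forall i, is_fourier (F i) (G i)) ->
  is_fourier (\sum_(i <- s) F i) (\sum_(i <- s) G i).
Proof.
move=> FG; elim: s => [|i s IH]; first by rewrite !big_nil; exact: is_fourier_0.
by rewrite !big_cons; exact: is_fourier_D.
Qed.

Lemma L2_translate k f : L2 f -> L2 (translate k f).
Proof. exact: L2_shiftf. Qed.

Lemma norm2_translate k f : L2 f -> norm2 (translate k f) = norm2 f.
Proof. exact: norm2_shiftf. Qed.

Lemma cvg2_translate k (u : nat -> cfun) f : cvg2 u f ->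
  cvg2 (fun n => translate k (u n)) (translate k f).
Proof.
move=> /cvg2P[uL fL H]; apply/cvg2P; split.
- by move=> n; exact: L2_translate.
- exact: L2_translate.
- move=> e /H[N HN]; exists N => n /HN.
  by rewrite -(norm2_translate k (L2B (uL n) fL)).
Qed.

Lemma cvg2_echar k (u : nat -> cfun) f : cvg2 u f ->
  cvg2 (fun n t => echar k t * u n t) (fun t => echar k t * f t).
Proof.
move=> /cvg2P[uL fL H]; apply/cvg2P; split.
- by move=> n; exact: L2_echar.
- exact: L2_echar.
- move=> e /H[N HN]; exists N => n /HN; apply: le_trans.
  rewrite (_ : _ - _ = (fun t => echar k t * (u n - f) t)); last first.
    by apply/funext => t /=; rewrite mulrBr.
  rewrite !norm2E ler_wsqrtr// fine_le ?L2_fin//; try exact: L2B.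
    by apply: L2_echar; exact: L2B.
  apply: le_sqnorm2; last by move=> x; rewrite cabsM cabs_echar mul1r.
    by apply: L2_cmeasurable; apply: L2_echar; exact: L2B.
  by apply: L2_cmeasurable; exact: L2B.
Qed.

Lemma is_fourier_translate k f g : is_fourier f g -> is_fourier (translate k f) (fun t => echar k t * g t).
Proof.
move=> [u [ui uf ug]]; exists (fun n => translate k (u n)); split.
- by move=> n; apply/Lp1P; apply: cintegrable_shiftf; exact/Lp1P.
- exact: cvg2_translate.
- rewrite (_ : (fun n => _) = (fun n t => echar k t * fourierL1 (u n) t)).
    exact: cvg2_echar.
  by apply/funext => n; rewrite fourierL1_translate//; exact/Lp1P.
Qed.

(** Polarization: the norm of a sum determines the real part of the inner product, and multiplying
    one argument by [i] gives the imaginary part. *)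
Lemma is_fourier_inner f g f' g' : is_fourier f g -> is_fourier f' g' -> inner g g' = inner f f'.
Proof.
move=> fg fg'; have [fL gL] := is_fourier_L2 fg; have [fL' gL'] := is_fourier_L2 fg'.
have re h w h' w' : is_fourier h w -> is_fourier h' w' -> Re (inner w w') = Re (inner h h').
  move=> hw hw'; have [hL wL] := is_fourier_L2 hw; have [hL' wL'] := is_fourier_L2 hw'.
  have := is_fourier_norm (is_fourier_D hw hw') => /(congr1 (fun r => r ^+ 2)).
  by rewrite !sqr_norm2D// (is_fourier_norm hw) (is_fourier_norm hw'); lra.
apply: complexP; first exact: re.
have := re _ _ _ _ fg (is_fourier_Z (0 +i* 1) fg').
rewrite !innerZr// !cReM /=; lra.
Qed.

Lemma is_fourier_exists f : L2 f -> is_fourier f (fourier f).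
Proof.
move=> fL.
have wL n : L2 (cut n f) by exact: L2_cut.
have wi n : cintegrable (cut n f) by apply: cintegrable_mul => //; exact: L2_box.
have wc : cvg2 (fun n => cut n f) f by exact: cvg2_cut.
have HL n := plancherel (wi n) (wL n).
have [g Hg] : exists g, cvg2 (fun n => fourierL1 (cut n f)) g.
  apply: l2_complete; first by move=> n; case: (HL n).
  move=> e /(cvg2_cauchy wc)[N HN]; exists N => n m Nn Nm.
  rewrite -fourierL1B//.
  have [_ ->] := plancherel (cintegrableD (wi n) (cintegrableN (wi m))) (L2B (wL n) (wL m)).
  exact: HN.
suff : exists g, is_fourier f g.
  by move=> /(xgetPex (cst 0)).
by exists g, (fun n => cut n f); split => // n; exact/Lp1P.
Qed.

End FourierTransform.

(** * Frames *)

Section Frames.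
Variable R : realType.
Local Notation cfun := (R -> R[i]).
Local Notation Re := (@complex.Re R).
Local Notation Im := (@complex.Im R).
Local Notation L2 := (@Lp R 2%:E).
Local Notation ebasis := (@ebasis R).
Implicit Types (f g h u v : cfun) (k : int) (c : int -> R[i]).

(** The norm of the truncation to [[-n, n]] of a sequence, realised as the
    norm of a trigonometric polynomial. *)
Definition l2norm c n : R := norm2 (lincomb ebasis c n).

Let ebasisL : forall k, L2 (ebasis k) := @L2_ebasis R.

Lemma l2norm_ge0 c n : 0 <= l2norm c n. Proof. exact: norm2_ge0. Qed.

Lemma sqr_l2norm c n : l2norm c n ^+ 2 = sqsum c n. Proof. exact: norm2_lincomb_ebasis. Qed.

Lemma l2normD c c' n : l2norm (fun k => c k + c' k) n <= l2norm c n + l2norm c' n.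
Proof. by rewrite /l2norm lincombD norm2D//; exact: L2_lincomb. Qed.

Lemma l2normZ a c n : l2norm (fun k => a * c k) n = cabs a * l2norm c n.
Proof. by rewrite /l2norm lincombZ norm2Z//; exact: L2_lincomb. Qed.

Lemma l2norm_supp c n m : supp c n -> (n <= m)%N -> l2norm c m = l2norm c n.
Proof. by move=> cn nm; rewrite /l2norm (lincomb_supp _ cn nm). Qed.

Lemma l2norm_le c n (M : R) : 0 <= M -> (l2norm c n <= M) = (sqsum c n <= M ^+ 2).
Proof. by move=> M0; rewrite -sqr_l2norm ler_pXn2r ?nnegrE ?l2norm_ge0. Qed.

Lemma psum_cauchy_schwarz (a b : int -> R[i]) n :
  cabs (psum (fun k => (b k)^* * a k) n) <= l2norm a n * l2norm b n.
Proof.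
have := inner_le (L2_lincomb a n ebasisL) (L2_lincomb b n ebasisL).
rewrite inner_lcr//; last exact: L2_lincomb.
rewrite (@eq_psum_in _ _ (fun k => (b k)^* * a k)) // => k kn.
by rewrite inner_lincomb_ebasis kn.
Qed.

Section Synthesis.
Variables (W : set cfun) (F : int -> cfun) (b : R).
Hypothesis FL : forall k, L2 (F k).
Hypothesis WL : forall f, W f -> L2 f.
Hypothesis b0 : 0 <= b.
Hypothesis Wlc : forall c n, W (lincomb F c n).
Hypothesis up : forall f n, W f -> l2norm (analysis F f) n <= b * norm2 f.

(** Duality: for [w = sum_k c_k F_k] the square norm [<w, w>] pairs [c] with the analysis
    coefficients of [w], at most [b * norm2 w] in norm since [w] lies in [W]; divide by
    [norm2 w]. *)
Lemma synth_bound c n : norm2 (lincomb F c n) <= b * l2norm c n.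
Proof.
set w := lincomb F c n; have wL : L2 w by exact: L2_lincomb.
have [w0|wN0] := eqVneq (norm2 w) 0; first by rewrite w0 mulr_ge0// l2norm_ge0.
have w1 : 0 < norm2 w by rewrite lt0r wN0 norm2_ge0.
rewrite -(ler_pM2l w1) -expr2.
have -> : norm2 w ^+ 2 = cabs (psum (fun k => (c k)^* * analysis F w k) n).
  by rewrite -inner_lcr// -/w innerff// cabs_real ger0_norm// sqr_ge0.
apply: (le_trans (psum_cauchy_schwarz _ _ _)).
by rewrite mulrA ler_wpM2r ?l2norm_ge0// mulrC; exact: up (Wlc c n).
Qed.

Variable a : R.
Hypothesis a0 : 0 < a.
Hypothesis lo : forall f, W f -> exists n, a * norm2 f ^+ 2 <= sqsum (analysis F f) n.
Hypothesis Wsub : forall f g, W f -> W g -> W (f - g).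

(** One damped step of the frame algorithm, with the series truncated. *)
Lemma contraction : exists r D : R, [/\ 0 <= r, r < 1, 0 <= D &
  forall w, W w -> exists n c, [/\ supp c n, norm2 (w - lincomb F c n) <= r * norm2 w &
    l2norm c n <= D * norm2 w]].
Proof.
(* For the truncated frame operator [S], [<S w, w> >= a |w|^2] and [|S w| <= b1 ^+ 2 |w|], so [|w -
   t S w|^2 <= (1 - 2 t a + t ^+ 2 b1 ^+ 4) |w|^2]. This [t] minimizes the factor, with minimum
   [r2]. Taking [b1] above [a], [b] and 1 keeps [r2] in [0, 1). *)
pose b1 := b + a + 1; pose t := a / b1 ^+ 4; pose r2 := 1 - a ^+ 2 / b1 ^+ 4.
have b1p : 0 < b1 by move: (a0) (b0); rewrite /b1; lra.
have b4 : 0 < b1 ^+ 4 by rewrite exprn_gt0.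
have b11 : 1 <= b1 by move: (a0) (b0); rewrite /b1; lra.
have b1a : a <= b1 by move: (a0) (b0); rewrite /b1; lra.
have bb1 : b <= b1 by move: (a0) (b0); rewrite /b1; lra.
have b12 : b1 <= b1 ^+ 2 by nra.
have ab : a ^+ 2 <= b1 ^+ 4.
  rewrite (exprM b1 2 2) lerXn2r ?nnegrE ?sqr_ge0 ?(ltW a0)//.
  exact: le_trans b1a b12.
have r2_ge0 : 0 <= r2 by rewrite /r2 subr_ge0 ler_pdivrMr// mul1r.
have r2_lt1 : r2 < 1 by rewrite /r2 ltrBlDr ltrDl divr_gt0// exprn_gt0.
exists (Num.sqrt r2), (t * b); split.
- exact: sqrtr_ge0.
- by rewrite -sqrtr1 ltr_sqrt.
- by rewrite mulr_ge0// divr_ge0 ?ltW.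
move=> w Ww; have [n Hn] := lo Ww; have wL := WL Ww.
pose d := analysis F w; pose c := fun k => t%:C * d k.
have t0 : 0 <= t by rewrite divr_ge0 ?ltW.
have dn : sqsum d n <= (b * norm2 w) ^+ 2.
  by rewrite -l2norm_le ?mulr_ge0 ?norm2_ge0//; exact: up.
exists n, (trunc_seq n c); split; first exact: supp_trunc.
- rewrite lincomb_trunc -(@ler_pXn2r _ 2)// ?nnegrE ?mulr_ge0 ?norm2_ge0 ?sqrtr_ge0//.
  rewrite exprMn sqr_sqrtr// lincombZ.
  have SL : L2 (lincomb F d n) by exact: L2_lincomb.
  rewrite sqr_norm2B//; last exact: L2Z.
  rewrite norm2Z// cabs_real ger0_norm// innerZr//.
  have -> : Re (t%:C^* * inner w (lincomb F d n)) = t * sqsum d n.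
    rewrite inner_lcr// (@eq_psum _ _ (fun k => (cabs (d k) ^+ 2)%:C)).
      by rewrite psum_rc cReM /= /sqsum; ring.
    by move=> k; rewrite -mulJ mulrC.
  have S1 := synth_bound d n.
  have S2 : norm2 (lincomb F d n) <= b * (b * norm2 w).
    by apply: (le_trans S1); rewrite ler_wpM2l// l2norm_le ?mulr_ge0 ?norm2_ge0.
  have S3 : norm2 (lincomb F d n) <= b1 ^+ 2 * norm2 w.
    apply: (le_trans S2); rewrite mulrA -expr2 ler_wpM2r ?norm2_ge0// lerXn2r ?nnegrE//.
    exact: ltW.
  have S4 : norm2 (lincomb F d n) ^+ 2 <= b1 ^+ 4 * norm2 w ^+ 2.
    by rewrite (exprM b1 2 2) -exprMn lerXn2r ?nnegrE ?norm2_ge0// mulr_ge0 ?norm2_ge0 ?sqr_ge0.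
  have S5 : t ^+ 2 * norm2 (lincomb F d n) ^+ 2 <= t ^+ 2 * (b1 ^+ 4 * norm2 w ^+ 2).
    by rewrite ler_wpM2l// sqr_ge0.
  have S6 : t * (a * norm2 w ^+ 2) <= t * sqsum d n by rewrite ler_wpM2l.
  have -> : r2 * norm2 w ^+ 2 = norm2 w ^+ 2 - 2 * (t * (a * norm2 w ^+ 2)) +
      t ^+ 2 * (b1 ^+ 4 * norm2 w ^+ 2).
    by rewrite /r2 /t; field; rewrite gt_eqF.
  by rewrite exprMn; lra.
- have tb : 0 <= t * b * norm2 w by rewrite mulr_ge0 ?norm2_ge0// mulr_ge0.
  rewrite (l2norm_le _ _ tb) sqsum_trunc -sqr_l2norm l2normZ cabs_real ger0_norm//.
  rewrite -mulrA [leLHS]exprMn [leRHS]exprMn ler_wpM2l ?sqr_ge0//.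
  by rewrite sqr_l2norm.
Qed.

(** [contraction] is iterated on the successive residuals, which stay in [W]. Their norms decay like
    [r ^+ N], so the norms of the successive coefficients sum to at most [D / (1 - r)] times the
    norm of [w], whatever the accuracy [e]. *)
Lemma approx : exists2 C : R, 0 <= C & forall w (e : R), W w -> 0 < e ->
  exists n c, [/\ supp c n, norm2 (w - lincomb F c n) <= e & l2norm c n <= C * norm2 w].
Proof.
have [r [D [r0 r1 D0 H]]] := contraction.
exists (D / (1 - r)); first by rewrite divr_ge0// subr_ge0 ltW.
have P N : forall w, W w -> exists n c, [/\ supp c n,
    norm2 (w - lincomb F c n) <= r ^+ N * norm2 w & l2norm c n <= D / (1 - r) * norm2 w].
  elim: N => [|N IH] w Ww; have wL := WL Ww.
    exists 0%N, (fun=> 0); split => //.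
      rewrite (_ : lincomb _ _ _ = 0) ?subr0 ?expr0 ?mul1r//.
      by apply/funext => x; rewrite lincombE -[LHS]/(psum _ _) psum0 mul0r.
    rewrite /l2norm (_ : lincomb _ _ _ = 0); last first.
      by apply/funext => x; rewrite lincombE -[LHS]/(psum _ _) psum0 mul0r.
    by rewrite norm2_0 mulr_ge0 ?norm2_ge0// divr_ge0// subr_ge0 ltW.
  have [n [c [cn wc cD]]] := H w Ww.
  have [n' [c' [cn' wc' cD']]] := IH _ (Wsub Ww (Wlc c n)).
  exists (n + n')%N, (fun k => c k + c' k).
  have s1 := leq_addr n' n; have s2 := leq_addl n n'; split.
  - by move=> k kn; rewrite (supp_le s1 cn kn) (supp_le s2 cn' kn) addr0.
  - rewrite lincombD (lincomb_supp _ cn s1) (lincomb_supp _ cn' s2) opprD addrA (le_trans wc')//.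
    by rewrite exprSr -mulrA ler_wpM2l// exprn_ge0.
  - apply: (le_trans (l2normD _ _ _)); rewrite (l2norm_supp cn s1) (l2norm_supp cn' s2).
    apply: (@le_trans _ _ (D * norm2 w + D / (1 - r) * (r * norm2 w))).
      rewrite lerD// (le_trans cD')// ler_wpM2l// divr_ge0// subr_ge0 ltW//.
    rewrite le_eqVlt; apply/orP; left; apply/eqP; field.
    by rewrite subr_eq0 gt_eqF.
move=> w e Ww e0.
have : (fun N => r ^+ N * norm2 w) @ \oo --> (0 : R).
  rewrite -[0](mul0r (norm2 w)); apply: cvgM; last exact: cvg_cst.
  by apply: cvg_expr; rewrite ger0_norm.
move=> /cvg0P/(_ e e0)[N /(_ N (leqnn N)) HN].
have [n [c [cn wc cD]]] := P N w Ww; exists n, c; split => //.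
by apply: (le_trans wc); apply: le_trans HN; exact: ler_norm.
Qed.

End Synthesis.

(** A crude bound that may grow with [n]: it expresses the continuity of each truncated analysis
    operator before any bound uniform in [n] is known. *)
Lemma l2norm_analysis (G : int -> cfun) n f : (forall k, L2 (G k)) -> L2 f ->
  l2norm (analysis G f) n <= Num.sqrt (psum (fun k => norm2 (G k) ^+ 2) n) * norm2 f.
Proof.
move=> GL fL; rewrite l2norm_le ?mulr_ge0 ?norm2_ge0 ?sqrtr_ge0// exprMn sqr_sqrtr; last first.
  by apply: psum_ge0 => k; exact: sqr_ge0.
rewrite mulrC -psumZl; apply: le_psum => k; rewrite -exprMn.
by rewrite lerXn2r ?nnegrE ?mulr_ge0 ?norm2_ge0 ?cabs_ge0//; exact: inner_le.
Qed.

Section UniformBoundedness.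
Variable G : int -> cfun.
Hypothesis GL : forall k, L2 (G k).

Let p n f := l2norm (analysis G f) n.

Let pD n f g : L2 f -> L2 g -> p n (f + g) <= p n f + p n g.
Proof.
move=> fL gL; rewrite /p (_ : analysis G (f + g) = fun k => analysis G f k + analysis G g k).
  exact: l2normD.
by apply/funext => k; rewrite /analysis innerDl.
Qed.

Let pZ n z f : L2 f -> p n (scalef z f) = cabs z * p n f.
Proof.
move=> fL; rewrite /p (_ : analysis G (scalef z f) = fun k => z * analysis G f k) ?l2normZ//.
by apply/funext => k; rewrite /analysis innerZl.
Qed.

Let pB n f g : L2 f -> L2 g -> p n (f - g) <= p n f + p n g.
Proof.
move=> fL gL; apply: (le_trans (pD n fL (L2N gL))).
by rewrite scalefN1 pZ// cabsN cabs1 mul1r.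
Qed.

Let Cn n : R := Num.sqrt (psum (fun k => norm2 (G k) ^+ 2) n).

Let Cn0 n : 0 <= Cn n. Proof. exact: sqrtr_ge0. Qed.

Let p_le n f : L2 f -> p n f <= Cn n * norm2 f.
Proof. exact: l2norm_analysis. Qed.

(** Gliding hump: the step sizes [e j] decrease fast enough for the seminorm
    chosen at step [j] to survive all the later perturbations. *)
Lemma uniform_boundedness :
  (forall f, L2 f -> exists K, forall n, l2norm (analysis G f) n <= K) ->
  exists2 B : R, 0 <= B & forall f n, L2 f -> l2norm (analysis G f) n <= B * norm2 f.
Proof.
move=> pb; apply: contrapT => nB.
have H (B : R) : exists fn : cfun * nat, 0 <= B -> [/\ L2 fn.1, norm2 fn.1 <= 1 & B <= p fn.2 fn.1].
  (* The later use of [choice] requires a witness for every real [B]; negative targets get an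
     arbitrary one. *)
  have [B0|B0] := leP 0 B; last by exists (0, 0%N) => ?; lra.
  apply: contrapT => nH; apply: nB; exists B => // f n fL.
  have [f0|fN0] := eqVneq (norm2 f) 0.
    by have := p_le n fL; rewrite f0 !mulr0.
  have f1 : 0 < norm2 f by rewrite lt0r fN0 norm2_ge0.
  rewrite leNgt; apply/negP => h; apply: nH.
  have i0 : 0 <= (norm2 f)^-1 by rewrite invr_ge0 ltW.
  exists (scalef (norm2 f)^-1%:C f, n) => _ /=; split.
  - exact: L2Z.
  - by rewrite norm2Z// cabs_real ger0_norm// mulVf.
  - by rewrite pZ// cabs_real ger0_norm// mulrC ler_pdivlMr// ltW.
have {H}[fn Hfn] := choice H.
pose fx B := (fn B).1; pose nx B := (fn B).2.
have fxL B : 0 <= B -> L2 (fx B) by move=> /Hfn[].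
pose step (j : nat) (s : cfun * R) : cfun * R :=
  (* With this target the scaled vector [y] has seminorm at least [j + 2]; the later perturbations
     will cost at most 1 of it. *)
  let B := (j%:R + 2) / s.2 in
  let y := scalef s.2%:C (fx B) in
  (* Since [2 y = (x + y) - (x - y)], at least one sign gives a seminorm no smaller than that of
     [y]; the better sign is kept. *)
  (if p (nx B) (s.1 - y) <= p (nx B) (s.1 + y) then s.1 + y else s.1 - y,
   (* All later steps together move the point by at most twice the new size [e'], and
      [2 e' (1 + Cn) = e <= 1] bounds the effect on the current seminorm by 1. *)
   s.2 / (2 * (1 + Cn (nx B)))).
pose st := fix st (j : nat) := if j is j'.+1 then step j' (st j') else (0 : cfun, 1 : R).
pose x j := (st j).1; pose e j := (st j).2.
pose B j := (j%:R + 2) / e j; pose y j := scalef (e j)%:C (fx (B j)).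
have eS j : e j.+1 = e j / (2 * (1 + Cn (nx (B j)))) by [].
have xS j : x j.+1 = if p (nx (B j)) (x j - y j) <= p (nx (B j)) (x j + y j)
  then x j + y j else x j - y j by [].
have e0 j : 0 < e j.
  elim: j => [|j IH]; first exact: ltr01.
  by rewrite eS divr_gt0// mulr_gt0// ltr_wpDr.
have B0 j : 0 <= B j by apply: divr_ge0; [rewrite addr_ge0|exact: ltW].
have yL j : L2 (y j) by apply: L2Z; exact: fxL.
have y1 j : norm2 (y j) <= e j.
  have [? h _] := Hfn _ (B0 j).
  by rewrite norm2Z ?cabs_real ?ger0_norm ?(ltW (e0 j))// -[leRHS]mulr1 ler_pM2l.
have xL j : L2 (x j).
  elim: j => [|j IH]; first exact: L20.
  by rewrite xS; case: ifP => _; [exact: L2D|exact: L2B].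
have ehalf j : 2 * e j.+1 * (1 + Cn (nx (B j))) = e j.
  by rewrite eS; field; rewrite gt_eqF// ltr_wpDr.
have e2 j : 2 * e j.+1 <= e j.
  by have := ehalf j; have := Cn0 (nx (B j)); have := e0 j.+1; nra.
have e2n j : e j <= 2 ^- j.
  elim: j => [|j IH]; first by rewrite expr0 invr1.
  have := e2 j; rewrite exprS invfM => h.
  by rewrite mulrC ler_pdivlMr// mulrC (le_trans h).
have dx j : norm2 (x j.+1 - x j) <= e j.
  rewrite xS; case: ifP => _; rewrite addrAC subrr add0r//.
  by rewrite norm2N.
(* Telescoping: halving gives [e i <= 2 * e i - 2 * e i.+1]. *)
have dxm j m : norm2 (x (j + m)%N - x j) <= 2 * e j - 2 * e (j + m)%N.
  elim: m => [|m IH]; first by rewrite addn0 !subrr norm2_0.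
  rewrite addnS; apply: (le_trans (norm2_tri (xL _) (xL (j + m)%N) (xL j))).
  by have := dx (j + m)%N; have := e2 (j + m)%N; lra.
have xc : l2cauchy x.
  move=> d d0.
  have : (fun N => 4 * (2^-1) ^+ N) @ \oo --> (0 : R).
    rewrite -[0](mulr0 4); apply: cvgM; first exact: cvg_cst.
    by apply: cvg_expr; rewrite ger0_norm ?invr_ge0// invf_lt1// ltr1n.
  move=> /cvg0P/(_ d d0)[N /(_ N (leqnn N)) HN].
  have {}HN : 4 * e N <= d.
    apply: le_trans HN; rewrite ger0_norm ?mulr_ge0 ?exprn_ge0 ?invr_ge0//.
    by rewrite ler_wpM2l// exprVn.
  exists N => n m /subnKC <- /subnKC <-.
  apply: (le_trans (norm2_tri (xL _) (xL N) (xL _))).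
  rewrite (norm2BC (xL N))//.
  have := dxm N (n - N)%N; have := dxm N (m - N)%N.
  by have := e0 (N + (n - N))%N; have := e0 (N + (m - N))%N; lra.
have [z xz] := l2_complete xL xc.
have [_ zL _] := xz.
have zx j : norm2 (z - x j) <= 2 * e j.
  apply: (@real_cvg_le _ (fun m => norm2 (x (j + m)%N - x j))).
    have := cvg2_norm (cvg2B xz (cvg2_cst (xL j))) => h.
    apply: (cvg_comp (fun m => (j + m)%N) _ _ h).
    exact: cvg_addnl.
  by move=> m; have := dxm j m; have := e0 (j + m)%N; lra.
have px j : j%:R + 2 <= p (nx (B j)) (x j.+1).
  have [fL _ h] := Hfn _ (B0 j); set n := nx _.
  have h1 : j%:R + 2 <= p n (y j).
    rewrite pZ// cabs_real ger0_norm ?(ltW (e0 j))// mulrC -ler_pdivrMr//.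
  have h2 : 2 * p n (y j) <= p n (x j + y j) + p n (x j - y j).
    have -> : 2 * p n (y j) = p n (scalef 2%:C (y j)).
      by rewrite pZ// cabs_real ger0_norm.
    rewrite (_ : scalef 2%:C (y j) = (x j + y j) - (x j - y j)).
      by apply: pB; [exact: L2D|exact: L2B].
    apply/funext => t; rewrite /scalef -[RHS]/(x j t + y j t - (x j t - y j t)).
    by rewrite rmorphD rmorph1; ring.
  by rewrite xS -/n; case: (leP (p n (x j - y j)) (p n (x j + y j))) => ?; lra.
have shiftsum j : j%:R + 1 <= p (nx (B j)) z.
  have h : p (nx (B j)) (x j.+1) <= p (nx (B j)) z + p (nx (B j)) (z - x j.+1).
    have {1}-> : x j.+1 = z - (z - x j.+1) by rewrite subKr.
    by apply: pB => //; exact: L2B.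
  have h2 : p (nx (B j)) (z - x j.+1) <= Cn (nx (B j)) * (2 * e j.+1).
    apply: (le_trans (p_le _ (L2B zL (xL _)))); rewrite ler_wpM2l//.
  have e1 : e j <= 1.
    by apply: (le_trans (e2n j)); rewrite invf_le1 ?exprn_gt0// exprn_ege1// ler1n.
  by have := px j; have := ehalf j; have := e0 j.+1; lra.
have [K HK] := pb z zL.
have := shiftsum (Num.trunc K).+1; have := HK (nx (B (Num.trunc K).+1)).
by have := truncnS_gt K; rewrite /p; lra.
Qed.

End UniformBoundedness.
End Frames.

(** * Unordered sums of nonnegative families and their symmetric partial sums *)

Section EsumPsum.
Variable R : realType.
Implicit Types (a : int -> R) (k z : int).

(** Rewriting the symmetric sum as a sum over all the integers avoids any
    reindexing of finite sets. *)
Lemma psum_esum a n : (forall k, 0 <= a k) ->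
  (psum a n)%:E = (\esum_(z in [set: int]) (if (`|z| <= n)%N then a z else 0)%:E)%E.
Proof.
move=> a0; pose d z (i : 'I_n.*2.+1) : \bar R := (if i%:Z - n%:Z == z then a z else 0)%:E.
have d0 z i : (0 <= d z i)%E by rewrite /d; case: eqP; rewrite lee_fin.
transitivity (\esum_(z in [set: int]) \sum_(i < n.*2.+1) d z i)%E; last first.
  apply: eq_esum => z _; rewrite /d sumEFin; congr EFin.
  rewrite -(psum_delta z (a z) n); apply: eq_bigr => i _; by case: eqP.
rewrite esum_sum// /psum -sumEFin; apply: eq_bigr => i _.
rewrite -[LHS](@esum_set1 _ _ _ (fun k => (a k)%:E)) ?lee_fin//.
rewrite esum_mkcond; apply: eq_esum => z _; rewrite /d.
case: ifPn => [/set_mem ->|]; first by rewrite eqxx.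
case: eqP => [<-|//]; by rewrite mem_set.
Qed.

Lemma psum_le_esum a n : (forall k, 0 <= a k) ->
  ((psum a n)%:E <= \esum_(z in [set: int]) (a z)%:E)%E.
Proof.
move=> a0; rewrite psum_esum//; apply: le_esum => z _.
by case: ifP; rewrite lee_fin.
Qed.

(** Every finite set of integers lies in some [[- n, n]], so its sum is below a symmetric one. *)
Lemma esum_le a (M : \bar R) : (forall k, 0 <= a k) -> (forall n, (psum a n)%:E <= M)%E ->
  (\esum_(z in [set: int]) (a z)%:E <= M)%E.
Proof.
move=> a0 aM; apply: ge_ereal_sup => _ [X [fX _] <-].
have /finite_seqP[s Xs] := fX.
pose n := (\max_(z <- s) `|z|)%N.
have Xn z : X z -> (`|z| <= n)%N.
  by rewrite Xs => zs; exact: (@leq_bigmax_seq _ s xpredT (fun z : int => `|z|%N) z zs isT).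
apply: le_trans (aM n); rewrite -esum_fset//; last by move=> i _; rewrite lee_fin.
rewrite psum_esum// esum_mkcond; apply: le_esum => z _.
case: ifPn => [/set_mem/Xn ->//|_].
by case: ifP; rewrite lee_fin.
Qed.

Lemma esum_ge_psum a (M M' : R) : (forall k, 0 <= a k) ->
  (M%:E <= \esum_(z in [set: int]) (a z)%:E)%E -> M' < M -> exists n, M' <= psum a n.
Proof.
move=> a0 aM MM; apply: contrapT => nH.
have : (\esum_(z in [set: int]) (a z)%:E <= M'%:E)%E.
  apply: esum_le => // n; rewrite lee_fin leNgt; apply/negP => h; apply: nH.
  by exists n; exact: ltW.
by move=> /(le_trans aM); rewrite lee_fin leNgt MM.
Qed.

Lemma esum_eq0 a k : (forall k, 0 <= a k) ->
  (\esum_(z in [set: int]) (a z)%:E = 0)%E -> a k = 0.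
Proof.
move=> a0 s0; apply/eqP; rewrite eq_le a0 andbT.
have := psum_le_esum `|k|%N a0; rewrite s0 lee_fin; apply: le_trans.
rewrite -[leLHS](_ : psum (fun z => if z == k then a k else 0) `|k| = _).
  by apply: le_psum => z; case: eqP => [->|].
by rewrite psum_delta leqnn.
Qed.

End EsumPsum.

(** * Closed subspaces generated by a frame *)

Section Subspaces.
Variable R : realType.
Local Notation mu := (@lebesgue_measure R).
Local Notation cfun := (R -> R[i]).
Local Notation L2 := (@Lp R 2%:E).
Implicit Types (f g h u v w : cfun) (k : int) (c : int -> R[i]) (W V : set cfun).

Lemma closed_scalef_add W a f g : closed_subspace W -> W f -> W g -> W (scalef a f + g).
Proof. by move=> [_ _ Wlin _] Wf Wg; exact: Wlin. Qed.

Lemma closed_scalef W a f : closed_subspace W -> W f -> W (scalef a f).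
Proof.
move=> Wc Wf; have [_ W0 _ _] := Wc.
by rewrite -[scalef a f]addr0; exact: closed_scalef_add.
Qed.

Lemma closed_sub W f g : closed_subspace W -> W f -> W g -> W (f - g).
Proof. by move=> Wc Wf Wg; rewrite addrC scalefN1; exact: closed_scalef_add. Qed.

Lemma closed_lincomb W (F : int -> cfun) c n : closed_subspace W -> (forall k, W (F k)) ->
  W (lincomb F c n).
Proof.
move=> Wc WF; have [_ W0 _ _] := Wc; rewrite /lincomb /psum.
by elim/big_ind: _ => //= [f g Wf Wg|i _];
  [rewrite -[f](_ : scalef 1 f = _); [exact: closed_scalef_add|apply/funext => x; exact: mul1r]
  |exact: closed_scalef].
Qed.

Lemma frame_bounds W (F : int -> cfun) : closed_subspace W -> is_frame W F ->
  exists a b : R, [/\ 0 < a, 0 <= b,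
    forall f n, W f -> l2norm (analysis F f) n <= b * norm2 f &
    forall f, W f -> exists n, a * norm2 f ^+ 2 <= sqsum (analysis F f) n].
Proof.
move=> [WL _ _ _] [WF [al [be [al0 albe H]]]].
have be0 : 0 <= be by rewrite (le_trans _ albe)// ltW.
have a0 f k : 0 <= cabs (analysis F f k) ^+ 2 by exact: sqr_ge0.
(* Halving the lower frame bound leaves room for a finite partial sum to reach it; the square root
   turns the upper bound on squares into one on norms. *)
exists (al / 2), (Num.sqrt be); split.
- by rewrite divr_gt0.
- exact: sqrtr_ge0.
- move=> f n Wf; have /andP[_ h] := H f Wf.
  rewrite l2norm_le ?mulr_ge0 ?sqrtr_ge0 ?norm2_ge0// exprMn sqr_sqrtr//.
  by rewrite -lee_fin; apply: le_trans h; exact: psum_le_esum.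
- move=> f Wf; have /andP[h _] := H f Wf.
  have [f0|fN0] := eqVneq (norm2 f) 0.
    by exists 0%N; rewrite f0 expr0n mulr0 sqsum_ge0.
  apply: (esum_ge_psum (a0 f) h); rewrite ltr_pM2r; first lra.
  by rewrite exprn_gt0// lt0r fN0 norm2_ge0.
Qed.

Lemma frame_approx W (F : int -> cfun) : closed_subspace W -> is_frame W F ->
  exists2 C : R, 0 <= C & forall w (e : R), W w -> 0 < e ->
    exists n c, [/\ supp c n, norm2 (w - lincomb F c n) <= e & l2norm c n <= C * norm2 w].
Proof.
move=> Wc Wf; have [a [b [a0 b0 up lo]]] := frame_bounds Wc Wf.
have [WL _ _ _] := Wc; have [WF _] := Wf.
apply: (@approx _ W F b _ _ b0 _ up a a0 lo) => //.
- by move=> k; exact: WL.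
- by move=> c n; exact: closed_lincomb.
- by move=> f g; exact: closed_sub.
Qed.

Lemma translate_lincomb k (F : int -> cfun) c n :
  translate k (lincomb F c n) = lincomb (fun j => translate k (F j)) c n.
Proof. by apply/funext => x; rewrite /translate !lincombE. Qed.

Lemma translateD k j f : translate k (translate j f) = translate (k + j) f.
Proof. by apply/funext => x; rewrite /translate -addrA -opprD rmorphD. Qed.

(** Translation permutes the frame vectors, hence preserves their finite combinations; these are
    dense in [W] by [frame_approx], and [W] is closed. It is applied to [V], to place the translates
    of [phit] there. *)
Lemma translate_closed W f k w : closed_subspace W ->
  is_frame W (fun k => translate k f) -> W w -> W (translate k w).
Proof.
move=> Wc Wf Ww; have [C C0 H] := frame_approx Wc Wf.
have [WL _ _ Wcl] := Wc; have [WF _] := Wf.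
have /choice[u Hu] : forall j : nat, exists v, [/\ W (translate k v), L2 v & norm2 (v - w) <= 2 ^- j].
  move=> j; have j0 : (0 : R) < 2 ^- j by rewrite invr_gt0 exprn_gt0.
  have [n [c [_ h _]]] := H w _ Ww j0.
  have L2l : L2 (lincomb (fun k => translate k f) c n) by apply: WL; exact: closed_lincomb.
  exists (lincomb (fun k => translate k f) c n); split => //; last by rewrite norm2BC//; exact: WL.
  rewrite translate_lincomb; apply: closed_lincomb => // j'; rewrite translateD; exact: WF.
apply: (Wcl (fun j => translate k (u j))); first by move=> j; case: (Hu j).
apply: cvg2_translate; apply/cvg2P; split.
- by move=> j; case: (Hu j).
- exact: WL.
- move=> e e0; have : (fun N => (2^-1 : R) ^+ N) @ \oo --> (0 : R).
    by apply: cvg_expr; rewrite ger0_norm ?invr_ge0// invf_lt1// ltr1n.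
  move=> /cvg0P/(_ e e0)[N HN]; exists N => n /HN; apply: le_trans.
  by have [_ _ h] := Hu n; rewrite exprVn (le_trans h)// ler_norm.
Qed.

End Subspaces.

(** * The main estimate *)

Section Estimate.
Variable R : realType.
Local Notation mu := (@lebesgue_measure R).
Local Notation cfun := (R -> R[i]).
Local Notation L2 := (@Lp R 2%:E).
Local Notation ebasis := (@ebasis R).
Implicit Types (f g h u v w : cfun) (k : int) (c : int -> R[i]).

Lemma L2_ae_le f g (K : R) : 0 <= K -> cmeasurable f -> L2 g ->
  ae (fun x => cabs (f x) <= K * cabs (g x)) -> L2 f /\ norm2 f <= K * norm2 g.
Proof.
move=> K0 mf gL fg.
have KgL : L2 (scalef K%:C g) by exact: L2Z.
have H : (sqnorm2 f <= sqnorm2 (scalef K%:C g))%E.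
  apply: ae_ge0_le_integral => //.
  - by move=> x _; rewrite lee_fin sqr_ge0.
  - exact: measurable_sqcabs.
  - by move=> x _; rewrite lee_fin sqr_ge0.
  - exact: measurable_sqcabs (L2_cmeasurable KgL).
  - apply: aeS fg => x h _; rewrite lee_fin lerXn2r ?nnegrE ?cabs_ge0//.
    by rewrite /scalef cabsM cabs_real ger0_norm.
have fL : L2 f by apply/L2P; split => //; apply: le_lt_trans H _; case/L2P: KgL.
split => //; rewrite -[leRHS](_ : norm2 (scalef K%:C g) = _).
  by rewrite !norm2E ler_wsqrtr// fine_le// L2_fin.
by rewrite norm2Z// cabs_real ger0_norm.
Qed.

Definition trigpoly c n : cfun := fun t => psum (fun k => c k * echar k t) n.

Lemma trigpoly_bounded c n : exists K : R, forall t, cabs (trigpoly c n t) <= K.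
Proof.
exists (psum (fun k => cabs (c k)) n) => t; apply: (le_trans (cabs_psum _ _)).
by apply: le_psum => k; rewrite /= cabsM cabs_echar mulr1.
Qed.

Lemma cmeasurable_trigpoly c n : cmeasurable (trigpoly c n).
Proof.
rewrite (_ : trigpoly c n = lincomb (@echar R) c n); last by apply/funext => t; rewrite lincombE.
by apply: cmeasurable_sum => i; apply: cmeasurableZ; exact: cmeasurable_echar.
Qed.

Lemma trigpoly_per c n t k : trigpoly c n (t + k%:~R) = trigpoly c n t.
Proof. by apply: eq_psum => j; rewrite echar_per. Qed.

Lemma restr01_trigpoly c n : restr01 (trigpoly c n) = lincomb ebasis c n.
Proof.
apply/funext => t; rewrite lincombE /restr01 /trigpoly -psumZc; apply: eq_psum => k.
by rewrite mulrCA.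
Qed.

Lemma is_fourier_lincomb f p c n : is_fourier f p ->
  is_fourier (lincomb (fun k => translate k f) c n) (fun t => trigpoly c n t * p t).
Proof.
move=> fp; rewrite (_ : (fun t => _) = lincomb (fun k t => echar k t * p t) c n).
  by apply: is_fourier_sum => i; apply: is_fourier_Z; exact: is_fourier_translate.
apply/funext => t; rewrite lincombE /trigpoly mulrC -psumZc; apply: eq_psum => k; ring.
Qed.

Section Pair.
Variables (phi psi p q : cfun).
Hypothesis phip : is_fourier phi p.
Hypothesis psiq : is_fourier psi q.
Let F k := translate k phi.
Let G k := translate k psi.
Let phiL : L2 phi. Proof. by case: (is_fourier_L2 phip). Qed.
Let psiL : L2 psi. Proof. by case: (is_fourier_L2 psiq). Qed.
Let pL : L2 p. Proof. by case: (is_fourier_L2 phip). Qed.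
Let qL : L2 q. Proof. by case: (is_fourier_L2 psiq). Qed.
Let FL k : L2 (F k). Proof. exact: L2_translate. Qed.
Let GL k : L2 (G k). Proof. exact: L2_translate. Qed.
Let ebasisL : forall k, L2 (ebasis k) := @L2_ebasis R.

Variables (P : cfun) (Gd : R -> R).
Hypothesis mP : cmeasurable P.
Hypothesis iGd : mu.-integrable setT (EFin \o Gd).
Let pq : cfun := fun t => p t * (q t)^*.
Hypothesis cP : ae (fun t => ccvg (fun n => restr01 (shiftsum pq n) t) (P t)).
Hypothesis bP : ae (fun t => forall n, cabs (restr01 (shiftsum pq n) t) <= Gd t).
Variable eta : R.
Hypothesis eta0 : 0 <= eta.
Hypothesis Peta : ae (fun t => 0 <= t < 1 ->
  (forall k : int, p (t + k%:~R) = 0) \/ cabs (P t - 1) <= eta).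

Let pqi : cintegrable pq. Proof. exact: cintegrable_inner. Qed.

Let P_out : ae (fun t => ind01 t * P t = P t).
Proof.
apply: aeS cP => t H; have [t01|t01] := boolP (0 <= t < 1).
  by rewrite /ind01 t01 mul1r.
rewrite {1}/ind01 (negbTE t01) mul0r; apply: (ccvg_uniq _ H).
by apply: (eq_ccvg _ (ccvg_cst 0)) => n; rewrite /restr01 /ind01 (negbTE t01) mul0r.
Qed.

Let P_zero t : 0 <= t < 1 -> ccvg (fun n => restr01 (shiftsum pq n) t) (P t) ->
  (forall k : int, p (t + k%:~R) = 0) -> P t = 0.
Proof.
move=> t01 H p0; apply: (ccvg_uniq H); apply: (eq_ccvg _ (ccvg_cst 0)) => n.
rewrite /restr01 /shiftsum /pq (@eq_psum _ _ (fun=> 0)); last by move=> k; rewrite p0 mul0r.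
by rewrite /psum big1// mulr0.
Qed.

Section Finite.
Variables (c : int -> R[i]) (n0 : nat).
Let w := lincomb F c n0.
Let m := trigpoly c n0.
Let Q : cfun := restr01 (fun t => m t * P t).

Let wm : is_fourier w (fun t => m t * p t). Proof. exact: is_fourier_lincomb. Qed.

Let mQ : cmeasurable Q.
Proof. by apply: cmeasurableM; [exact: cmeasurable_ind01|apply: cmeasurableM => //; exact: cmeasurable_trigpoly]. Qed.

(** Either alternative of [Peta] gives [|P| <= 1 + eta], the first through [P_zero]. Over one period
    [m] is the trigonometric polynomial whose norm is [l2norm c n0]. *)
Let Q_spec : L2 Q /\ norm2 Q <= (1 + eta) * l2norm c n0.
Proof.
apply: L2_ae_le => //; first by rewrite addr_ge0.
  exact: L2_lincomb.
apply: (aeS2 _ cP Peta) => t cPt Pt.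
have [t01|t01] := boolP (0 <= t < 1); last first.
  by rewrite /Q /restr01 /ind01 (negbTE t01) mul0r cabs0 mulr_ge0 ?cabs_ge0// addr_ge0.
rewrite -restr01_trigpoly /Q /restr01 -/m mulrA cabsM mulrC ler_wpM2r ?cabs_ge0//.
have [p0|h] := Pt t01; first by rewrite (P_zero t01 cPt p0) cabs0 addr_ge0.
rewrite -(subrK 1 (P t)) (le_trans (cabsD _ _))// cabs1 addrC lerD2l//.
Qed.

Let QL : L2 Q. Proof. by case: Q_spec. Qed.
Let Q01 : restr01 Q = Q. Proof. exact: restr01_idem. Qed.

(** The transform preserves inner products, and the multiplier [m * conj (echar k)] is bounded and
    periodic, so the integral against [p * conj q] over the line folds onto [[0, 1[]. *)
Let coef k : analysis G w k = inner Q (ebasis k).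
Proof.
have [K mK] := trigpoly_bounded c n0.
rewrite /analysis -(is_fourier_inner wm (is_fourier_translate k psiq)).
have -> : inner (fun t => m t * p t) (fun t => echar k t * q t) =
    cintegral (fun t => (m t * (echar k t)^*) * pq t).
  by congr cintegral; apply/funext => t; rewrite /pq rmorphM /= mulrACA.
rewrite (@cintegral_periodize _ pq P Gd _ K)//.
- apply: ae_eq_cintegral.
  + by apply: cmeasurableM => //; apply: cmeasurableM; [exact: cmeasurable_trigpoly|apply: cmeasurableJ; exact: cmeasurable_echar].
  + by apply: cmeasurableM => //; apply: cmeasurableJ; exact: L2_cmeasurable.
  + apply/ae_eqP; apply: aeS P_out => t Pt.
    rewrite /Q /ebasis /restr01 rmorphM /= ind01J -{1}Pt; have := ind01_idem t.
    by move: (ind01 t) => i ii; rewrite -[in LHS]ii; ring.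
- by apply: cmeasurableM; [exact: cmeasurable_trigpoly|apply: cmeasurableJ; exact: cmeasurable_echar].
- by move=> t; rewrite cabsM cabsJ cabs_echar mulr1.
- by move=> t j; rewrite /m trigpoly_per echar_per.
Qed.

Lemma bessel_finite n : l2norm (analysis G w) n <= (1 + eta) * l2norm c n0.
Proof.
have [_ h] := Q_spec; apply: le_trans h; rewrite l2norm_le ?norm2_ge0//.
by rewrite (_ : analysis G w = fun k => inner Q (ebasis k)); [exact: bessel|apply/funext].
Qed.

Variables (b : R).
Hypothesis b0 : 0 <= b.
Hypothesis Fb : forall c n, norm2 (lincomb F c n) <= b * l2norm c n.

Let c' := analysis G w.
Let U j : cfun := fun t => (m t - trigpoly c' j t) * p t.

Let wU j : is_fourier (w - lincomb F c' j) (U j).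
Proof.
rewrite (_ : U j = (fun t => m t * p t) - (fun t => trigpoly c' j t * p t)).
  rewrite !scalefN1; apply: is_fourier_D => //; apply: is_fourier_Z; exact: is_fourier_lincomb.
by apply/funext => t; rewrite /U mulrBl.
Qed.

Let UL j : L2 (U j). Proof. by case: (is_fourier_L2 (wU j)). Qed.

(** By isometry it suffices that the combinations with coefficients [c'] be Cauchy: [bessel_finite]
    makes [c'] square-summable and [Fb] bounds synthesis. *)
Let U_cauchy : l2cauchy U.
Proof.
have : l2cauchy (lincomb F c').
  apply: (@lincomb_cauchy _ _ _ (b ^+ 2) (((1 + eta) * l2norm c n0) ^+ 2)) => //.
  - exact: sqr_ge0.
  - move=> d n; rewrite -sqr_l2norm -exprMn lerXn2r ?nnegrE ?norm2_ge0 ?mulr_ge0 ?l2norm_ge0//.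
  - move=> n; rewrite -l2norm_le; first exact: bessel_finite.
    by rewrite mulr_ge0 ?l2norm_ge0// addr_ge0.
move=> H e /H[N HN]; exists N => i j Ni Nj; apply: le_trans (HN i j Ni Nj).
have ft : is_fourier (lincomb F c' j - lincomb F c' i) (U i - U j).
  have -> : U i - U j = (fun t => trigpoly c' j t * p t) - (fun t => trigpoly c' i t * p t).
    apply/funext => t; rewrite -[LHS]/(U i t - U j t).
    by rewrite -[RHS]/(trigpoly c' j t * p t - trigpoly c' i t * p t) /U; ring.
  by rewrite !scalefN1; apply: is_fourier_D; [exact: is_fourier_lincomb|apply: is_fourier_Z; exact: is_fourier_lincomb].
by rewrite (is_fourier_norm ft) norm2BC//; exact: L2_lincomb.
Qed.

(** The Fourier series of [Q] converges in L2 of a period, which does not pass through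
    multiplication by [p] alone. A subsequence converges almost everywhere, on the whole line by
    periodicity, so [U] tends there to [m (1 - P) p], of modulus at most [eta |m p|]; as [U] is
    Cauchy, this pointwise limit is also its L2 limit. *)
Lemma residual_finite (e : R) : 0 < e -> exists N, forall j, (N <= j)%N ->
  norm2 (w - lincomb F c' j) <= eta * norm2 w + e.
Proof.
have c'E : c' = (fun k => inner Q (ebasis k)) by apply/funext.
have /cvg2_ae[s [sn sQ]] := fourier_series QL Q01; rewrite -c'E in sQ.
pose h := aelim (fun j => U (s j)).
have key : ae (fun t => exists l, ccvg (fun j => U (s j) t) l /\ cabs l <= eta * cabs (m t * p t)).
  apply: aeS (ae_shifts (aeS2 (S := fun t => 0 <= t < 1 ->
      ccvg (fun j => trigpoly c' (s j) t) (m t * P t) /\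
      ((forall k : int, p (t + k%:~R) = 0) \/ cabs (P t - 1) <= eta)) _ sQ Peta)).
    move=> t H; have [k t01] : exists k : int, 0 <= t + k%:~R < 1.
      exists (- Num.floor t); have := Num.Theory.floor_itv t; rewrite mulrNz => /andP[? ?].
      by apply/andP; split; lra.
    have [ct Pt] := H k t01; exists (m t * (1 - P (t + k%:~R)) * p t); split.
      rewrite /U mulrC; under eq_fun do rewrite mulrC.
      apply: ccvgZ; rewrite mulrBr mulr1; apply: (@ccvgB _ (cst (m t))); first exact: ccvg_cst.
      by move: ct; rewrite /m trigpoly_per; apply: eq_ccvg => j; rewrite trigpoly_per.
    (* The first alternative holds at the representative [t + k] in [[0, 1[]; read at the shift
       [- k] it says that [p t = 0]. *)
    case: Pt => [/(_ (- k))|Pt].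
      by rewrite rmorphN addrK => ->; rewrite !mulr0 cabs0 mulr0.
    rewrite (_ : m t * _ * p t = (1 - P (t + k%:~R)) * (m t * p t)); last by ring.
    by rewrite [leLHS]cabsM ler_wpM2r ?cabs_ge0// cabsBC.
  move=> t st Pt t01; split; last exact: Pt.
  have I1 : ind01 t = 1 by rewrite /ind01 t01.
  move: st; rewrite /Q /restr01 I1 mul1r; apply: eq_ccvg => j.
  by rewrite -restr01_trigpoly /restr01 I1 mul1r.
have mh : cmeasurable h by apply: cmeasurable_aelim => j; exact: L2_cmeasurable.
have Uh : cvg2 U h.
  apply: (@cauchy_cvg2 _ _ _ s) => //.
  by apply: aeS key => t [l [cl _]]; rewrite /h (aelimE cl).
have mpL : L2 (fun t => m t * p t) by case: (is_fourier_L2 wm).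
have [_ hle] : L2 h /\ norm2 h <= eta * norm2 (fun t => m t * p t).
  apply: L2_ae_le => //; apply: aeS key => t [l [cl ll]].
  by rewrite /h (aelimE cl).
rewrite (is_fourier_norm wm) in hle.
move=> e0; have /cvg2P[_ hL /(_ e e0)[N HN]] := Uh.
exists N => j /HN Nj; rewrite -(is_fourier_norm (wU j)).
rewrite -[U j](subrK h) (le_trans (norm2D _ _))//; first exact: L2B.
by rewrite addrC lerD.
Qed.

End Finite.
End Pair.
End Estimate.

(** * From finite combinations to the whole subspace *)

Section Assembly.
Variable R : realType.
Local Notation mu := (@lebesgue_measure R).
Local Notation cfun := (R -> R[i]).
Local Notation L2 := (@Lp R 2%:E).
Implicit Types (f g h u v w : cfun) (k : int) (c : int -> R[i]).

Lemma synthesis_cvg (F : int -> cfun) c f : cvg2 (lincomb F c) f -> cvg2 (lincomb F c) (synthesis F c).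
Proof.
move=> cf; have E : (fun n x => psumZ (fun k => c k * F k x) n) = lincomb F c.
  by apply/funext => n; apply/funext => x; rewrite lincombE.
rewrite /synthesis E.
exact: (@xgetPex _ (cst 0) [set g | cvg2 (lincomb F c) g] (ex_intro _ f cf)).
Qed.

Lemma analysisB (G : int -> cfun) f g : (forall k, L2 (G k)) -> L2 f -> L2 g ->
  analysis G (f - g) = fun k => analysis G f k - analysis G g k.
Proof. by move=> GL fL gL; apply/funext => k; rewrite /analysis innerBl. Qed.

Lemma l2normB c c' n : l2norm c n <= l2norm (fun k => c k - c' k) n + l2norm c' n.
Proof. by rewrite -{1}(_ : (fun k => c k - c' k + c' k) = c) ?l2normD//; apply/funext => k; rewrite subrK. Qed.

Section FrameDual.
Variables (W V : set cfun) (phi psi : cfun).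
Let F k := translate k phi.
Let G k := translate k psi.
Hypothesis Wc : closed_subspace W.
Hypothesis Wf : is_frame W F.
Hypothesis psiL : L2 psi.
Variable eta : R.
Hypothesis eta0 : 0 <= eta.
Hypothesis bessel_fin : forall c n0 n, l2norm (analysis G (lincomb F c n0)) n <= (1 + eta) * l2norm c n0.
Hypothesis residual_fin : forall (b : R), 0 <= b ->
  (forall c n, norm2 (lincomb F c n) <= b * l2norm c n) ->
  forall c n0 (e : R), 0 < e -> exists N, forall j, (N <= j)%N ->
  norm2 (lincomb F c n0 - lincomb F (analysis G (lincomb F c n0)) j) <= eta * norm2 (lincomb F c n0) + e.

Let GL k : L2 (G k). Proof. exact: L2_translate. Qed.
Let WL f : W f -> L2 f. Proof. by case: Wc => WL _ _ _; exact: WL. Qed.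
Let WF k : W (F k). Proof. by case: Wf. Qed.
Let FL k : L2 (F k). Proof. exact: WL. Qed.
Let Wlc c n : W (lincomb F c n). Proof. exact: closed_lincomb. Qed.

(** For fixed [n], [w] is approximated so closely that the crude constant [K] of [l2norm_analysis]
    contributes at most [e]. The main term involves only [(1 + eta) * C], since the approximant has
    coefficients of norm at most [C * norm2 w]. *)
Lemma bessel_W : exists2 B : R, 0 <= B & forall w n, W w -> l2norm (analysis G w) n <= B * norm2 w.
Proof.
have [C C0 H] := frame_approx Wc Wf.
exists ((1 + eta) * C); first by rewrite mulr_ge0// addr_ge0.
move=> w n Ww; have wL := WL Ww.
set K := Num.sqrt (psum (fun k => norm2 (G k) ^+ 2) n).
have K0 : 0 <= K by exact: sqrtr_ge0.
apply/ler_addgt0Pr => e e0.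
have e1 : 0 < e / (K + 1) by rewrite divr_gt0// ltr_wpDl.
have [n0 [c [_ h1 h2]]] := H w _ Ww e1.
have lL : L2 (lincomb F c n0) by exact: L2_lincomb.
apply: (le_trans (l2normB _ (analysis G (lincomb F c n0)) n)); rewrite -analysisB//.
rewrite addrC lerD//.
  apply: (le_trans (bessel_fin c n0 n)); rewrite -mulrA ler_wpM2l// addr_ge0//.
apply: (le_trans (l2norm_analysis n GL (L2B wL lL))); rewrite -/K.
apply: (@le_trans _ _ (K * (e / (K + 1)))); first by rewrite ler_wpM2l.
rewrite mulrCA ler_piMr ?(ltW e0)// ler_pdivrMr ?ltr_wpDl//; lra.
Qed.

Hypothesis direct : forall f, L2 f -> exists2 w, W w & analysis G f = analysis G w.

Lemma bessel_L2 : exists2 B : R, 0 <= B & forall f n, L2 f -> l2norm (analysis G f) n <= B * norm2 f.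
Proof.
have [B B0 HB] := bessel_W.
apply: uniform_boundedness => // f fL; have [w Ww ->] := direct fL.
by exists (B * norm2 w) => n; exact: HB.
Qed.

Lemma synth_frame : exists2 b : R, 0 <= b & forall c n, norm2 (lincomb F c n) <= b * l2norm c n.
Proof.
have [a [b [a0 b0 up lo]]] := frame_bounds Wc Wf.
by exists b => // c n; apply: (@synth_bound _ W).
Qed.

Lemma synthesis_W w : W w -> cvg2 (lincomb F (analysis G w)) (synthesis F (analysis G w)).
Proof.
move=> Ww; have [B B0 HB] := bessel_W; have [b b0 Fb] := synth_frame.
have [f cf] : exists f, cvg2 (lincomb F (analysis G w)) f.
  apply: l2_complete; first by move=> n; exact: L2_lincomb.
  apply: (@lincomb_cauchy _ _ _ (b ^+ 2) ((B * norm2 w) ^+ 2)) => //.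
  - exact: sqr_ge0.
  - by move=> d n; rewrite -sqr_l2norm -exprMn lerXn2r ?nnegrE ?norm2_ge0 ?mulr_ge0 ?l2norm_ge0.
  - by move=> n; rewrite -l2norm_le ?mulr_ge0 ?norm2_ge0//; exact: HB.
exact: synthesis_cvg cf.
Qed.

Lemma norm2_synthesis_le w (M b : R) : W w -> 0 <= b ->
  (forall c n, norm2 (lincomb F c n) <= b * l2norm c n) ->
  (forall n, l2norm (analysis G w) n <= M) -> norm2 (synthesis F (analysis G w)) <= b * M.
Proof.
move=> Ww b0 Fb wM; apply: (real_cvg_le (cvg2_norm (synthesis_W Ww))) => n /=.
by apply: (le_trans (Fb _ _)); rewrite ler_wpM2l.
Qed.

Lemma residual_W w : W w -> norm2 (w - synthesis F (analysis G w)) <= eta * norm2 w.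
Proof.
move=> Ww; have [B B0 HB] := bessel_W; have [b b0 Fb] := synth_frame.
have [C C0 H] := frame_approx Wc Wf.
have wL := WL Ww; have sW := synthesis_W Ww; have [_ sL _] := sW.
apply/ler_addgt0Pr => e e0.
(* In units of [d = e / K] the errors are 1 for replacing [w] by [w'], 1 for the slack in
   [residual_fin], [eta] for comparing [norm2 w'] with [norm2 w], and [b * B] for the change in the
   synthesized sums. *)
pose K := 2 + eta + b * B.
have K0 : 0 < K by rewrite /K ltr_wpDr ?mulr_ge0// ltr_wpDr.
have d0 : 0 < e / K by rewrite divr_gt0.
set d := e / K in d0.
have [n0 [c [_ h1 _]]] := H w _ Ww d0.
set w' := lincomb F c n0 in h1.
have Ww' : W w' by exact: Wlc.
have wL' := WL Ww'.
have [N HN] := residual_fin b0 Fb c n0 d0.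
apply: (real_cvg_le (a := fun j => norm2 (w - lincomb F (analysis G w) (N + j)%N))).
  have h := cvg2_norm (cvg2B (cvg2_cst wL) sW).
  by apply: (cvg_comp (fun j => (N + j)%N) _ _ h); exact: cvg_addnl.
move=> j; set n := (N + j)%N.
have l1 : L2 (lincomb F (analysis G w) n) by exact: L2_lincomb.
have l2 : L2 (lincomb F (analysis G w') n) by exact: L2_lincomb.
apply: (le_trans (norm2_tri wL wL' l1)).
have := norm2_tri wL' l2 l1.
rewrite -lincombB -analysisB// => h2.
have h3 := HN n (leq_addr _ _); rewrite -/w' in h3.
have h4 : norm2 (lincomb F (analysis G (w' - w)) n) <= b * (B * d).
  apply: (le_trans (Fb _ _)); rewrite ler_wpM2l//.
  apply: (le_trans (HB _ _ (closed_sub Wc Ww' Ww))); rewrite ler_wpM2l//.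
  by rewrite norm2BC.
have h5 : eta * norm2 w' <= eta * norm2 w + eta * d.
  rewrite -mulrDr ler_wpM2l// -[w'](subrK w) (le_trans (norm2D _ _))//; first exact: L2B.
  by rewrite addrC lerD2l norm2BC.
have -> : e = K * d by rewrite /d mulrC divfK// gt_eqF.
by rewrite /K; lra.
Qed.

End FrameDual.

Lemma periodic_int (H : cfun) k x : (forall x, H (x + 1) = H x) -> H (x + k%:~R) = H x.
Proof.
move=> H1; have Hn (n : nat) y : H (y + n%:R) = H y.
  elim: n y => [|n IH] y; first by rewrite addr0.
  by rewrite -natr1 addrA H1 IH.
case: k => n; first exact: Hn.
by rewrite NegzE mulrNz -[LHS](Hn n.+1) subrK.
Qed.

End Assembly.

(** * The oblique projection and the bracket *)

Section Projection.
Variable R : realType.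
Local Notation mu := (@lebesgue_measure R).
Local Notation cfun := (R -> R[i]).
Local Notation L2 := (@Lp R 2%:E).
Implicit Types (f g : cfun) (W V : set cfun).

(** The decomposition [f = a + b] holds only almost everywhere. So [f - a] is shown orthogonal to
    [V] by replacing it with [b] inside inner products. *)
Lemma oblique_projP W V f : closed_subspace W -> closed_subspace V ->
  L2_direct_sum W (orthocompl V) -> L2 f ->
  W (oblique_proj W (orthocompl V) f) /\
  orthocompl V (f - oblique_proj W (orthocompl V) f).
Proof.
move=> Wc Vc [WV _] fL.
have [WL _ _ _] := Wc; have [VL _ _ _] := Vc.
have [a [b [Wa [bL Vb] fab]]] := WV f fL.
apply: (@xgetPex _ (cst 0) [set a : cfun | W a /\ orthocompl V (f \- a)]).
exists a; split => //; have aL := WL _ Wa; split; first exact: L2B.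
move=> g Vg; rewrite -[RHS](Vb g Vg); apply: ae_eq_inner.
- by apply: cmeasurableB; exact: L2_cmeasurable.
- exact: L2_cmeasurable (VL _ Vg).
- exact: L2_cmeasurable.
- exact: L2_cmeasurable (VL _ Vg).
- by apply: filterS fab => x /(_ I) h _; rewrite /= h /= addrC addKr.
- exact: aeW.
Qed.

(** A periodic multiplier is constant along the orbit [x + k], so its conjugate comes out of the
    sum; convergence of that sum to [P] is what gives [bracket], a limit of partial sums, its
    meaning at [x]. *)
Lemma bracket_multiplier (f g g' H P P' : cfun) :
  (forall x, H (x + 1) = H x) -> ae (fun x => g' x = H x * g x) ->
  ae (fun x => ccvg (fun n => restr01 (shiftsum (fun x => f x * (g x)^*) n) x) (P x)) ->
  ae (fun x => ccvg (fun n => restr01 (shiftsum (fun x => f x * (g' x)^*) n) x) (P' x)) ->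
  ae (fun x => 0 <= x < 1 -> P' x = (H x)^* * bracket f g x).
Proof.
move=> Hper gg' cP cP'.
apply: (aeS2 _ (ae_shifts gg') (aeS2 (fun x a b => conj a b) cP cP')) => x gx [cx cx'] x01.
have I1 : ind01 x = 1 by rewrite /ind01 x01.
have -> : bracket f g x = P x.
  apply: csumZE; apply: eq_ccvg cx => n; rewrite /restr01 I1 mul1r //.
apply: (ccvg_uniq cx'); apply: eq_ccvg (ccvgZ (H x)^* cx) => n.
rewrite /restr01 I1 !mul1r /shiftsum -psumZc; apply: eq_psum => k.
by rewrite gx (periodic_int k x Hper) rmorphM /=; ring.
Qed.

End Projection.

Theorem corollary8p2 (R : realType) (W V : set (R -> R[i]))
    (phi phi1 phit Ht : R -> R[i]) (eps : R)
    (Wclosed : closed_subspace W) (Vclosed : closed_subspace V)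
    (WV : L2_direct_sum W (orthocompl V))
    (phiL2 : Lp 2%:E phi) (phi1L2 : Lp 2%:E phi1)
    (phi_frame : is_frame W (fun k => translate k phi))
    (phi1_frame : is_frame V (fun k => translate k phi1))
    (phitV : V phit) (HtC2 : Cper 2%:E Ht)
    (phitE : ae_eq lebesgue_measure setT (fourier phit)
               (fun gamma => Ht gamma * fourier phi1 gamma))
    (eps_ge0 : 0 <= eps) (eps_lt1 : eps < 1)
    (bound : {ae lebesgue_measure, forall gamma : R,
       (~` zero_set (periodization2 (fourier phi))) gamma ->
       cabs ((Ht gamma)^* * bracket (fourier phi) (fourier phi1) gamma - 1)
       <= eps / fine (opnorm (oblique_proj W (orthocompl V)))}) :
  is_frame V (fun k => translate k phit) /\
  approx_oblique_dual eps W V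
    (fun k => translate k phi) (fun k => translate k phit).
Proof.
have [WL _ _ _] := Wclosed; have [VL _ _ _] := Vclosed.
have phitL := VL _ phitV.
have pT := is_fourier_exists phiL2; have p1T := is_fourier_exists phi1L2; have qT := is_fourier_exists phitL.
have [_ pL] := is_fourier_L2 pT; have [_ p1L] := is_fourier_L2 p1T; have [_ qL] := is_fourier_L2 qT.
set p := fourier phi in pT pL bound; set q := fourier phit in qT qL phitE.
set p1 := fourier phi1 in p1T p1L bound phitE.
pose proj := oblique_proj W (orthocompl V); rewrite -/proj in bound.
set eta := eps / fine (opnorm proj) in bound.
pose F k := translate k phi; pose G k := translate k phit.
have projP f : Lp 2%:E f -> W (proj f) /\ orthocompl V (f - proj f).
  exact: oblique_projP.
have opn0 : (0 <= opnorm proj)%E.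
  apply: (@le_trans _ _ (norm2 (proj 0))%:E); first by rewrite lee_fin norm2_ge0.
  apply: ereal_sup_ubound; exists 0 => //; split; first exact: L20.
  by rewrite norm2_0 ler01.
have eta0 : 0 <= eta by rewrite divr_ge0// fine_ge0.
have eta_proj f : Lp 2%:E f -> norm2 f <= 1 -> eta * norm2 (proj f) <= eps.
  move=> fL f1.
  have fo : ((norm2 (proj f))%:E <= opnorm proj)%E.
    by apply: ereal_sup_ubound; exists f.
  (* [fine] sends an infinite norm to 0 and division by 0 yields 0, so this case gives [eta = 0] for
     a norm that is 0 or infinite. *)
  have [z0|oN0] := eqVneq (fine (opnorm proj)) 0.
    by rewrite /eta z0 invr0 mulr0 mul0r.
  have ofin : opnorm proj \is a fin_num.
    by case: (opnorm proj) oN0 => //=; rewrite eqxx.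
  have op : 0 < fine (opnorm proj) by rewrite lt0r oN0 fine_ge0.
  rewrite -(fineK ofin) lee_fin in fo.
  by rewrite /eta mulrAC ler_pdivrMr// ler_wpM2l.
have [P [Gd [mP iGd cP bP]]] := periodize (cintegrable_inner pL qL).
have [P1 [_ [_ _ cP1 _]]] := periodize (cintegrable_inner pL p1L).
have Peta : ae (fun t => 0 <= t < 1 ->
    (forall k : int, p (t + k%:~R) = 0) \/ cabs (P t - 1) <= eta).
  have [Hper _] := HtC2; have /ae_eqP qp1 := phitE.
  apply: (aeS2 _ (bracket_multiplier Hper qp1 cP1 cP) bound) => t Pt bt t01.
  (* On [N(Phi)] a vanishing sum of squares forces [p] to be 0 on the whole orbit of [t]; elsewhere
     the assumed bound applies, [P] being the multiplied bracket. *)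
  have [z|z] := pselect (zero_set (periodization2 p) t); last by right; rewrite Pt//; exact: bt.
  left => k; apply/eqP; rewrite -cabs_eq0 -sqrf_eq0; apply/eqP.
  exact: (esum_eq0 (a := fun k => cabs (p (t + k%:~R)) ^+ 2) _ (fun _ => sqr_ge0 _) z).
have GV k : V (G k) by exact: translate_closed phi1_frame _.
have GL k : Lp 2%:E (G k) by exact: VL.
have bfin := bessel_finite pT qT mP iGd cP bP eta0 Peta.
have an_proj f : Lp 2%:E f -> analysis G f = analysis G (proj f).
  move=> fL; have [Wp [_ Vp]] := projP f fL; apply/funext => k.
  apply/eqP; rewrite -subr_eq0 /analysis -innerBl//; last exact: WL.
  by rewrite Vp.
have direct f : Lp 2%:E f -> exists2 w, W w & analysis G f = analysis G w.
  by move=> fL; exists (proj f); [case: (projP f fL)|exact: an_proj].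
have resid f : Lp 2%:E f ->
    norm2 (proj f - synthesis F (analysis G f)) <= eta * norm2 (proj f).
  move=> fL; rewrite an_proj//; have [Wp _] := projP f fL.
  apply: (residual_W Wclosed phi_frame phitL eta0 bfin) => // b b0 Fb c n0.
  exact: (residual_finite pT qT mP iGd cP bP eta0 Peta c n0 b0 Fb).
have [B B0 HB] := bessel_L2 Wclosed phi_frame phitL eta0 bfin direct.
have [b b0 Fb] := synth_frame Wclosed phi_frame.
(* Chosen so that [b * M < 1 - eps], also when [b = 0]: analysis norms at most [M] would then make
   the synthesized vector shorter than [1 - eps]. *)
pose M := (1 - eps) / (2 * (b + 1)).
have M0 : 0 < M by rewrite divr_gt0 ?subr_gt0// mulr_gt0// ltr_wpDl.
have lower f : V f -> exists n, M * norm2 f <= l2norm (analysis G f) n.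
  move=> Vf; have fL := VL _ Vf.
  have [f0|fN0] := eqVneq (norm2 f) 0.
    by exists 0%N; rewrite f0 mulr0 l2norm_ge0.
  have f1 : 0 < norm2 f by rewrite lt0r fN0 norm2_ge0.
  have fi0 : 0 <= (norm2 f)^-1 by rewrite invr_ge0 ltW.
  pose v := scalef (norm2 f)^-1%:C f.
  have vL : Lp 2%:E v by exact: L2Z.
  have Vv : V v by exact: closed_scalef.
  have v1 : norm2 v = 1 by rewrite norm2Z// cabs_real ger0_norm// mulVf.
  have [Wp [_ Vp]] := projP v vL.
  have pvL := WL _ Wp.
  set s := synthesis F (analysis G v).
  have sE : cvg2 (lincomb F (analysis G v)) s.
    rewrite /s an_proj//; exact: (synthesis_W Wclosed phi_frame phitL eta0 bfin).
  have [_ sL _] := sE.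
  have s1 : 1 - eps <= norm2 s.
    (* [v - proj v] is orthogonal to [V], which contains [v], and [v] has norm 1. *)
    have e1 : inner (proj v) v = 1.
      have := Vp _ Vv; rewrite innerBl// innerff// v1 expr1n => /eqP.
      by rewrite subr_eq0 => /eqP <-.
    have e2 : cabs (inner (proj v - s) v) <= eps.
      apply: (le_trans (inner_le (L2B pvL sL) vL)); rewrite v1 mulr1.
      by apply: (le_trans (resid v vL)); apply: eta_proj => //; rewrite v1.
    have e3 := inner_le sL vL; rewrite v1 mulr1 in e3.
    have e4 : 1 <= cabs (inner (proj v - s) v) + cabs (inner s v).
      rewrite -(@cabs1 R) -e1 -[in leLHS](subrK s (proj v)) (@innerDl _ (proj v - s) s v) ?cabsD//.
      exact: L2B.
    lra.
  apply: contrapT => nH.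
  have H n : l2norm (analysis G (proj v)) n <= M.
    rewrite -an_proj// leNgt; apply/negP => h; apply: nH; exists n.
    rewrite mulrC -ler_pdivlMl// mulrC; apply: ltW; apply: (lt_le_trans h).
    rewrite (_ : analysis G v = fun k => (norm2 f)^-1%:C * analysis G f k).
      by rewrite l2normZ cabs_real ger0_norm// mulrC.
    by apply/funext => k; rewrite /analysis innerZl.
  have := norm2_synthesis_le Wclosed phi_frame phitL eta0 bfin Wp b0 Fb H.
  rewrite -an_proj// -/s => /(le_trans s1).
  rewrite leNgt => /negP; apply.
  rewrite /M mulrCA gtr_pMr ?subr_gt0// ltr_pdivrMr ?mulr_gt0 ?ltr_wpDl// mul1r.
  lra.
have frameG : is_frame V G.
  (* Adding [M ^+ 2] to the upper bound guarantees that the two constants are in order. *)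
  split => //; exists (M ^+ 2), (B ^+ 2 + M ^+ 2); split.
  - by rewrite exprn_gt0.
  - by rewrite lerDr sqr_ge0.
  - move=> f Vf; have fL := VL _ Vf.
    have sq0 k : 0 <= cabs (analysis G f k) ^+ 2 by exact: sqr_ge0.
    apply/andP; split.
      have [n Hn] := lower f Vf; apply: le_trans (psum_le_esum n sq0).
      rewrite lee_fin -exprMn -/(sqsum (analysis G f) n) -sqr_l2norm.
      by rewrite lerXn2r ?nnegrE ?l2norm_ge0// mulr_ge0 ?norm2_ge0// ltW.
    apply: esum_le => // n; rewrite lee_fin -/(sqsum (analysis G f) n) -sqr_l2norm.
    apply: (@le_trans _ _ ((B * norm2 f) ^+ 2)).
      by rewrite lerXn2r ?nnegrE ?l2norm_ge0 ?mulr_ge0 ?norm2_ge0//; exact: HB.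
    by rewrite exprMn ler_wpM2r ?sqr_ge0// lerDl sqr_ge0.
split => //; split => //.
apply: ge_ereal_sup => _ [f [fL f1] <-]; rewrite lee_fin.
exact: le_trans (resid f fL) (eta_proj f fL f1).
Qed.
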